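(* Let $B_1\subset\mathbb{R}^2$ be the unit ball. There exists a weakly stationary map $f\in W^{1,2}(B_1,\mathcal{A}_2(\mathbb{R}))$ which is not continuous at $0$.
   Context: $B_1$ is the open unit ball centered at $0$. Q-points. $[[p]]$ denotes the Dirac mass at $p\in\mathbb{R}^n$, and $\mathcal{A}_Q(\mathbb{R}^n)=\{\sum_{i=1}^Q[[p_i]]: p_i\in\mathbb{R}^n\}$, with the metric $\mathcal{G}\big(\sum_i[[p_i]],\sum_i[[s_i]]\big)=\min_{\sigma}\big(\sum_i|p_i-s_{\sigma(i)}|^2\big)^{1/2}$, the minimum over permutations $\sigma$ of $\{1,\dots,Q\}$. Sobolev maps. For $\Omega\subset\mathbb{R}^m$ open, a measurable $f:\Omega\to\mathcal{A}_Q(\mathbb{R}^n)$ is in $W^{1,2}(\Omega,\mathcal{A}_Q(\mathbb{R}^n))$ if there are $\varphi_1,\dots,\varphi_m\in L^2(\Omega)$ such that for every $T\in\mathcal{A}_Q(\mathbb{R}^n)$ the function $x\mapsto\mathcal{G}(f(x),T)$ is in $W^{1,2}(\Omega)$ and $|\partial_j\mathcal{G}(f,T)|\le\varphi_j$ a.e. for all $j$. The minimal such $\varphi_j$ is denoted $|\partial_jf|$ and $|Df|^2=\sum_j|\partial_jf|^2$. Such an $f$ is approximately differentiable a.e.: for a.e. $x$, writing $f(x)=\sum_i[[f_i(x)]]$, there are matrices $Df_i(x)\in\mathbb{R}^{n\times m}$ (with $Df_i(x)=Df_j(x)$ whenever $f_i(x)=f_j(x)$) such that $y\mapsto\sum_i[[f_i(x)+Df_i(x)(y-x)]]$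 is the approximate first-order expansion of $f$ at $x$, and $|Df|^2=\sum_i|Df_i|^2$ a.e. Maps are considered up to a.e. equality; ''not continuous at $0$'' means that no representative of $f$ is continuous at $0$. Weak stationarity. Admissible outer test fields are $\psi(x,u)\in C^\infty(\Omega\times\mathbb{R}^n;\mathbb{R}^n)$ with support in $\Omega'\times\mathbb{R}^n$ for some $\Omega'$ compactly contained in $\Omega$, with $|D_u\psi|\le C<\infty$ and $|\psi|+|D_x\psi|\le C(1+|u|)$ for some constant $C$. Put $$\mathcal{O}(f,\psi)=\int\sum_i\langle Df_i(x):D_x\psi(x,f_i(x))\rangle\,dx+\int\sum_i\langle Df_i(x):D_u\psi(x,f_i(x))\cdot Df_i(x)\rangle\,dx.$$ $f\in W^{1,2}(\Omega,\mathcal{A}_Q(\mathbb{R}^n))$ is weakly stationary if $\mathcal{O}(f,\psi)=0$ for all admissible $\psi$. *)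

(* Defs.v *)
From HB Require Import structures.
From mathcomp Require Import all_boot all_order all_algebra all_fingroup.
From mathcomp Require Import finmap multiset.
From mathcomp Require Import all_classical all_reals all_analysis.

Set Implicit Arguments.
Unset Strict Implicit.
Unset Printing Implicit Defensive.
Import Order.TTheory GRing.Theory Num.Theory numFieldNormedType.Exports.
Local Open Scope classical_set_scope.
Local Open Scope ring_scope.

Section euclidean.
Variable R : realType.

(* The topology of R * R and of 'M[R]_(p, q) is that of the library's sup
   norms; lengths, which the sup norm would get wrong, are always measured by
   [enorm]. *)
Definition mxdot p q (A B : 'M[R]_(p, q)) : R :=
  \sum_i \sum_j A i j * B i j.

Definition enorm p q (A : 'M[R]_(p, q)) : R := Num.sqrt (mxdot A A).

Definition vec2 (z : R * R) : 'cV[R]_2 :=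
  \col_j (if j == 0 then z.1 else z.2).

Definition e2 (j : 'I_2) : R * R := if j == 0 then (1, 0) else (0, 1).

Definition eball (x : R * R) (r : R) : set (R * R) :=
  [set y | enorm (vec2 (y - x)) < r].

Definition leb2 := (@lebesgue_measure R \x @lebesgue_measure R)%E.

End euclidean.

Section smooth.
Variables (R : realType) (V W : normedModType R).

(* For U open. Quantifying over all directions v at every order is the same as
   using the partial derivatives along a basis, V being finite dimensional in
   all uses below. *)
Fixpoint of_class_C (k : nat) (U : set V) (F : V -> W) : Prop :=
  (forall x, U x -> F @ x --> F x) /\
  (if k is k'.+1 then
     forall v, (forall x, U x -> derivable F x v) /\
               of_class_C k' U (fun x => 'D_v F x)
   else True).

Definition smooth (U : set V) (F : V -> W) := forall k, of_class_C k U F.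

End smooth.

Section sobolev.
Variable R : realType.
Implicit Types (Omega : set (R * R)) (g : R * R -> R).

Definition L2 Omega g :=
  measurable_fun Omega g /\
  (@leb2 R).-integrable Omega (fun x => ((g x) ^+ 2)%:E).

Definition test_function Omega (phi : R * R -> R) :=
  [/\ smooth setT phi,
      compact (closure [set x | phi x != 0]) &
      closure [set x | phi x != 0] `<=` Omega].

Definition weak_partial Omega (j : 'I_2) g (h : R * R -> R) :=
  forall phi, test_function Omega phi ->
    \int[@leb2 R]_(x in Omega) (g x * 'D_(e2 R j) phi x) =
    - \int[@leb2 R]_(x in Omega) (h x * phi x).

Definition W12_with_gradient Omega g (h : 'I_2 -> R * R -> R) :=
  L2 Omega g /\ forall j, L2 Omega (h j) /\ weak_partial Omega j g (h j).

End sobolev.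

Section qvalued.
Variables (R : realType) (Q n : nat).
Notation V := 'cV[R]_n.

(* Finite sums of Dirac masses are multisets: [[p]] is [mset p]. *)
Definition dirac_sum (p : 'I_Q -> V) : {mset V}%mset :=
  \big[@msetD V/mset0]_(i < Q) [mset p i]%mset.

Definition AQ := {T : {mset V}%mset | exists p : 'I_Q -> V, T = dirac_sum p}.

Definition qpoint (p : 'I_Q -> V) : AQ :=
  exist _ (dirac_sum p) (ex_intro _ p erefl).

Definition atoms (T : AQ) : 'I_Q -> V := projT1 (cid (proj2_sig T)).

Definition match_dist (p s : 'I_Q -> V) (sigma : 'S_Q) : R :=
  Num.sqrt (\sum_i enorm (p i - s (sigma i)) ^+ 2).

(* The minimum does not depend on the enumerations chosen by [atoms]. *)
Definition Gdist (T S : AQ) : R :=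
  let d := match_dist (atoms T) (atoms S) in
  \big[Num.min/d 1%g]_(sigma : 'S_Q) d sigma.

Definition Gopen (U : set AQ) :=
  forall T, U T -> exists2 r, 0 < r & forall S, Gdist T S < r -> U S.

Implicit Types (Omega : set (R * R)) (f : R * R -> AQ).

(* A map Omega -> AQ is a total function whose values off Omega are never
   looked at. *)
Definition qmeasurable Omega f :=
  forall U, Gopen U -> measurable (Omega `&` f @^-1` U).

Definition qW12 Omega f :=
  qmeasurable Omega f /\
  exists phi : 'I_2 -> R * R -> R,
    (forall j, L2 Omega (phi j)) /\
    forall T : AQ, exists h : 'I_2 -> R * R -> R,
      W12_with_gradient Omega (fun x => Gdist (f x) T) h /\
      forall j, {ae @leb2 R, forall x, Omega x -> `|h j x| <= phi j x}.

Definition qcontinuous_at f (x : R * R) :=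
  (fun y => Gdist (f y) (f x)) @ x --> (0 : R).

Definition density_one (E : set (R * R)) (x : R * R) :=
  (fun r : R => fine (@leb2 R (E `&` eball x r)) / fine (@leb2 R (eball x r)))
    @ 0^'+ --> (1 : R).

Definition approx_diff Omega f (x : R * R)
    (pD : ('I_Q -> V) * ('I_Q -> 'M[R]_(n, 2))) :=
  let: (p, D) := pD in
  [/\ f x = qpoint p,
      (forall i j, p i = p j -> D i = D j) &
      exists E : set (R * R),
        [/\ measurable E, E `<=` Omega, E x, density_one E x &
            (fun y => Gdist (f y) (qpoint (fun i => p i + D i *m vec2 (y - x)))
                      / enorm (vec2 (y - x)))
              @ within E x^' --> (0 : R)]].

(* Such a pair is unique up to a simultaneous permutation of its components,
   and exists at a.e. x when f is in W^{1,2}; the default value is only used on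
   a null set. *)
Definition differential Omega f (x : R * R) :
    ('I_Q -> V) * ('I_Q -> 'M[R]_(n, 2)) :=
  xget (fun=> 0, fun=> 0) [set pD | approx_diff Omega f x pD].

Definition Dx (psi : R * R * V -> V) (x : R * R) (u : V) : 'M[R]_(n, 2) :=
  \matrix_(k, j) ('D_(e2 R j, 0) psi (x, u)) k 0.

Definition Du (psi : R * R * V -> V) (x : R * R) (u : V) : 'M[R]_n :=
  \matrix_(k, l) ('D_(0, delta_mx l 0) psi (x, u)) k 0.

Definition admissible Omega (psi : R * R * V -> V) :=
  [/\ smooth (Omega `*` setT) psi,
      (exists Omega' : set (R * R),
        [/\ open Omega', compact (closure Omega'), closure Omega' `<=` Omega &
            closure [set z | Omega z.1 /\ psi z != 0] `&` (Omega `*` setT)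
              `<=` Omega' `*` setT]) &
      exists C : R, forall x u, Omega x ->
        enorm (Du psi x u) <= C /\
        enorm (psi (x, u)) + enorm (Dx psi x u) <= C * (1 + enorm u)].

(* Extended-real integrals, so that the variation is 0 only if both of them are
   finite. *)
Definition outer_variation Omega f (psi : R * R * V -> V) : \bar R :=
  (\int[@leb2 R]_(x in Omega)
     (let: (p, D) := differential Omega f x in
      \sum_i mxdot (D i) (Dx psi x (p i)))%:E +
   \int[@leb2 R]_(x in Omega)
     (let: (p, D) := differential Omega f x in
      \sum_i mxdot (D i) (Du psi x (p i) *m D i))%:E)%E.

Definition weakly_stationary Omega f :=
  forall psi, admissible Omega psi -> outer_variation Omega f psi = 0%E.

End qvalued.

(* Main.v *)
Require Import Defs.
From HB Require Import structures.
From mathcomp Require Import all_boot all_order all_algebra all_fingroup.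
From mathcomp Require Import finmap multiset.
From mathcomp Require Import all_classical all_reals all_analysis.
From mathcomp Require Import measurable_realfun.
From mathcomp Require Import ring lra.

Set Implicit Arguments.
Unset Strict Implicit.
Unset Printing Implicit Defensive.
Import Order.TTheory GRing.Theory Num.Theory numFieldNormedType.Exports.
Import HBNNSimple.
Local Open Scope classical_set_scope.
Local Open Scope ring_scope.

(** The map is [x |-> [[h x]] + [[- h x]]], where [h] is the positive part of
    [v x = 1 + \sum_k 16 ^- k.+1 * ln (|x - a_k| ^+ 2 / 4)], and the poles
    [a_k = (2 ^- k.+1, 0)] tend to the origin.

    Discontinuity. The series is small on the left half disc, where [v >= 1 / 2],
    whereas [v <= 0], hence [h = 0], on a small disc around each pole. Both
    happen on open sets arbitrarily close to the origin, so changing [h] on a null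
    set does not help ([limit_potential_left], [limit_potential_near_pole]).

    Stationarity. The outer variation of the map is the integral of
    [\sum_j D_j h * D_j (chi (x, h x))], with [chi (x, t) = psi (x, t) - psi (x, - t)].
    Where [h] is positive [v] is harmonic, and [chi (x, h x)] vanishes where [h]
    does. Integrating by parts, no boundary term appears: the kinks of the two
    sheets along the boundary of the set where [v] is positive balance each
    other, while [h] alone is only subharmonic.

    To make this rigorous the series is truncated and the positive part is
    replaced by a smooth cutoff, which vanishes near the poles. The truncated
    maps satisfy the identities by integration along lines
    ([integral_trunc_partial], [integral_trunc_harmonic]), and these pass to the
    limit by dominated convergence ([integral_limit0]). The dominating function
    [energy_bound] exists because positivity of a truncated potential keeps [x]
    out of a disc of squared radius [4 * exp (- 16 ^ k.+1)] around the [k]-th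
    pole. Outside of it the energy of the logarithm is of order [16 ^ k.+1],
    which the square of the weight compensates.

    Sobolev regularity. The distance of the map to a fixed Q-point is an
    explicit function of [h] ([Gdist_sheets]), Lipschitz and smooth off one value
    of [h]; its weak derivatives come from the same limit ([weak_identity]), and
    are bounded by a multiple of the gradient of [h].

    The differential. The variation is written with approximate differentials,
    which have to be identified with the gradients of the two sheets. At
    points off the axis with [v x <> 0], [h] has a first-order expansion
    ([height_linear]); and an approximate differential is unique up to the order
    of its components, because a set of density one meets all small rectangles of
    a given shape ([linear_form_eq0], [approx_diff_unique]). *)

(** * Integrating derivatives along lines *)

Section measure_tools.
Variable R : realType.
Notation mu := (@lebesgue_measure R).
Notation plane := (measurableTypeR R * measurableTypeR R)%type.

(** Countably many squares with rational data exhaust an open set. *)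
Lemma open_measurable2 (U : set (R * R)) : open U -> measurable (U : set plane).
Proof.
move=> oU.
pose r (a b : rat) (k : nat) : set (R * R) :=
  ball (ratr a : R) k.+1%:R^-1 `*` ball (ratr b : R) k.+1%:R^-1.
pose A (n : nat) : set (R * R) :=
  if (@choice.unpickle (rat * rat * nat)%type n) is Some (a, b, k) then
    if `[< r a b k `<=` U >] then r a b k else set0
  else set0.
have -> : U = \bigcup_n A n.
  apply/seteqP; split => [[x y] Uxy|z [n _]]; last first.
    rewrite /A; case: choice.unpickle => // -[[a b] k].
    by case: ifPn => // /asboolP; apply.
  have /nbhs_ballP[e e0 eU] : nbhs (x, y) U by exact: open_nbhs_nbhs.
  have [k ke] : exists k : nat, k.+1%:R^-1 < e / 2.
    by have [k] := ltr_add_invr (divr_gt0 e0 (ltr0n R 2)); rewrite add0r; exists k.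
  have hr (z : R) : exists a : rat, ball (ratr a : R) k.+1%:R^-1 z.
    have [a _ /andP[az1 az2]] : exists2 a : rat, true & z - k.+1%:R^-1 < ratr a < z + k.+1%:R^-1.
      have [a] : exists a : rat, ratr a \in `](z - k.+1%:R^-1), (z + k.+1%:R^-1)[.
        apply: rat_in_itvoo.
        by rewrite ltrD2l gtrN// invr_gt0.
      by rewrite in_itv /= => az; exists a.
    exists a; rewrite -ball_normE/=.
    by rewrite distrC ltr_distlC az1 az2.
  have [a xa] := hr x; have [b yb] := hr y.
  exists (choice.pickle (a, b, k)); [exact: I|rewrite /A choice.pickleK].
  case: ifPn => [_|/asboolP h]; first by split.
  exfalso; apply: h => -[u v] [/= au bv]; apply: eU; split => /=.
  - move: xa au; rewrite -!ball_normE /= (distrC _ x) => xa au.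
    by rewrite (le_lt_trans (ler_distD (ratr a) _ _))// (splitr e) ltrD// (lt_trans _ ke).
  - move: yb bv; rewrite -!ball_normE /= (distrC _ y) => yb bv.
    by rewrite (le_lt_trans (ler_distD (ratr b) _ _))// (splitr e) ltrD// (lt_trans _ ke).
apply: bigcupT_measurable => n; rewrite /A; case: choice.unpickle => [[[a b] k]|//].
case: ifPn => // _.
by apply: (@measurableX _ _ (measurableTypeR R) (measurableTypeR R));
  apply: open_measurable; exact: ball_open.
Qed.

Lemma continuous_measurable2 (D : set (R * R)) (f : R * R -> R) :
  open D -> (forall x, D x -> {for x, continuous f}) ->
  measurable_fun (D : set plane) f.
Proof.
move=> oD cf; apply: (measurability _ (RGenOpens.measurableE R)).
move=> _ [_ [a [b ->] <-]].
apply: open_measurable2; rewrite openE => x [Dx fx].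
have nD : nbhs x D by exact: open_nbhs_nbhs.
have : nbhs (f x) `]a, b[%classic.
  by apply: open_nbhs_nbhs; split => //; exact: interval_open.
move=> /(cf _ Dx) h; rewrite /interior; exact: filterI.
Qed.

(** The integral of a non-negative function is a supremum over the simple
    functions below it, and cutting those off on a null set does not change
    their integrals. This applies to integrands built from a chosen
    differential, whose measurability is not known. *)
Lemma integral_setD_null d (T : measurableType d)
    (m : {measure set T -> \bar R}) (D N : set T) (f : T -> \bar R) :
  measurable N -> m N = 0%E ->
  (\int[m]_(x in D) f x = \int[m]_(x in D `\` N) f x)%E.
Proof.
move=> mN N0.
have pos (g : T -> \bar R) : (forall x, 0 <= g x)%E ->
    (\int[m]_x g x = \int[m]_x (g \_ (~` N)) x)%E.
  move=> g0.
  have r0 x : (0 <= (g \_ (~` N)) x)%E by rewrite /patch; case: ifP.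
  apply/eqP; rewrite eq_le; apply/andP; split; last first.
    rewrite !ge0_integralTE//; apply: ereal_sup_le => _ [h hg <-].
    exists h => // x; apply: (le_trans (hg x)).
    by rewrite /patch; case: ifP.
  rewrite [leLHS]ge0_integralTE//; apply: ge_ereal_sup => _ [h hg <-].
  rewrite -(integralT_nnsfun m h).
  rewrite (@ge0_negligible_integral _ _ _ m setT N)//; last 2 first.
  - by apply/measurable_EFinP.
  - by move=> x _; rewrite lee_fin.
  rewrite setTD integral_nnsfun; last exact: measurableC.
  rewrite (mrestrict h (measurableC mN)) ge0_integralTE//.
  apply: ereal_sup_ubound.
  exists (proj_nnsfun h (measurableC mN)) => // x.
  rewrite -mrestrict /patch; case: ifP => _ //; exact: hg.
rewrite [LHS]integral_mkcond [RHS]integral_mkcond.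
rewrite [LHS]integralE [RHS]integralE !funepos_restrict !funeneg_restrict.
rewrite pos; last by move=> x; rewrite /patch; case: ifP.
rewrite [X in (_ - X)%E]pos; last by move=> x; rewrite /patch; case: ifP.
have DN x : (x \in D `\` N) = (x \in ~` N) && (x \in D).
  by apply/idP/andP; rewrite !inE => -[].
by congr (_ - _)%E; apply: eq_integral => x _; rewrite /patch DN;
  case: (x \in ~` N).
Qed.

(** [g'] vanishes outside of [[-1, 1]] as well, so the integral is taken over an
    interval whose end points are zeros of [g]. *)
Lemma integral_derive_supp (g g' : R -> R) :
  (forall t : R, is_derive t 1 g (g' t)) -> continuous g' ->
  (forall t, 1 <= `|t| -> g t = 0) ->
  (\int[mu]_t (g' t)%:E = 0)%E.
Proof.
move=> dg cg' g0.
have g'0 (t : R) : 1 < `|t| -> g' t = 0.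
  move=> t1.
  have h : \near t, cst 0 t = g t.
    have : \near t, 1 < `|t|.
      apply: (@open_nbhs_nbhs _ t); split => //.
      apply: (@open_comp _ _ (fun x : R => `|x|) [set x | 1 < x]) => [x _|].
        exact: norm_continuous.
      exact: open_gt.
    by apply: filterS => u u1; rewrite g0// ltW.
  have d0 := near_eq_is_derive h (is_derive_cst (0 : R) t 1).
  by rewrite -(@derive_val _ _ _ _ _ _ _ (dg t)) (@derive_val _ _ _ _ _ _ _ d0).
have cg (t : R) : {for t, continuous g}.
  apply: differentiable_continuous; apply/derivable1_diffP.
  exact: (@ex_derive _ _ _ _ _ _ _ (dg t)).
transitivity (\int[mu]_(t in `[(-2)%R, 2%R]) (g' t)%:E)%E.
  rewrite [RHS]integral_mkcond; apply: eq_integral => t _.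
  rewrite /patch; case: ifPn => //; rewrite notin_setE /= in_itv /= => /negP t2.
  rewrite g'0// ltNge; apply: contra t2 => t1.
  by move: t1; rewrite ler_norml => /andP[? ?]; apply/andP; split; lra.
rewrite (@continuous_FTC2 _ g' g).
- by rewrite !g0 ?subee// ?normrN ger0_norm// ler1n.
- by rewrite gtrN.
- exact: continuous_subspaceT.
- split.
  + by move=> t _; exact: (@ex_derive _ _ _ _ _ _ _ (dg t)).
  + exact/cvg_at_right_filter/cg.
  + exact/cvg_at_left_filter/cg.
- by move=> t _; rewrite derive1E (@derive_val _ _ _ _ _ _ _ (dg t)).
Qed.

Definition line (j : 'I_2) (c t : R) : R * R := if j == 0 then (t, c) else (c, t).

(** The potentials below are singular at countably many points, which almost
    every line parallel to an axis avoids: regularity is recorded line by line. *)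
Definition C1line (j : 'I_2) (c : R) (g g' : R * R -> R) :=
  (forall t : R, is_derive t 1 (fun s => g (line j c s)) (g' (line j c t))) /\
  continuous (fun s => g' (line j c s)).

(** All singular points lie on the axis removed here. *)
Definition offaxis : set (R * R) := [set x | x.2 != 0].

Lemma open_offaxis : open offaxis.
Proof.
apply: (@open_comp _ _ snd [set x : R | x != 0]) => [x _|]; last exact: open_neq.
exact: cvg_snd.
Qed.

(** Integration by parts on the plane, by Fubini's theorem. Asking for regularity
    on almost all lines only allows [g] to have singular points. *)
Lemma integral_partial0 (j : 'I_2) (g g' : R * R -> R) :
  (@leb2 R).-integrable offaxis (EFin \o g') ->
  {ae mu, forall c, C1line j c g g'} ->
  (forall x, 1 <= `|x.1| \/ 1 <= `|x.2| -> g x = 0) ->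
  (\int[@leb2 R]_(x in offaxis) (g' x)%:E = 0)%E.
Proof.
move=> ig' C1 g0.
have mO : measurable (offaxis : set plane) by apply: open_measurable2; exact: open_offaxis.
have iG := (iffLR (integrable_mkcond _ mO)) ig'.
have line0 c : C1line j c g g' -> (\int[mu]_t (g' (line j c t))%:E = 0)%E.
  move=> [d1 c1]; apply: (integral_derive_supp d1 c1) => t t1.
  by apply: g0; rewrite /line; case: ifP => _ /=; [left|right].
rewrite integral_mkcond; case: (boolP (j == 0)) => j0.
- rewrite -(integral21_prod_meas1 iG).
  rewrite -[RHS](@integral0 _ _ _ mu setT); apply: ae_eq_integral => //.
    exact: (measurable_fubini_G iG).
  have n0 : {ae mu, forall c : R, c != 0}.
    exists [set 0]; split; [by []|by rewrite lebesgue_measure_set1|].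
    by move=> c /= /negP; rewrite negbK => /eqP.
  apply: (filterS2 (ae_filter_ringOfSetsType mu) _ n0 C1) => c c0 /line0 + _.
  rewrite /fubini_G => <-.
  by apply: eq_integral => t _; rewrite /line j0 /patch mem_set.
- rewrite -(integral12_prod_meas1 iG).
  rewrite -[RHS](@integral0 _ _ _ mu setT); apply: ae_eq_integral => //.
    exact: (measurable_fubini_F iG).
  apply: (@filterS _ _ (ae_filter_ringOfSetsType mu) _ _ _ C1) => c C1c _.
  rewrite /fubini_F -(line0 _ C1c).
  (* A vertical line meets the axis in one point, which is null. *)
  rewrite -[RHS](@integral_setD1 _ _ 0); first last.
    apply: measurable_funTS; apply/measurable_EFinP.
    exact: continuous_measurable_fun C1c.2.
    exact: measurableD.
  rewrite setTD [RHS]integral_mkcond; apply: eq_integral => t _.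
  rewrite /patch /line (negbTE j0); case: (eqVneq t 0) => [->|t0].
    by rewrite ifF ?ifF//; apply/negbTE; rewrite notin_setE /offaxis /= ?eqxx//; exact.
  by rewrite !mem_set//=; exact/eqP.
Qed.

End measure_tools.

(** * Calculus along lines *)

Section calculus.
Variable R : realType.

(** An estimate for all increments differentiates functions given by cases also
    where the cases meet. *)
Lemma is_derive_quad (f : R -> R) (t l C : R) :
  (forall h, `|f (h + t) - f t - h * l| <= C * h ^+ 2) -> is_derive t 1 f l.
Proof.
move=> H.
have C0 : 0 <= C.
  by have := le_trans (normr_ge0 _) (H 1); rewrite expr1n mulr1.
have cv : h^-1 *: (f (h *: (1 : R) + t) - f t) @[h --> 0^'] --> l.
  apply/cvgrPdist_le => /= e e0.
  have d0 : 0 < e / (C + 1) by rewrite divr_gt0// ltr_wpDl.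
  near=> h.
  have h0 : h != 0 by near: h; exact: nbhs_dnbhs_neq.
  have hd : `|h| <= e / (C + 1).
    by near: h; exact: dnbhs0_le.
  rewrite distrC /GRing.scale /= mulr1.
  have -> : h^-1 * (f (h + t) - f t) - l = h^-1 * (f (h + t) - f t - h * l).
    by rewrite [RHS]mulrBr mulKf.
  rewrite normrM normfV ler_pdivrMl ?normr_gt0//.
  apply: (le_trans (H h)).
  rewrite -real_normK ?num_real// expr2 mulrA (mulrC _ e) ler_wpM2r//.
  rewrite (le_trans (ler_wpM2l C0 hd))// mulrCA ler_piMr// ?(ltW e0)//.
  by rewrite ler_pdivrMr ?ltr_wpDl// mul1r lerDl.
by apply: DeriveDef; [apply/cvg_ex; exists l|exact/cvg_lim].
Unshelve. all: by end_near. Qed.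

Lemma is_derive_continuous (f : R -> R) (t l : R) :
  is_derive t 1 f l -> {for t, continuous f}.
Proof.
move=> [d _]; apply: differentiable_continuous; exact/derivable1_diffP.
Qed.

Lemma C1line_continuous j c (g g' : R * R -> R) :
  C1line j c g g' -> continuous (fun s => g (line j c s)).
Proof. by move=> [d _] t; exact: (is_derive_continuous (d t)). Qed.

Lemma C1line_eq j c (g g' h h' : R * R -> R) :
  (forall t, g (line j c t) = h (line j c t)) ->
  (forall t, g' (line j c t) = h' (line j c t)) ->
  C1line j c g g' -> C1line j c h h'.
Proof.
move=> gh gh'; rewrite /C1line.
rewrite (_ : (fun s => h' (line j c s)) = (fun s => g' (line j c s))); last exact/funext.
rewrite (_ : (fun s => h (line j c s)) = (fun s => g (line j c s))); last exact/funext.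
by move=> [d c']; split => // t; rewrite -gh'.
Qed.

Lemma C1lineD j c (g1 g1' g2 g2' : R * R -> R) :
  C1line j c g1 g1' -> C1line j c g2 g2' ->
  C1line j c (fun x => g1 x + g2 x) (fun x => g1' x + g2' x).
Proof.
move=> [d1 c1] [d2 c2]; split=> [t|t]; last exact: cvgD (c1 t) (c2 t).
exact: (@is_deriveD _ _ _ (fun s => g1 (line j c s)) (fun s => g2 (line j c s))
  t 1 _ _ (d1 t) (d2 t)).
Qed.

Lemma C1lineM j c (g1 g1' g2 g2' : R * R -> R) :
  C1line j c g1 g1' -> C1line j c g2 g2' ->
  C1line j c (fun x => g1 x * g2 x) (fun x => g1' x * g2 x + g1 x * g2' x).
Proof.
move=> C1 C2; have [d1 c1] := C1; have [d2 c2] := C2.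
have cc1 := C1line_continuous C1; have cc2 := C1line_continuous C2.
split=> [t|t].
- apply: (@is_derive_eq _ _ _ _ _ _ _ _ (@is_deriveM _ _
    (fun s => g1 (line j c s)) (fun s => g2 (line j c s)) t 1 _ _ (d1 t) (d2 t))).
  by rewrite /GRing.scale /= addrC mulrC.
- apply: cvgD; first exact: (cvgM (c1 t) (cc2 t)).
  exact: (cvgM (cc1 t) (c2 t)).
Qed.

Lemma C1line_comp j c (phi phi' : R -> R) (g g' : R * R -> R) :
  (forall t, is_derive (g (line j c t)) 1 phi (phi' (g (line j c t))) /\
             {for g (line j c t), continuous phi'}) ->
  C1line j c g g' ->
  C1line j c (fun x => phi (g x)) (fun x => phi' (g x) * g' x).
Proof.
move=> hphi C; have cg := C1line_continuous C; have [d cd] := C.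
split=> t.
- have [dp _] := hphi t.
  exact: (@is_derive1_comp _ phi (fun s => g (line j c s)) _ _ _ dp (d t)).
- apply: cvgM; last exact: cd.
  apply: (@continuous_comp _ _ _ (fun s => g (line j c s)) phi'); first exact: cg.
  exact: (hphi t).2.
Qed.

Lemma C1line_cst j c (a : R) : C1line j c (fun=> a) (fun=> 0).
Proof. by split=> t; [exact: is_derive_cst|exact: cvg_cst]. Qed.

Lemma C1line_sum j c n (g g' : nat -> R * R -> R) :
  (forall k, (k < n)%N -> C1line j c (g k) (g' k)) ->
  C1line j c (fun x => \sum_(k < n) g k x) (fun x => \sum_(k < n) g' k x).
Proof.
elim: n => [|n IH] H.
  rewrite (_ : (fun x => _) = fun=> 0); last first.
    by apply/funext => x; rewrite big_ord0.
  rewrite (_ : (fun x => \sum_(k < 0) g' k x) = fun=> 0); last first.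
    by apply/funext => x; rewrite big_ord0.
  exact: C1line_cst.
rewrite (_ : (fun x => _) = (fun x => \sum_(k < n) g k x + g n x)); last first.
  by apply/funext => x; rewrite big_ord_recr.
rewrite (_ : (fun x => \sum_(k < n.+1) g' k x) =
    (fun x => \sum_(k < n) g' k x + g' n x)); last first.
  by apply/funext => x; rewrite big_ord_recr.
by apply: C1lineD; [apply: IH => k kn; apply: H; exact: ltnW|exact: H].
Qed.

Definition coordinate (j : 'I_2) (x : R * R) : R := if j == 0 then x.1 else x.2.

Lemma C1line_coordinate j c : C1line j c (coordinate j) (fun=> 1).
Proof.
split=> t; last exact: cvg_cst.
rewrite (_ : (fun s => _) = id); first exact: is_derive_id.
by apply/funext => s; rewrite /coordinate /line; case: (j == 0).
Qed.

Lemma C1line_coordinate_other j k c : k != j -> C1line j c (coordinate k) (fun=> 0).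
Proof.
move=> kj; rewrite /C1line.
rewrite (_ : (fun s => coordinate k (line j c s)) = fun=> c); last first.
  apply/funext => s; rewrite /coordinate /line.
  by case: j kj => -[|[|//]] ?; case: k => -[|[|//]] ?.
by split=> t; [exact: is_derive_cst|exact: cvg_cst].
Qed.

(** A continuously differentiable approximation from below, as [e] tends to 0,
    of the positive part; it vanishes on the negative half-line, which is what
    removes the logarithmic poles. *)
Definition cutoff (e t : R) : R := Num.sqrt (Num.max t 0 ^+ 2 + e ^+ 2) - e.

Definition cutoff' (e t : R) : R :=
  Num.max t 0 / Num.sqrt (Num.max t 0 ^+ 2 + e ^+ 2).

Lemma is_derive_pos_part_sqr (t : R) :
  is_derive t 1 (fun t : R => Num.max t 0 ^+ 2) (2 * Num.max t 0).
Proof.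
apply: (@is_derive_quad _ _ _ 1) => h.
rewrite !maxEle; case: ifPn; case: ifPn; rewrite -?ltNge => h1 h2;
  rewrite ler_norml; apply/andP; split; nra.
Qed.

Lemma continuous_pos_part : continuous (fun t : R => Num.max t 0).
Proof. by move=> t; apply: continuous_max; [exact: cvg_id|exact: cvg_cst]. Qed.

Lemma is_derive_sqrt_comp (p : R -> R) (t p' : R) :
  0 < p t -> is_derive t 1 p p' ->
  is_derive t 1 (fun t => Num.sqrt (p t)) (p' / (2 * Num.sqrt (p t))).
Proof.
move=> p0 dp.
have := @is_derive1_comp _ Num.sqrt p t _ _ (is_derive1_sqrt p0) dp.
by rewrite mulrC.
Qed.

Lemma is_derive_cutoff (e t : R) : 0 < e -> is_derive t 1 (cutoff e) (cutoff' e t).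
Proof.
move=> e0.
have p0 : 0 < Num.max t 0 ^+ 2 + e ^+ 2.
  by rewrite ltr_wpDl ?sqr_ge0// exprn_gt0.
have dp : is_derive t 1 (fun t : R => Num.max t 0 ^+ 2 + e ^+ 2) (2 * Num.max t 0).
  have := is_deriveD (is_derive_pos_part_sqr t) (is_derive_cst (e ^+ 2) t (1 : R)).
  by rewrite addr0.
have := is_deriveB (@is_derive_sqrt_comp (fun t => Num.max t 0 ^+ 2 + e ^+ 2) t _ p0 dp)
  (is_derive_cst e t (1 : R)).
rewrite subr0 /cutoff' => h; apply: (is_derive_eq h).
by rewrite -mulf_div divff// mul1r.
Qed.

Lemma continuous_cutoff' e : 0 < e -> continuous (cutoff' e).
Proof.
move=> e0 t; apply: cvgM; first exact: continuous_pos_part.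
have p0 : 0 < Num.max t 0 ^+ 2 + e ^+ 2.
  by rewrite ltr_wpDl ?sqr_ge0// exprn_gt0.
apply: cvgV; first by rewrite gt_eqF// sqrtr_gt0.
apply: (@continuous_comp _ _ _ (fun t : R => Num.max t 0 ^+ 2 + e ^+ 2) Num.sqrt).
  apply: cvgD; last exact: cvg_cst.
  by apply: (@is_derive_continuous _ _ _ (is_derive_pos_part_sqr t)).
exact: sqrt_continuous.
Qed.

Lemma cutoff_le0 e t : 0 < e -> t <= 0 -> cutoff e t = 0.
Proof.
move=> e0 t0; rewrite /cutoff max_r// expr0n add0r sqrtr_sqr gtr0_norm//.
by rewrite subrr.
Qed.

Lemma cutoff'_le0 e t : t <= 0 -> cutoff' e t = 0.
Proof. by move=> t0; rewrite /cutoff' max_r// mul0r. Qed.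

Lemma cutoff_ge0 e t : 0 < e -> 0 <= cutoff e t.
Proof.
move=> e0; rewrite /cutoff subr_ge0 -{1}(gtr0_norm e0) -sqrtr_sqr.
by rewrite ler_sqrt ?lerDr ?sqr_ge0// addr_ge0 ?sqr_ge0.
Qed.

Lemma cutoff_le e t : 0 < e -> cutoff e t <= Num.max t 0.
Proof.
move=> e0; rewrite /cutoff lerBlDr.
have m0 : 0 <= Num.max t 0 by rewrite le_max lexx orbT.
rewrite -[leRHS]ger0_norm ?addr_ge0// ?(ltW e0)// -sqrtr_sqr ler_sqrt ?sqr_ge0//.
by rewrite sqrrD -addrA lerD2l lerDr mulrn_wge0// mulr_ge0// ltW.
Qed.

Lemma cutoff'_ge0 e t : 0 <= cutoff' e t.
Proof. by rewrite /cutoff' divr_ge0 ?sqrtr_ge0// le_max lexx orbT. Qed.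

Lemma cutoff'_le1 e t : cutoff' e t <= 1.
Proof.
rewrite /cutoff'; have m0 : 0 <= Num.max t 0 by rewrite le_max lexx orbT.
have [s0|s0] := eqVneq (Num.sqrt (Num.max t 0 ^+ 2 + e ^+ 2)) 0.
  by rewrite s0 invr0 mulr0.
rewrite ler_pdivrMr ?lt_def ?s0 ?sqrtr_ge0// mul1r.
rewrite -{1}(ger0_norm m0) -sqrtr_sqr ler_sqrt ?addr_ge0 ?sqr_ge0//.
by rewrite lerDl sqr_ge0.
Qed.

End calculus.

(** * Potentials with logarithmic poles *)

Section potential.
Variable R : realType.
Notation mu := (@lebesgue_measure R).

(** The poles are the points [(pole k, 0)], which tend to the origin. Their
    weights decrease so fast that, seen from the left half-plane, the logarithms
    of the distances add up to little. *)
Definition pole (k : nat) : R := 2^-1 ^+ k.+1.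

Definition weight (k : nat) : R := 16^-1 ^+ k.+1.

Definition sqdist (k : nat) (x : R * R) : R := (x.1 - pole k) ^+ 2 + x.2 ^+ 2.

Definition offset (k : nat) (j : 'I_2) (x : R * R) : R :=
  if j == 0 then x.1 - pole k else x.2.

(** The factor [1 / 4] makes the logarithms non-positive on the unit disc, so that
    the potentials decrease with [N] there. *)
Definition potential (N : nat) (x : R * R) : R :=
  1 + \sum_(k < N) weight k * ln (sqdist k x / 4).

Definition potential1 (N : nat) (j : 'I_2) (x : R * R) : R :=
  \sum_(k < N) weight k * (2 * offset k j x / sqdist k x).

Definition potential2 (N : nat) (j : 'I_2) (x : R * R) : R :=
  \sum_(k < N) weight k *
    (2 / sqdist k x - 4 * offset k j x ^+ 2 / sqdist k x ^+ 2).

Definition regular_line (j : 'I_2) (c : R) :=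
  forall k t, 0 < sqdist k (line j c t).

Lemma weight_gt0 k : 0 < weight k. Proof. by rewrite exprn_gt0. Qed.

Lemma pole_gt0 k : 0 < pole k. Proof. by rewrite exprn_gt0. Qed.

Lemma pole_le1 k : pole k <= 1.
Proof. by rewrite exprn_ile1// invf_le1// ler1n. Qed.

Lemma sqdist_offaxis k x : x.2 != 0 -> 0 < sqdist k x.
Proof. by move=> x0; rewrite ltr_wpDl ?sqr_ge0// exprn_even_gt0. Qed.

(** Only the countably many lines through a pole are excluded. *)
Lemma regular_line_ae j : {ae mu, forall c, regular_line j c}.
Proof.
have : {ae mu, forall c : R, c != 0 /\ forall k, c != pole k}.
  pose b k : R := if k is k'.+1 then pole k' else 0.
  exists (range b); split.
  - rewrite (_ : range b = \bigcup_k [set b k]).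
      exact: bigcupT_measurable.
    by apply/seteqP; split => [_ [k _ <-]|_ [k _ ->]]; exists k.
  - apply: countable_lebesgue_measure0.
    exact: sub_countable (card_image_le b setT) (countableP _).
  - move=> c /= h; apply: contrapT => cb; apply: h; split=> [|k].
      by apply/eqP => c0; apply: cb; exists 0%N.
    by apply/eqP => ck; apply: cb; exists k.+1.
apply: (@filterS _ _ (ae_filter_ringOfSetsType mu)) => c [c0 cp] k t.
rewrite /sqdist /line; case: ifP => _ /=.
  by rewrite ltr_wpDl ?sqr_ge0// exprn_even_gt0.
by rewrite ltr_wpDr ?sqr_ge0// exprn_even_gt0//= subr_eq0.
Qed.

Lemma C1line_offset j c k : C1line j c (offset k j) (fun=> 1).
Proof.
have := C1lineD (C1line_coordinate j c)
  (C1line_cst j c (- (if j == 0 then pole k else 0))).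
apply: C1line_eq => t; last by rewrite addr0.
by rewrite /coordinate /offset; case: ifP => _ //; rewrite oppr0 addr0.
Qed.

Lemma C1line_offset_other i j c k : i != j -> C1line j c (offset k i) (fun=> 0).
Proof.
move=> ij; have := C1lineD (C1line_coordinate_other c ij)
  (C1line_cst j c (- (if i == 0 then pole k else 0))).
apply: C1line_eq => t; last by rewrite addr0.
by rewrite /coordinate /offset; case: ifP => _ //; rewrite oppr0 addr0.
Qed.

Lemma C1line_sqdist j c k :
  C1line j c (sqdist k) (fun x => 2 * offset k j x).
Proof.
have Cx i : C1line j c (fun x => offset k i x ^+ 2)
    (fun x => if i == j then 2 * offset k j x else 0).
  case: (eqVneq i j) => [->|ij].
    apply: C1line_eq (C1lineM (C1line_offset j c k) (C1line_offset j c k)) => t.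
      by rewrite expr2.
    by rewrite mul1r mulr1 mulr2n mulrDl mul1r.
  have Co := C1line_offset_other c k ij.
  apply: C1line_eq (C1lineM Co Co) => t; first by rewrite expr2.
  by rewrite mul0r mulr0 addr0.
apply: C1line_eq (C1lineD (Cx 0) (Cx 1)) => t; first by [].
by case: j {Cx} => -[|[|//]] ? /=; rewrite ?addr0 ?add0r.
Qed.

Lemma C1line_inv_sqdist j c k : regular_line j c ->
  C1line j c (fun x => (sqdist k x)^-1)
    (fun x => - (2 * offset k j x / sqdist k x ^+ 2)).
Proof.
move=> reg; have := C1line_comp (phi := fun t : R => t^-1)
  (phi' := fun t : R => - (t ^- 2)) _ (C1line_sqdist j c k).
have H t : is_derive (sqdist k (line j c t)) 1 (fun t : R => t^-1)
      (- (sqdist k (line j c t) ^- 2)) /\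
    {for sqdist k (line j c t), continuous (fun t : R => - (t ^- 2))}.
  have s0 : sqdist k (line j c t) != 0 by rewrite gt_eqF.
  split.
    have := is_deriveV (f := id) s0 (is_derive_id (sqdist k (line j c t)) (1 : R)).
    by move=> h; apply: (is_derive_eq h); rewrite /GRing.scale /= mulr1.
  apply: cvgN; apply: cvgV; first by rewrite expf_neq0.
  exact: exprn_continuous.
move=> /(_ H); apply: C1line_eq => t //.
by rewrite mulNr mulrC.
Qed.

Lemma C1line_log j c k : regular_line j c ->
  C1line j c (fun x => ln (sqdist k x / 4)) (fun x => 2 * offset k j x / sqdist k x).
Proof.
move=> reg.
have C4 := C1lineM (C1line_sqdist j c k) (C1line_cst j c 4^-1).
have := C1line_comp (phi := @ln R) (phi' := fun t => t^-1) _ C4.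
have H t : is_derive (sqdist k (line j c t) / 4) 1 (@ln R) (sqdist k (line j c t) / 4)^-1 /\
    {for sqdist k (line j c t) / 4, continuous (fun t : R => t^-1)}.
  have p : 0 < sqdist k (line j c t) / 4 by rewrite divr_gt0.
  split; first exact: is_derive1_ln.
  by apply: cvgV; [rewrite gt_eqF|exact: cvg_id].
move=> /(_ H); apply: C1line_eq => t //.
by have := reg k t => ?; field; rewrite gt_eqF.
Qed.

Lemma C1line_potential N j c : regular_line j c ->
  C1line j c (potential N) (potential1 N j).
Proof.
move=> reg; have Ck k : C1line j c (fun x => weight k * ln (sqdist k x / 4))
    (fun x => weight k * (2 * offset k j x / sqdist k x)).
  apply: C1line_eq (C1lineM (C1line_cst j c (weight k)) (C1line_log k reg)) => t //.
  by rewrite mul0r add0r.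
have := C1lineD (C1line_cst j c 1) (C1line_sum (n := N) (fun k _ => Ck k)).
by apply: C1line_eq => t //; rewrite add0r.
Qed.

Lemma C1line_potential1 N j c : regular_line j c ->
  C1line j c (potential1 N j) (potential2 N j).
Proof.
move=> reg.
have Ck k : C1line j c (fun x => weight k * (2 * offset k j x / sqdist k x))
    (fun x => weight k *
       (2 / sqdist k x - 4 * offset k j x ^+ 2 / sqdist k x ^+ 2)).
  have := C1lineM (C1line_cst j c (weight k * 2))
    (C1lineM (C1line_offset j c k) (C1line_inv_sqdist k reg)).
  apply: C1line_eq => t; first by rewrite !mulrA.
  by have := reg k t => ?; field; rewrite gt_eqF.
exact: (C1line_sum (n := N) (fun k _ => Ck k)).
Qed.

(** The logarithm of the distance is harmonic in the plane. *)
Lemma laplace_potential N x : x.2 != 0 ->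
  potential2 N 0 x + potential2 N 1 x = 0.
Proof.
move=> x2; rewrite -big_split big1//= => k _; rewrite -mulrDr /offset /=.
have := sqdist_offaxis k x2; rewrite /sqdist => s.
by apply/eqP; rewrite mulf_eq0; apply/orP; right; apply/eqP; field; rewrite gt_eqF.
Qed.

End potential.

(** * The limit potential and the energy bound *)

Section potential_bounds.
Variable R : realType.
Notation mu := (@lebesgue_measure R).
Notation plane := (measurableTypeR R * measurableTypeR R)%type.
Notation offaxis := (@offaxis R).
Notation pole := (@pole R).
Notation weight := (@weight R).
Notation B1 := (eball (0 : R * R) 1).

Lemma sum_geometric (m : R) N : 1 < m ->
  \sum_(k < N) m^-1 ^+ k.+1 = (1 - m^-1 ^+ N) / (m - 1).
Proof.
move=> m1; have m0 : m != 0 by rewrite gt_eqF// (lt_trans _ m1).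
have m10 : m - 1 != 0 by rewrite subr_eq0 gt_eqF.
elim: N => [|N IH]; first by rewrite big_ord0 expr0 subrr mul0r.
rewrite big_ord_recr /= IH exprS.
move: (m^-1 ^+ N) => z; field; exact/andP.
Qed.

Lemma sum_geometric_le (m : R) N : 1 < m ->
  \sum_(k < N) m^-1 ^+ k.+1 <= (m - 1)^-1.
Proof.
move=> m1; rewrite sum_geometric// ler_piMl// ?invr_ge0 ?subr_ge0 ?(ltW m1)//.
by rewrite gerBl exprn_ge0// invr_ge0 (le_trans _ (ltW m1)).
Qed.

Lemma sum_weight_le1 N : \sum_(k < N) weight k <= 1.
Proof.
apply: (le_trans (sum_geometric_le N (_ : 1 < 16 :> R))); first by rewrite ltr1n.
by rewrite invf_le1; lra.
Qed.

Lemma cvg_weighted_sum (u : nat -> R) (K : R) : (forall k, `|u k| <= K) ->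
  cvgn (fun N => \sum_(k < N) weight k * u k).
Proof.
move=> uK.
have -> : (fun N => \sum_(k < N) weight k * u k) = series (fun k => weight k * u k).
  by apply/funext => N; rewrite /series /= big_mkord.
apply: normed_cvg; apply: (@series_le_cvg _ _ (fun k => K * weight k)) => [k|k|k|].
- exact: normr_ge0.
- by rewrite mulr_ge0// ?(le_trans _ (uK 0%N))// ltW// weight_gt0.
- by rewrite /= normrM gtr0_norm ?weight_gt0// mulrC ler_wpM2r// ltW// weight_gt0.
- have -> : (fun k => K * weight k) = geometric (K * 16^-1) 16^-1.
    by apply/funext => k; rewrite /= /weight exprS mulrA.
  apply: is_cvg_geometric_series; rewrite ger0_norm ?invr_ge0//.
  by rewrite invf_lt1; lra.
Qed.

Lemma enorm_vec2 (z : R * R) : enorm (vec2 z) = Num.sqrt (z.1 ^+ 2 + z.2 ^+ 2).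
Proof.
rewrite /enorm /mxdot big_ord_recl big_ord_recl big_ord0 !big_ord1 !mxE /=.
by rewrite addr0 -!expr2.
Qed.

Lemma eball_sqr (x y : R * R) r : 0 < r ->
  eball x r y <-> (y.1 - x.1) ^+ 2 + (y.2 - x.2) ^+ 2 < r ^+ 2.
Proof.
move=> r0; rewrite /eball /= enorm_vec2 /= -{1}(gtr0_norm r0) -sqrtr_sqr.
by rewrite ltr_sqrt// exprn_gt0.
Qed.

Lemma B1_sqr (x : R * R) : B1 x <-> x.1 ^+ 2 + x.2 ^+ 2 < 1.
Proof. by rewrite eball_sqr// !subr0 expr1n. Qed.

Lemma open_eball (x : R * R) r : open (eball x r).
Proof.
rewrite /eball; under eq_fun do rewrite enorm_vec2.
apply: (@open_comp _ _ (fun y : R * R => Num.sqrt ((y.1 - x.1) ^+ 2 + (y.2 - x.2) ^+ 2))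
  [set t | t < r]); last exact: open_lt.
move=> y _; apply: (@continuous_comp _ _ _
    (fun y : R * R => (y.1 - x.1) ^+ 2 + (y.2 - x.2) ^+ 2) Num.sqrt).
  have c2 (f : R * R -> R) : {for y, continuous f} ->
      {for y, continuous (fun z => f z ^+ 2)}.
    move=> cf; rewrite (_ : (fun z => f z ^+ 2) = (fun z => f z * f z)).
      exact: (cvgM cf cf).
    by apply/funext => z; rewrite expr2.
  apply: cvgD; apply: c2; apply: cvgB.
  - exact: cvg_fst.
  - exact: cvg_cst.
  - exact: cvg_snd.
  - exact: cvg_cst.
exact: sqrt_continuous.
Qed.

Lemma sqdist_B1 k x : B1 x -> sqdist k x <= 4.
Proof.
move=> /B1_sqr x1; rewrite /sqdist; have := pole_gt0 R k; have := pole_le1 R k.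
have := sqr_ge0 (x.1 + pole k); nra.
Qed.

Lemma ln_sqdist_le0 k x : B1 x -> ln (sqdist k x / 4) <= 0.
Proof. by move=> Bx; apply: ln_le0; rewrite ler_pdivrMr// mul1r sqdist_B1. Qed.

Lemma potential_nincr x N M : B1 x -> (N <= M)%N -> potential M x <= potential N x.
Proof.
move=> Bx NM; rewrite lerD2l -(subnKC NM) big_split_ord /= gerDl.
apply: sumr_le0 => k _.
by rewrite mulr_ge0_le0 ?ln_sqdist_le0// ltW// weight_gt0.
Qed.

Lemma potential_le1 N x : B1 x -> potential N x <= 1.
Proof.
by move=> Bx; rewrite (le_trans (potential_nincr Bx (leq0n N)))// /potential big_ord0 addr0.
Qed.

Lemma potential_term N k x : B1 x -> (k < N)%N ->
  potential N x <= 1 + weight k * ln (sqdist k x / 4).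
Proof.
move=> Bx kN; rewrite /potential (bigD1 (Ordinal kN))//= lerD2l gerDl.
apply: sumr_le0 => i _.
by rewrite mulr_ge0_le0 ?ln_sqdist_le0// ltW// weight_gt0.
Qed.

Lemma expRN_ge n : 4^-1 ^+ n <= expR (- n%:R) :> R.
Proof.
have h : 2^-1 <= expR (- 2^-1) :> R.
  by apply: le_trans (expR_ge1Dx _); lra.
have -> : - n%:R = (2 * n)%:R * (- 2^-1) :> R by rewrite natrM; field.
rewrite expRM_natl.
have -> : 4^-1 ^+ n = 2^-1 ^+ (2 * n) :> R.
  by rewrite exprM expr2; congr (_ ^+ _); lra.
by rewrite lerXn2r// ?nnegrE ?expR_ge0 ?invr_ge0.
Qed.

(** Where the potential is positive no term can be below [- 1], which keeps [x] out
    of the disc [sqdist k x <= 4 * expR (- (weight k)^-1)]; the power of 4 is a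
    lower bound that suits dyadic sums. *)
Lemma sqdist_lower N k x : B1 x -> 0 < sqdist k x -> (k < N)%N ->
  0 < potential N x -> 4 * 4^-1 ^+ (16 ^ k.+1) < sqdist k x.
Proof.
move=> Bx q0 kN p0; rewrite -ltr_pdivlMl// mulrC.
have q40 : 0 < sqdist k x / 4 by rewrite divr_gt0.
apply: (le_lt_trans (expRN_ge _)); rewrite -[ltRHS]lnK ?posrE// ltr_expR.
have := lt_le_trans p0 (potential_term Bx kN).
have -> : (16 ^ k.+1)%:R = (weight k)^-1 :> R by rewrite natrX /weight exprVn invrK.
rewrite -ltrBlDl sub0r => h.
rewrite -[ltLHS]mul1r mulrN -mulNr ltr_pdivrMr ?weight_gt0//.
by rewrite (mulrC (ln _)).
Qed.

(** A majorant of [1 / sqdist k] outside of the disc excluded by [sqdist_lower],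
    made of indicators of concentric squares so that its integral is elementary. *)
Definition dyadic_majorant (k : nat) (x : R * R) : R :=
  \sum_(i < 16 ^ k.+1) 4 ^+ i *
    \1_(`[pole k - 2 * 2^-1 ^+ i, pole k + 2 * 2^-1 ^+ i] `*`
        `[- (2 * 2^-1 ^+ i), 2 * 2^-1 ^+ i]) x.

Lemma indic_ge0 (T : Type) (A : set T) x : 0 <= \1_A x :> R.
Proof. by rewrite indicE; case: (_ \in _). Qed.

(** In the annulus [4 * 4^-1 ^+ i.+1 < sqdist k x <= 4 * 4^-1 ^+ i] the [i]-th term
    alone is at least [1 / sqdist k x]. *)
Lemma inv_sqdist_le (k J : nat) x : 4 * 4^-1 ^+ J < sqdist k x -> sqdist k x <= 4 ->
  (sqdist k x)^-1 <= \sum_(i < J) 4 ^+ i *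
    \1_(`[pole k - 2 * 2^-1 ^+ i, pole k + 2 * 2^-1 ^+ i] `*`
        `[- (2 * 2^-1 ^+ i), 2 * 2^-1 ^+ i]) x.
Proof.
move=> + q4; elim: J => [|J IH]; first by rewrite expr0 mulr1 ltNge q4.
rewrite big_ord_recr /= => qJ.
have [/IH h|qle] := ltP (4 * 4^-1 ^+ J) (sqdist k x).
  by rewrite (le_trans h)// lerDl mulr_ge0 ?indic_ge0// exprn_ge0.
have q0 : 0 < sqdist k x by apply: le_lt_trans qJ; rewrite mulr_ge0 ?exprn_ge0.
have pJ : 0 < 2 * 2^-1 ^+ J :> R by rewrite mulr_gt0 ?exprn_gt0.
have e4 : 4 * 4^-1 ^+ J = (2 * 2^-1 ^+ J) ^+ 2 :> R.
  by rewrite exprMn -exprM mulnC exprM; congr (_ * _ ^+ _); lra.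
rewrite indicE mem_set; last first.
  move: qle; rewrite e4 /sqdist => qle.
  have h (u v : R) : u ^+ 2 + v ^+ 2 <= (2 * 2^-1 ^+ J) ^+ 2 -> `|u| <= 2 * 2^-1 ^+ J.
    move=> uv; rewrite -[leRHS](gtr0_norm pJ) -ler_sqr ?nnegrE// !real_normK ?num_real//.
    by rewrite (le_trans _ uv)// lerDl sqr_ge0.
  split; rewrite /= in_itv /=.
    by have := h _ _ qle; rewrite ler_distl.
  by rewrite addrC in qle; have := h _ _ qle; rewrite ler_norml.
rewrite mulr1 (le_trans (_ : _ <= 4 ^+ J))//; last first.
  rewrite lerDr; apply: sumr_ge0 => i _.
  by rewrite mulr_ge0 ?indic_ge0// exprn_ge0.
rewrite invf_ple ?posrE// ?exprn_gt0// -exprVn (le_trans _ (ltW qJ))//.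
by rewrite exprS mulrA divff// mul1r.
Qed.

(** The inequality of Cauchy and Schwarz against the summable weights [2 ^- k.+1],
    so that the number of terms does not enter. *)
Lemma sqr_sum_le (n : nat) (c : nat -> R) :
  (\sum_(k < n) c k) ^+ 2 <= \sum_(k < n) 2 ^+ k.+1 * c k ^+ 2.
Proof.
elim: n c => [|n IH] c; first by rewrite !big_ord0 expr0n.
rewrite !big_ord_recl /= expr1.
have h (a b : R) : (a + b) ^+ 2 <= 2 * a ^+ 2 + 2 * b ^+ 2.
  by have := sqr_ge0 (a - b); nra.
apply: (le_trans (h _ _)); rewrite lerD2l.
apply: (le_trans (ler_wpM2l _ (IH (fun k => c k.+1)))) => //.
rewrite mulr_sumr; apply: ler_sum => i _ /=.
by rewrite mulrA -exprS.
Qed.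

Lemma offset_sqr_le k j (x : R * R) : offset k j x ^+ 2 <= sqdist k x.
Proof.
rewrite /offset /sqdist; case: ifP => _; first by rewrite lerDl sqr_ge0.
by rewrite lerDr sqr_ge0.
Qed.

Definition energy_coef (k : nat) : R := 4 * 128^-1 ^+ k.+1.

Lemma energy_coefE k : energy_coef k = 4 * (2 ^+ k.+1 * weight k ^+ 2).
Proof.
rewrite /energy_coef /weight -exprM mulnC exprM -exprMn.
by congr (_ * _ ^+ _); lra.
Qed.

Lemma potential1_sqr_le N j x : B1 x -> offaxis x -> 0 < potential N x ->
  potential1 N j x ^+ 2 <= \sum_(k < N) energy_coef k * dyadic_majorant k x.
Proof.
move=> Bx x0 p0.
apply: (le_trans (sqr_sum_le N (fun k => weight k * (2 * offset k j x / sqdist k x)))).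
apply: ler_sum => k _.
have q0 := sqdist_offaxis k x0.
have -> : energy_coef k * dyadic_majorant k x =
    2 ^+ k.+1 * weight k ^+ 2 * (4 * dyadic_majorant k x).
  by rewrite energy_coefE; ring.
rewrite exprMn [leLHS]mulrA.
apply: ler_wpM2l; first by rewrite mulr_ge0// exprn_ge0// ltW// weight_gt0.
apply: (le_trans (_ : _ <= 4 * (sqdist k x)^-1)).
  rewrite expr_div_n exprMn ler_pdivrMr ?exprn_gt0//.
  rewrite expr2 -!mulrA (mulrA _^-1) mulVf ?gt_eqF// mul1r.
  by have := offset_sqr_le k j x; nra.
rewrite ler_wpM2l//; apply: inv_sqdist_le; last exact: sqdist_B1.
exact: sqdist_lower p0.
Qed.

(** An integrable bound for the squares of the gradients [potential1 N], for all
    [N], where [potential N] is positive: the integral of the [k]-th majorant is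
    of order [(weight k)^-1], which the squared weights compensate. *)
Definition energy_bound (x : R * R) : \bar R :=
  (\sum_(k <oo) (energy_coef k * dyadic_majorant k x)%:E)%E.

Lemma energy_term_ge0 k x : 0 <= energy_coef k * dyadic_majorant k x.
Proof.
rewrite mulr_ge0//; first by rewrite mulr_ge0// exprn_ge0.
by apply: sumr_ge0 => i _; rewrite mulr_ge0 ?indic_ge0// exprn_ge0.
Qed.

Lemma energy_bound_ge N x :
  ((\sum_(k < N) energy_coef k * dyadic_majorant k x)%:E <= energy_bound x)%E.
Proof.
rewrite /energy_bound -sumEFin
  -(big_mkord xpredT (fun k => (energy_coef k * dyadic_majorant k x)%:E)).
apply: nneseries_lim_ge => k _ _; rewrite lee_fin; exact: energy_term_ge0.
Qed.

Lemma measurable_dyadic_majorant k :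
  measurable_fun (setT : set plane) (dyadic_majorant k).
Proof.
apply: measurable_sum => i; apply: measurable_funM; first exact: measurable_cst.
apply: measurable_indic.
by apply: (@measurableX _ _ (measurableTypeR R) (measurableTypeR R)).
Qed.

Lemma leb2_rect (a b c d : R) : a <= b -> c <= d ->
  leb2 (`[a, b] `*` `[c, d]) = ((b - a) * (d - c))%:E.
Proof.
have E (x y : R) : x <= y -> mu `[x, y]%classic = (y - x)%:E.
  rewrite lebesgue_measure_itv /= lte_fin; case: ltgtP => // -> _.
  by rewrite subrr.
move=> ab cd; transitivity (mu `[a, b]%classic * mu `[c, d]%classic)%E.
  by rewrite /leb2 product_measure1E.
by rewrite !E// EFinM.
Qed.

(** All squares contribute the same amount, the area of the [i]-th one being
    [16 * 4^-1 ^+ i]. *)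
Lemma integral_dyadic_majorant k :
  (\int[@leb2 R]_x (dyadic_majorant k x)%:E <= (16 * 16 ^+ k.+1)%:E)%E.
Proof.
have mS i : measurable (`[pole k - 2 * 2^-1 ^+ i, pole k + 2 * 2^-1 ^+ i] `*`
        `[- (2 * 2^-1 ^+ i), 2 * 2^-1 ^+ i] : set plane).
  by apply: (@measurableX _ _ (measurableTypeR R) (measurableTypeR R)).
under eq_integral do rewrite /dyadic_majorant -sumEFin.
rewrite ge0_integral_sum//; last first.
  by move=> i; apply/measurable_EFinP; apply: measurable_funM.
rewrite (_ : (16 * 16 ^+ k.+1)%:E = \sum_(i < 16 ^ k.+1) (16%:E : \bar R))%E; last first.
  by rewrite sumEFin sumr_const card_ord -natrX mulr_natr.
apply: lee_sum => i _.
under eq_integral do rewrite EFinM.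
rewrite ge0_integralZl//; last first.
  by apply/measurable_EFinP; exact: measurable_indic.
have p : 0 <= 2 * 2^-1 ^+ i :> R by rewrite mulr_ge0 ?exprn_ge0.
have -> : (\int[@leb2 R]_x (\1_(`[pole k - 2 * 2^-1 ^+ i, pole k + 2 * 2^-1 ^+ i] `*`
    `[- (2 * 2^-1 ^+ i), 2 * 2^-1 ^+ i]) x)%:E = (16 * 2^-1 ^+ i * 2^-1 ^+ i)%:E)%E.
  rewrite integral_indic// setIT.
  have h1 : pole k - 2 * 2^-1 ^+ i <= pole k + 2 * 2^-1 ^+ i by lra.
  have h2 : - (2 * 2^-1 ^+ i) <= 2 * 2^-1 ^+ i :> R by lra.
  apply: (etrans (leb2_rect h1 h2)).
  by congr (_%:E); ring.
rewrite -EFinM lee_fin.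
have -> : 4 ^+ i = (2 ^+ i) ^+ 2 :> R by rewrite -exprM mulnC exprM; congr (_ ^+ _); lra.
rewrite exprVn; have : 2 ^+ i != 0 :> R by rewrite expf_neq0.
move: (2 ^+ i) => z z0.
by rewrite le_eqVlt; apply/orP; left; apply/eqP; field.
Qed.

Lemma measurable_energy_bound : measurable_fun (setT : set plane) energy_bound.
Proof.
apply: ge0_emeasurable_sum => k *; first by rewrite lee_fin energy_term_ge0.
apply/measurable_EFinP; apply: measurable_funM => //.
exact: measurable_dyadic_majorant.
Qed.

Lemma energy_bound_ge0 x : (0 <= energy_bound x)%E.
Proof. by apply: nneseries_ge0 => k *; rewrite lee_fin energy_term_ge0. Qed.

Lemma integrable_energy_bound : (@leb2 R).-integrable setT energy_bound.
Proof.
apply/integrableP; split; first exact: measurable_energy_bound.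
under eq_integral do rewrite gee0_abs ?energy_bound_ge0//.
rewrite integral_nneseries//; last 2 first.
- move=> k; apply/measurable_EFinP; apply: measurable_funM => //.
  exact: measurable_dyadic_majorant.
- by move=> k x _; rewrite lee_fin energy_term_ge0.
apply: (@le_lt_trans _ _ (64%:E)); last exact: ltry.
apply: lime_le.
  by apply: is_cvg_nneseries => k _ _; apply: integral_ge0 => x _; rewrite lee_fin energy_term_ge0.
near=> N.
apply: (@le_trans _ _ (\sum_(0 <= k < N) (64 * 8^-1 ^+ k.+1)%:E)%E).
  apply: lee_sum => k _.
  under eq_integral do rewrite EFinM.
  rewrite ge0_integralZl//; last 3 first.
  - by apply/measurable_EFinP; exact: measurable_dyadic_majorant.
  - move=> x _; rewrite lee_fin; apply: sumr_ge0 => i _.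
    by rewrite mulr_ge0 ?indic_ge0// exprn_ge0.
  - by rewrite lee_fin mulr_ge0// exprn_ge0.
  apply: (le_trans (lee_wpmul2l _ (integral_dyadic_majorant k))).
    by rewrite lee_fin mulr_ge0// exprn_ge0.
  rewrite -EFinM lee_fin /energy_coef mulrACA -exprMn.
  rewrite le_eqVlt; apply/orP; left; apply/eqP; congr (_ * _ ^+ _); lra.
rewrite sumEFin lee_fin big_mkord -mulr_sumr.
rewrite ger_pMr// (le_trans (sum_geometric_le N (_ : 1 < 8 :> R)))//; first by rewrite ltr1n.
by rewrite invf_le1; lra.
Unshelve. all: by end_near. Qed.

Definition limit_potential (x : R * R) : R := limn (fun N => potential N x).

Definition limit_potential1 (j : 'I_2) (x : R * R) : R :=
  limn (fun N => potential1 N j x).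

Lemma cvg_potential x : offaxis x -> potential N x @[N --> \oo] --> limit_potential x.
Proof.
move=> x0; have x20 : 0 < x.2 ^+ 2 by rewrite exprn_even_gt0.
pose m := x.2 ^+ 2 / 4; pose M := ((`|x.1| + 1) ^+ 2 + x.2 ^+ 2) / 4.
have m0 : 0 < m by rewrite divr_gt0.
have M0 : 0 < M by rewrite divr_gt0// ltr_wpDl ?sqr_ge0.
have b k : `|ln (sqdist k x / 4)| <= `|ln m| + `|ln M|.
  have q0 : 0 < sqdist k x / 4 by rewrite divr_gt0// sqdist_offaxis.
  have l1 : ln m <= ln (sqdist k x / 4).
    by rewrite ler_ln ?posrE// ler_pM2r// lerDr sqr_ge0.
  have l2 : ln (sqdist k x / 4) <= ln M.
    rewrite ler_ln ?posrE// ler_pM2r// lerD2r -[leRHS]real_normK ?num_real//.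
    rewrite -[leLHS]real_normK ?num_real// lerXn2r ?nnegrE// [leRHS]ger0_norm ?addr_ge0//.
    by rewrite (le_trans (ler_normB _ _))// lerD2l ger0_norm ?pole_le1// ltW// pole_gt0.
  rewrite ler_norml; apply/andP; split.
    have := ler_norm (- ln m); rewrite normrN.
    by have := normr_ge0 (ln M); lra.
  by rewrite (le_trans l2)// (le_trans (ler_norm _))// lerDr.
have /cvg_ex[l cl] := cvg_weighted_sum b.
apply/cvg_ex; exists (1 + l); exact: (cvgD (cvg_cst _) cl).
Qed.

Lemma cvg_potential1 j x : offaxis x ->
  potential1 N j x @[N --> \oo] --> limit_potential1 j x.
Proof.
move=> x0; have x20 : 0 < `|x.2| by rewrite normr_gt0.
have b k : `|2 * offset k j x / sqdist k x| <= 2 / `|x.2|.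
  have q0 := sqdist_offaxis k x0.
  rewrite normrM normfV (gtr0_norm q0) normrM gtr0_norm// ler_pdivrMr//.
  rewrite -mulrA ler_pM2l// ler_pdivlMl//.
  have := offset_sqr_le k j x; rewrite -(real_normK (num_real (offset k j x))).
  have : `|x.2| ^+ 2 <= sqdist k x by rewrite real_normK ?num_real// lerDr sqr_ge0.
  have := sqr_ge0 (`|x.2| - `|offset k j x|); nra.
exact: (cvg_weighted_sum b).
Qed.

Lemma limit_potential_le N x : B1 x -> offaxis x -> limit_potential x <= potential N x.
Proof.
move=> Bx x0; apply: limr_le; first by apply/cvg_ex; eexists; exact: cvg_potential.
by exists N => // M /= NM; exact: potential_nincr.
Qed.

Lemma limit_potential_le1 x : B1 x -> offaxis x -> limit_potential x <= 1.
Proof.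
by move=> Bx x0; rewrite (le_trans (limit_potential_le 0 Bx x0))// potential_le1.
Qed.

(** On this side [sqdist k x] is at least [pole k ^+ 2], so the logarithms grow
    linearly in [k], and the weights make their sum small. *)
Lemma limit_potential_left x : B1 x -> offaxis x -> x.1 <= 0 ->
  2^-1 <= limit_potential x.
Proof.
move=> Bx x0 x10; apply: limr_ge; first by apply/cvg_ex; eexists; exact: cvg_potential.
near=> N.
have b k : - (3 * 8^-1 ^+ k.+1) <= weight k * ln (sqdist k x / 4).
  have p0 : 0 < pole k ^+ 2 / 4 by rewrite divr_gt0// exprn_gt0// pole_gt0.
  have l1 : ln (pole k ^+ 2 / 4) <= ln (sqdist k x / 4).
    rewrite ler_ln ?posrE// ?divr_gt0// ?sqdist_offaxis// ler_pM2r//.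
    rewrite /sqdist; have := pole_gt0 R k; have := sqr_ge0 x.2; nra.
  have l2 : - (3 * k.+2%:R) <= ln (pole k ^+ 2 / 4).
    have -> : pole k ^+ 2 / 4 = (4 ^+ k.+2)^-1.
      have -> : pole k ^+ 2 = 4^-1 ^+ k.+1.
        by rewrite /pole -exprM mulnC exprM; congr (_ ^+ _); lra.
      by rewrite [in RHS]exprS invfM exprVn mulrC.
    rewrite lnV ?posrE ?exprn_gt0// lerN2 lnXn//.
    have -> : ln 4 *+ k.+2 = ln 4 * k.+2%:R :> R by rewrite mulr_natr.
    have l3 : ln (1 + 3) <= 3 :> R by apply: le_ln1Dx; lra.
    by rewrite ler_wpM2r// (le_trans _ l3)// (_ : 1 + 3 = 4)//; lra.
  apply: (@le_trans _ _ (weight k * - (3 * k.+2%:R))); last first.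
    by rewrite ler_pM2l ?weight_gt0// (le_trans l2).
  (* Half of the decay of [weight k] absorbs the logarithm, as
     [k.+2 <= 2 ^ k.+1]. *)
  rewrite mulrN lerN2 mulrCA ler_pM2l// /weight.
  have -> : 16^-1 = 8^-1 * 2^-1 :> R by lra.
  rewrite exprMn -mulrA ler_piMr ?exprn_ge0// exprVn ler_pdivrMl ?exprn_gt0//.
  by rewrite mulr1 -natrX ler_nat ltn_expl.
have : - (3 / 7) <= \sum_(k < N) weight k * ln (sqdist k x / 4).
  apply: (@le_trans _ _ (\sum_(k < N) - (3 * 8^-1 ^+ k.+1))).
    rewrite sumrN lerN2 -mulr_sumr ler_pM2l//.
    apply: (le_trans (sum_geometric_le N (_ : 1 < 8 :> R))); first by rewrite ltr1n.
    by rewrite lef_pV2 ?posrE; lra.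
  by apply: ler_sum => k _; exact: b.
by rewrite /potential => h; lra.
Unshelve. all: by end_near. Qed.

(** One term is at most [- 1] there, and the others are non-positive. *)
Lemma limit_potential_near_pole k x : B1 x -> offaxis x ->
  sqdist k x <= 4 * expR (- (weight k)^-1) -> limit_potential x <= 0.
Proof.
move=> Bx x0 h; apply: (le_trans (limit_potential_le k.+1 Bx x0)).
apply: (le_trans (potential_term Bx (ltnSn k))).
have q40 : 0 < sqdist k x / 4 by rewrite divr_gt0// sqdist_offaxis.
have : ln (sqdist k x / 4) <= - (weight k)^-1.
  rewrite -[leRHS]expRK ler_ln ?posrE ?expR_gt0//.
  by rewrite ler_pdivrMr// mulrC.
rewrite -(ler_pM2l (weight_gt0 R k)) mulrN divff ?gt_eqF ?weight_gt0// => l; lra.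
Qed.

(** Every term increases with the distance to the axis; the gain of the first one
    persists in the limit. *)
Lemma limit_potential_lt c y z : 0 < `|y| -> `|y| < `|z| ->
  limit_potential (c, y) < limit_potential (c, z).
Proof.
move=> y0 yz; have z0 : 0 < `|z| by exact: lt_trans yz.
have y2 : y != 0 by rewrite -normr_gt0.
have z2 : z != 0 by rewrite -normr_gt0.
have yz2 : y ^+ 2 < z ^+ 2.
  by rewrite -(real_normK (num_real y)) -(real_normK (num_real z)) ltrXn2r ?nnegrE.
have qq k : sqdist k (c, y) < sqdist k (c, z) by rewrite ltrD2l.
have ll k : ln (sqdist k (c, y) / 4) < ln (sqdist k (c, z) / 4).
  by rewrite ltr_ln ?posrE ?divr_gt0 ?sqdist_offaxis// ltr_pM2r.
pose d := weight 0 * (ln (sqdist 0 (c, z) / 4) - ln (sqdist 0 (c, y) / 4)).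
have d0 : 0 < d by rewrite mulr_gt0 ?weight_gt0// subr_gt0.
rewrite -subr_gt0; apply: (lt_le_trans d0).
have cv : potential N (c, z) - potential N (c, y) @[N --> \oo] -->
    limit_potential (c, z) - limit_potential (c, y).
  by apply: cvgB; exact: cvg_potential.
rewrite -(cvg_lim _ cv)//; apply: limr_ge; first by apply/cvg_ex; eexists; exact: cv.
exists 1%N => // -[//|N] _ /=; rewrite /potential !big_ord_recl /= /d.
have : \sum_(i < N) weight (bump 0 i) * ln (sqdist (bump 0 i) (c, y) / 4) <=
    \sum_(i < N) weight (bump 0 i) * ln (sqdist (bump 0 i) (c, z) / 4).
  by apply: ler_sum => i _; rewrite ler_pM2l ?weight_gt0// ltW.
by lra.
Qed.

Lemma ln1D_quadratic (s : R) : `|s| <= 2^-1 -> `|ln (1 + s) - s| <= 2 * s ^+ 2.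
Proof.
rewrite ler_norml => /andP[s1 s2]; have s0 : 0 < 1 + s by lra.
have u : ln (1 + s) <= s by apply: le_ln1Dx; lra.
have l : s - 2 * s ^+ 2 <= ln (1 + s).
  have h : ln (1 + s)^-1 <= (1 + s)^-1 - 1.
    have := @le_ln1Dx R ((1 + s)^-1 - 1); rewrite addrCA subrr addr0; apply.
    by rewrite ltrBrDl subrr invr_gt0.
  move: h; rewrite lnV ?posrE// => h.
  have -> : ln (1 + s) = - - ln (1 + s) by rewrite opprK.
  rewrite lerNr (le_trans h)// lerBlDr -[leLHS]mul1r ler_pdivrMr//.
  have := sqr_ge0 s; nra.
by rewrite ler_norml; apply/andP; split; have := sqr_ge0 s; lra.
Qed.

Lemma log_quadratic k (x h : R * R) : offaxis x ->
  h.1 ^+ 2 + h.2 ^+ 2 <= x.2 ^+ 2 / 64 ->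
  `|ln (sqdist k (x + h) / 4) - ln (sqdist k x / 4)
    - (2 * offset k 0 x / sqdist k x * h.1 + 2 * offset k 1 x / sqdist k x * h.2)|
  <= 19 / x.2 ^+ 2 * (h.1 ^+ 2 + h.2 ^+ 2).
Proof.
move=> x0 hx; have q0 := sqdist_offaxis k x0.
have x20 : 0 < x.2 ^+ 2 by rewrite exprn_even_gt0.
have xq : x.2 ^+ 2 <= sqdist k x by rewrite lerDr sqr_ge0.
(* [sqdist k (x + h) = q * (1 + s)], where [s] is small because
   [p ^+ 2 <= q * n]. *)
pose p := (x.1 - pole k) * h.1 + x.2 * h.2; pose n := h.1 ^+ 2 + h.2 ^+ 2.
pose q := sqdist k x; pose s := (2 * p + n) / q.
have n0 : 0 <= n by rewrite addr_ge0 ?sqr_ge0.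
have pn : p ^+ 2 <= q * n.
  by rewrite /p /q /n /sqdist; have := sqr_ge0 ((x.1 - pole k) * h.2 - x.2 * h.1); nra.
have nq : n <= q / 64 by apply: (le_trans hx); rewrite ler_pM2r.
have sq : s * q = 2 * p + n by rewrite /s -mulrA mulVf ?mulr1// gt_eqF.
have qq : sqdist k (x + h) / 4 = q / 4 * (1 + s).
  have -> : q / 4 * (1 + s) = (q + s * q) / 4 by ring.
  by rewrite sq; congr (_ / _); rewrite /q /sqdist /p /n /=; ring.
have s2 : s ^+ 2 <= 9 * n / q.
  rewrite /s expr_div_n ler_pdivrMr ?exprn_gt0// expr2 mulrA mulfVK ?gt_eqF//.
  have := sqr_ge0 (2 * p - 8 * n); nra.
have s12 : `|s| <= 2^-1.
  rewrite -ler_sqr ?nnegrE// real_normK ?num_real// (le_trans s2)//.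
  by rewrite ler_pdivrMr//; lra.
have s0 : 0 < 1 + s by move: s12; rewrite ler_norml => /andP[? ?]; lra.
rewrite qq lnM ?posrE ?divr_gt0//.
have -> : ln (q / 4) + ln (1 + s) - ln (sqdist k x / 4) -
    (2 * offset k 0 x / sqdist k x * h.1 + 2 * offset k 1 x / sqdist k x * h.2)
  = (ln (1 + s) - s) + n / q.
  rewrite -/q; have -> : s = (2 * p + n) / q by [].
  by rewrite /offset /= /p; field; rewrite gt_eqF.
apply: (le_trans (ler_normD _ _)); rewrite (@ger0_norm _ (n / q)); last first.
  by rewrite divr_ge0// ltW.
apply: (@le_trans _ _ (19 * (n / q))).
  have := ln1D_quadratic s12; have : s ^+ 2 <= 9 * (n / q) by rewrite mulrA. lra.
rewrite -mulrA ler_pM2l// mulrC ler_wpM2r//.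
by rewrite lef_pV2.
Qed.

(** Off the axis, the limit is differentiable: the second-order remainders of the
    truncated potentials are bounded uniformly in the truncation. *)
Lemma limit_potential_quadratic (x h : R * R) : offaxis x ->
  h.1 ^+ 2 + h.2 ^+ 2 <= x.2 ^+ 2 / 64 ->
  `|limit_potential (x + h) - limit_potential x
    - (limit_potential1 0 x * h.1 + limit_potential1 1 x * h.2)|
  <= 19 / x.2 ^+ 2 * (h.1 ^+ 2 + h.2 ^+ 2).
Proof.
move=> x0 hx; have x20 : 0 < x.2 ^+ 2 by rewrite exprn_even_gt0.
have xh0 : offaxis (x + h).
  apply/eqP => /= xh; have hE : h.2 = - x.2 by lra.
  by move: hx; rewrite hE sqrrN; have := sqr_ge0 h.1; lra.
have cv : `|potential N (x + h) - potential N x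
    - (potential1 N 0 x * h.1 + potential1 N 1 x * h.2)| @[N --> \oo] -->
  `|limit_potential (x + h) - limit_potential x
    - (limit_potential1 0 x * h.1 + limit_potential1 1 x * h.2)|.
  apply: cvg_norm; apply: cvgB; first by apply: cvgB; exact: cvg_potential.
  by apply: cvgD; apply: cvgM; do ?exact: cvg_potential1; exact: cvg_cst.
rewrite -(cvg_lim _ cv)//; apply: limr_le; first by apply/cvg_ex; eexists; exact: cv.
near=> N.
rewrite /potential /potential1 opprD addrACA subrr add0r -sumrB !mulr_suml -big_split.
rewrite -sumrB /=.
under eq_bigr => k _ do rewrite -mulrBr -!mulrA -mulrDr -mulrBr.
apply: (le_trans (ler_norm_sum _ _ _)).
apply: (@le_trans _ _ (\sum_(k < N) weight k * (19 / x.2 ^+ 2 * (h.1 ^+ 2 + h.2 ^+ 2)))).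
  apply: ler_sum => k _; rewrite normrM gtr0_norm ?weight_gt0// ler_pM2l ?weight_gt0//.
  by have := log_quadratic k x0 hx; rewrite -!mulrA.
rewrite -mulr_suml ler_piMl ?sum_weight_le1//.
by apply: mulr_ge0; [rewrite divr_ge0// sqr_ge0|rewrite addr_ge0 ?sqr_ge0].
Unshelve. all: by end_near. Qed.

End potential_bounds.

(** * Composite integrands and measurability *)

Section chain_rule.
Variable R : realType.

Lemma mvt_symmetric (f f' : R -> R) (a b : R) :
  (forall t : R, is_derive t 1 f (f' t)) ->
  exists2 c, `|c - a| <= `|b - a| & f b - f a = f' c * (b - a).
Proof.
move=> df; have cf : continuous f by move=> t; exact: (is_derive_continuous (df t)).
case: (ltgtP a b) => [ab|ba|<-].
- have [c] := MVT ab (fun x _ => df x) (continuous_subspaceT cf).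
  rewrite in_itv /= => /andP[ac cb] h; exists c => //.
  by rewrite !gtr0_norm ?subr_gt0// lerD2r ltW.
- have [c] := MVT ba (fun x _ => df x) (continuous_subspaceT cf).
  rewrite in_itv /= => /andP[bc ca] h; exists c.
    by rewrite !ltr0_norm ?subr_lt0// lerN2 lerD2r ltW.
  by rewrite -opprB h -mulrN opprB.
- by exists a; rewrite ?subrr ?mulr0.
Qed.

(** The increment in the first argument, taken at the moving value of the second,
    is handled by the mean value theorem and the continuity of [Gs]; what remains
    is a composition of functions of one variable. *)
Lemma is_derive_chain2 (G Gs Gt : R -> R -> R) (u : R -> R) (s0 u' : R) :
  (forall s t : R, is_derive s 1 (G ^~ t) (Gs s t)) ->
  (forall t : R, is_derive t 1 (G s0) (Gt s0 t)) ->
  {for (s0, u s0), continuous (fun z : R * R => Gs z.1 z.2)} ->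
  is_derive s0 1 u u' ->
  is_derive s0 1 (fun s => G s (u s)) (Gs s0 (u s0) + Gt s0 (u s0) * u').
Proof.
move=> dG1 dG2 cGs du.
pose k s := G s (u s) - G s0 (u s).
have dk : is_derive s0 1 k (Gs s0 (u s0)).
  have cv : h^-1 *: (k (h *: (1 : R) + s0) - k s0) @[h --> 0^'] --> Gs s0 (u s0).
    apply/cvgrPdist_le => /= e e0.
    have /cvgrPdist_le /(_ _ e0) [[A B] /= [nA nB] AB] := cGs.
    have /nbhs_ballP[d /= d0 dA] := nA.
    have cu : {for s0, continuous u} by exact: is_derive_continuous du.
    have nu : \forall h \near 0^', B (u (h + s0)).
      apply: cvg_within; have c0 : (h + s0) @[h --> (0:R)] --> s0.
        by rewrite -[X in _ --> X]add0r; apply: cvgD; [exact: cvg_id|exact: cvg_cst].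
      exact: (c0 _ (cu _ nB)).
    near=> h.
    have h0 : h != 0 by near: h; exact: nbhs_dnbhs_neq.
    have hd : `|h| <= d / 2 by near: h; apply: dnbhs0_le; rewrite divr_gt0.
    have Bu : B (u (h + s0)) by near: h; exact: nu.
    rewrite /k subrr subr0 /GRing.scale /= mulr1.
    have [c c1 ->] := mvt_symmetric s0 (h + s0) (fun s => dG1 s (u (h + s0))).
    rewrite addrK in c1 *; rewrite mulrC mulfK//.
    apply: (AB (c, u (h + s0))); split => //=; apply: dA.
    rewrite -ball_normE /= distrC (le_lt_trans c1)// (le_lt_trans hd)//.
    by rewrite ltr_pdivrMr// ltr_pMr// ltr1n.
  by apply: DeriveDef; [apply/cvg_ex; eexists; exact: cv|exact/cvg_lim].
have := is_deriveD dk (@is_derive1_comp _ (G s0) u s0 _ _ (dG2 (u s0)) du).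
by congr (is_derive _ _ _ _); apply/funext => s; rewrite /k /= subrK.
Unshelve. all: by end_near. Qed.

(** The integrands below are all of the form [fun x => H x (u x)], with [H]
    continuously differentiable in [x] and in the value [u x]. *)
Record C1field (H : R * R -> R -> R) (Hx : 'I_2 -> R * R -> R -> R)
    (Ht : R * R -> R -> R) : Prop := {
  C1field_x : forall (j : 'I_2) (c t s : R),
    is_derive s 1 (fun s => H (line j c s) t) (Hx j (line j c s) t);
  C1field_t : forall (x : R * R) (t : R), is_derive t 1 (H x) (Ht x t);
  C1field_cx : forall j, continuous (fun z : R * R * R => Hx j z.1 z.2);
  C1field_ct : continuous (fun z : R * R * R => Ht z.1 z.2);
  C1field_c : continuous (fun z : R * R * R => H z.1 z.2);
  C1field_out : forall x t, ~ eball 0 1 x ->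
    [/\ H x t = 0, Ht x t = 0 & forall j, Hx j x t = 0] }.

Lemma continuous_pair (T U V : topologicalType) (f : T -> U) (g : T -> V) x :
  {for x, continuous f} -> {for x, continuous g} ->
  {for x, continuous (fun y => (f y, g y))}.
Proof. by move=> cf cg; exact: (cvg_pair cf cg). Qed.

Lemma continuous_line j c : continuous (line j c : R -> R * R).
Proof.
move=> t; rewrite /line; case: (j == 0).
  by apply: continuous_pair; [exact: cvg_id|exact: cvg_cst].
by apply: continuous_pair; [exact: cvg_cst|exact: cvg_id].
Qed.

Lemma C1field_line H Hx Ht j c u u' : C1field H Hx Ht -> C1line j c u u' ->
  C1line j c (fun x => H x (u x)) (fun x => Hx j x (u x) + Ht x (u x) * u' x).
Proof.
move=> CH Cu; have cu := C1line_continuous Cu; have [du cu'] := Cu.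
have cp (K : R * R -> R -> R) : continuous (fun z : R * R * R => K z.1 z.2) ->
    continuous (fun s => K (line j c s) (u (line j c s))).
  move=> cK t; apply: (@continuous_comp _ _ _
    (fun s => (line j c s, u (line j c s))) (fun z : R * R * R => K z.1 z.2)).
    by apply: continuous_pair; [exact: continuous_line|exact: cu].
  exact: cK.
split=> [s0|t].
- apply: (@is_derive_chain2 (fun s t => H (line j c s) t)
    (fun s t => Hx j (line j c s) t) (fun s t => Ht (line j c s) t)
    (fun s => u (line j c s)) s0).
  + by move=> s t; exact: (C1field_x CH).
  + by move=> t; exact: (C1field_t CH).
  + apply: (@continuous_comp _ _ _
      (fun z : R * R => (line j c z.1, z.2)) (fun z : R * R * R => Hx j z.1 z.2)).
      apply: continuous_pair; last exact: cvg_snd.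
      apply: (@continuous_comp _ _ _ fst (line j c)); first exact: cvg_fst.
      exact: continuous_line.
    exact: (C1field_cx CH).
- exact: (cvgD (cp (Hx j) (C1field_cx CH (j := j)) t)
    (cvgM (cp Ht (C1field_ct CH) t) (cu' t))).
Qed.

End chain_rule.

Section regularity.
Variable R : realType.
Notation mu := (@lebesgue_measure R).
Notation plane := (measurableTypeR R * measurableTypeR R)%type.
Notation offaxis := (@offaxis R).
Notation weight := (@weight R).
Notation B1 := (eball (0 : R * R) 1).
Definition punctured : set (R * R) := B1 `&` offaxis.

Lemma continuous_offset k j : continuous (offset k j : R * R -> R).
Proof.
move=> x; rewrite /offset; case: (j == 0); last exact: cvg_snd.
by apply: cvgB; [exact: cvg_fst|exact: cvg_cst].
Qed.

Lemma continuous_sqdist k : continuous (sqdist k : R * R -> R).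
Proof.
move=> x; rewrite (_ : sqdist k = fun x : R * R => offset k 0 x * offset k 0 x +
  offset k 1 x * offset k 1 x); last by apply/funext => y; rewrite /sqdist !expr2.
by apply: cvgD; apply: cvgM; exact: continuous_offset.
Qed.

Lemma continuous_inv_sqdist k (x : R * R) : offaxis x ->
  {for x, continuous (fun x => (sqdist k x)^-1)}.
Proof.
move=> x0; apply: cvgV; last exact: continuous_sqdist.
by rewrite gt_eqF// sqdist_offaxis.
Qed.

Lemma continuous_weighted_sum N (u : nat -> R * R -> R) (x : R * R) :
  (forall k, {for x, continuous (u k)}) ->
  {for x, continuous (fun x => \sum_(k < N) weight k * u k x)}.
Proof.
move=> cu; elim: N => [|N IH].
  rewrite (_ : (fun x => _) = fun=> 0); first exact: cvg_cst.
  by apply/funext => y; rewrite big_ord0.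
rewrite (_ : (fun x => _) =
    (fun x => \sum_(k < N) weight k * u k x + weight N * u N x)); last first.
  by apply/funext => y; rewrite big_ord_recr.
by apply: cvgD; [exact: IH|apply: cvgM; [exact: cvg_cst|exact: cu]].
Qed.

Lemma continuous_potential N (x : R * R) : offaxis x ->
  {for x, continuous (potential N)}.
Proof.
move=> x0; apply: cvgD; first exact: cvg_cst.
apply: (continuous_weighted_sum (u := fun k x => ln (sqdist k x / 4))) => k.
apply: (@continuous_comp _ _ _ (fun x => sqdist k x / 4) (@ln R)).
  by apply: cvgM; [exact: continuous_sqdist|exact: cvg_cst].
by apply: continuous_ln; rewrite divr_gt0// sqdist_offaxis.
Qed.

Lemma continuous_potential1 N j (x : R * R) : offaxis x ->
  {for x, continuous (potential1 N j)}.
Proof.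
move=> x0.
apply: (continuous_weighted_sum (u := fun k x => 2 * offset k j x / sqdist k x)) => k.
apply: cvgM; last exact: continuous_inv_sqdist.
by apply: cvgM; [exact: cvg_cst|exact: continuous_offset].
Qed.

Lemma continuous_potential2 N j (x : R * R) : offaxis x ->
  {for x, continuous (potential2 N j)}.
Proof.
move=> x0; apply: (continuous_weighted_sum (u := fun k x =>
  2 / sqdist k x - 4 * offset k j x ^+ 2 / sqdist k x ^+ 2)) => k.
rewrite (_ : (fun x => _) = fun x => 2 * (sqdist k x)^-1 -
    4 * (offset k j x * offset k j x) * ((sqdist k x)^-1 * (sqdist k x)^-1)).
  apply: cvgB.
    by apply: cvgM; [exact: cvg_cst|exact: continuous_inv_sqdist].
  apply: cvgM; last by apply: cvgM; exact: continuous_inv_sqdist.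
  apply: cvgM; first exact: cvg_cst.
  by apply: cvgM; exact: continuous_offset.
by apply/funext => y; rewrite !expr2 invfM.
Qed.

Lemma open_punctured : open punctured.
Proof. by apply: openI; [exact: open_eball|exact: open_offaxis]. Qed.

Lemma measurable_punctured : measurable (punctured : set plane).
Proof. exact: open_measurable2 open_punctured. Qed.

Lemma measurable_offaxis : measurable (offaxis : set plane).
Proof. exact: open_measurable2 (@open_offaxis R). Qed.

Lemma measurable_limit_potential :
  measurable_fun (offaxis : set plane) (@limit_potential R).
Proof.
apply: (@measurable_fun_cvg _ plane R offaxis (fun N => @potential R N)) => [N|x x0].
  by apply: continuous_measurable2 => [|x x0]; [exact: open_offaxis|exact: continuous_potential].
exact: cvg_potential.
Qed.

Lemma measurable_limit_potential1 j :
  measurable_fun (offaxis : set plane) (@limit_potential1 R j).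
Proof.
apply: (@measurable_fun_cvg _ plane R offaxis (fun N => @potential1 R N j)) => [N|x x0].
  by apply: continuous_measurable2 => [|x x0]; [exact: open_offaxis|exact: continuous_potential1].
exact: cvg_potential1.
Qed.

Lemma axis_null : measurable (~` offaxis : set plane) /\ leb2 (~` offaxis) = 0%E.
Proof.
split; first by apply: measurableC; exact: measurable_offaxis.
transitivity (leb2 (setT `*` [set (0 : R)])).
  congr (leb2 _); apply/seteqP; split => [[x y] /= /negP|[x y] /= [_ ->]].
    by rewrite negbK => /eqP.
  by rewrite /offaxis /= eqxx.
transitivity (mu setT * mu [set 0%R])%E; last first.
  by rewrite [X in (_ * X)%E]lebesgue_measure_set1 mule0.
by rewrite /leb2 product_measure1E.
Qed.

(** On a vertical line the potential is strictly increasing in the distance to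
    the axis, so a level set meets it in at most two points. *)
Lemma level_set_null (l : R) :
  measurable (offaxis `&` (@limit_potential R) @^-1` [set l] : set plane) /\
  leb2 (offaxis `&` (@limit_potential R) @^-1` [set l]) = 0%E.
Proof.
have mA : measurable (offaxis `&` (@limit_potential R) @^-1` [set l] : set plane).
  by apply: measurable_limit_potential => //; exact: measurable_offaxis.
split=> //; rewrite /leb2 /product_measure1; apply: integral0_eq => c _ /=.
have [S0|/set0P[y Sy]] := eqVneq (xsection (offaxis `&` (@limit_potential R) @^-1` [set l]) c) set0.
  by rewrite S0 measure0.
have sub : xsection (offaxis `&` (@limit_potential R) @^-1` [set l]) c `<=` [set y; - y].
  move=> z; move: Sy; rewrite /xsection /= !inE => -[/= y0 yl] [/= z0 zl].
  have [yz|zy|yz] := ltgtP `|y| `|z|.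
  - have := @limit_potential_lt _ c y z; rewrite yl zl ltxx normr_gt0.
    by move=> /(_ y0 yz).
  - have := @limit_potential_lt _ c z y; rewrite yl zl ltxx normr_gt0.
    by move=> /(_ z0 zy).
  - by move/eqP: yz; rewrite eqr_norm2 => /orP[/eqP->|/eqP->]; [left|right; rewrite opprK].
apply: countable_lebesgue_measure0; apply: (sub_countable (subset_card_le sub)).
exact/finite_set_countable/finite_set2.
Qed.

Lemma cvg_cutoff (e u : nat -> R) (l : R) :
  (forall n, 0 < e n) -> e @ \oo --> 0 -> u @ \oo --> l ->
  cutoff (e n) (u n) @[n --> \oo] --> Num.max l 0.
Proof.
move=> e0 ce cu.
have cm : Num.max (u n) 0 @[n --> \oo] --> Num.max l 0.
  exact: (@cvg_comp _ _ _ _ (fun t : R => Num.max t 0) _ _ _ cu (@continuous_pos_part R l)).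
apply: (@squeeze_cvgr _ _ _ _ (fun n => Num.max (u n) 0 - e n) (fun n => Num.max (u n) 0)).
- near=> n; rewrite cutoff_le// andbT /cutoff lerD2r.
  have m0 : 0 <= Num.max (u n) 0 by rewrite le_max lexx orbT.
  by rewrite -{1}(ger0_norm m0) -sqrtr_sqr ler_sqrt ?addr_ge0 ?sqr_ge0// lerDl sqr_ge0.
- by rewrite -[X in _ --> X]subr0; exact: cvgB.
- exact: cm.
Unshelve. all: by end_near. Qed.

(** At [l = 0] the limit would depend on the rates of convergence. *)
Lemma cvg_cutoff' (e u : nat -> R) (l : R) : l != 0 ->
  e @ \oo --> 0 -> u @ \oo --> l ->
  cutoff' (e n) (u n) @[n --> \oo] --> ((0 < l)%R%:R : R).
Proof.
move=> l0 ce cu; case: (ltgtP 0 l) l0 => // [lp|ln] _.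
- have cm : Num.max (u n) 0 @[n --> \oo] --> l.
    have := @cvg_comp _ _ _ _ (fun t : R => Num.max t 0) _ _ _ cu (@continuous_pos_part R l).
    by rewrite max_l// ltW.
  have -> : (true%:R : R) = l / Num.sqrt (l * l + 0 * 0).
    by rewrite mulr0 addr0 -expr2 sqrtr_sqr gtr0_norm// divff// gt_eqF.
  rewrite /cutoff'; apply: cvgM => //; apply: cvgV.
    by rewrite mulr0 addr0 -expr2 sqrtr_sqr normr_eq0 gt_eqF.
  apply: (@cvg_comp _ _ _ (fun n => Num.max (u n) 0 ^+ 2 + e n ^+ 2) Num.sqrt _
    (nbhs (l * l + 0 * 0))); last exact: sqrt_continuous.
  by apply: cvgD; under eq_fun do rewrite expr2; exact: cvgM.
- apply: cvg_near_cst.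
  have : \forall n \near \oo, u n < 0.
    by apply: (cvgr_lt _ cu).
  by apply: filterS => n un; rewrite cutoff'_le0// ltW.
Qed.

End regularity.

(** * Identities for the truncated potentials *)

Section identities.
Variable R : realType.
Notation mu := (@lebesgue_measure R).
Notation plane := (measurableTypeR R * measurableTypeR R)%type.
Notation offaxis := (@offaxis R).
Notation punctured := (@punctured R).
Notation weight := (@weight R).
Notation B1 := (eball (0 : R * R) 1).

Lemma B1_bounded (x : R * R) : 1 <= `|x.1| \/ 1 <= `|x.2| -> ~ B1 x.
Proof.
move=> h /B1_sqr; rewrite -(real_normK (num_real x.1)) -(real_normK (num_real x.2)).
have := sqr_ge0 `|x.1|; have := sqr_ge0 `|x.2|.
by case: h => h; have := normr_ge0 x.1; have := normr_ge0 x.2; nra.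
Qed.

Lemma measurable_B1 : measurable (B1 : set plane).
Proof. apply: open_measurable2; exact: open_eball. Qed.

Lemma leb2_B1_lty : (leb2 B1 < +oo)%E.
Proof.
apply: (@le_lt_trans _ _ (leb2 (`[(- 1)%R, 1%R] `*` `[(- 1)%R, 1%R]))).
  apply: le_measure; rewrite ?inE.
  - exact: measurable_B1.
  - by apply: (@measurableX _ _ (measurableTypeR R) (measurableTypeR R)).
  - move=> x Bx; split; rewrite /= in_itv /= -ler_norml leNgt; apply/negP => h;
      apply: (@B1_bounded x _ Bx); [left|right]; exact: ltW.
by rewrite leb2_rect ?ltry//; lra.
Qed.

Lemma leb2_punctured_lty : (leb2 punctured < +oo)%E.
Proof.
apply: le_lt_trans leb2_B1_lty; apply: le_measure; rewrite ?inE.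
- exact: measurable_punctured.
- exact: measurable_B1.
- by move=> x [].
Qed.

Lemma bounded_integrable_punctured (g : R * R -> R) (M : R) :
  measurable_fun (punctured : set plane) g ->
  (forall x, punctured x -> `|g x| <= M) ->
  (@leb2 R).-integrable punctured (EFin \o g).
Proof.
move=> mg gM; apply: measurable_bounded_integrable => //.
- exact: measurable_punctured.
- exact: leb2_punctured_lty.
- exists M; split; first exact: num_real.
  by move=> y My x xp /=; rewrite (le_trans (gM x xp))// ltW.
Qed.

(** [integral_partial0] on the disc, where a bound provides the integrability. *)
Lemma integral_punctured0 (j : 'I_2) (g g' : R * R -> R) (M : R) :
  (forall x, offaxis x -> {for x, continuous g'}) ->
  (forall x, punctured x -> `|g' x| <= M) ->
  {ae mu, forall c, C1line j c g g'} ->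
  (forall x, ~ B1 x -> g x = 0 /\ g' x = 0) ->
  (\int[@leb2 R]_(x in punctured) (g' x)%:E = 0)%E.
Proof.
move=> cg' gM C1 g0.
have mO := @measurable_offaxis R; have mP := @measurable_punctured R.
have mg' : measurable_fun (offaxis : set plane) g'.
  by apply: continuous_measurable2 => //; exact: open_offaxis.
have PO : punctured `<=` offaxis by move=> x [].
have ip : (@leb2 R).-integrable punctured (EFin \o g').
  apply: bounded_integrable_punctured gM.
  by apply: measurable_funS mg'.
have E : ((EFin \o g') \_ punctured = (EFin \o g') \_ offaxis)%R.
  apply/funext => x; rewrite /patch /=.
  have [xO|xO] := boolP (x \in offaxis); last first.
    by rewrite ifN//; apply: contra xO; rewrite !inE => /PO.
  case: ifPn => // /negP xP; rewrite (g0 x _).2// => Bx; apply: xP.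
  by rewrite inE; split => //; rewrite inE in xO.
have io : (@leb2 R).-integrable offaxis (EFin \o g').
  apply/(integrable_mkcond _ mO); rewrite -E; exact/(integrable_mkcond _ mP).
have := integral_partial0 io C1 (fun x h => (g0 x (B1_bounded h)).1).
by rewrite integral_mkcond -[X in (\int[_]_x X x)%E]E -integral_mkcond.
Qed.

(** Where [potential N] is positive, [sqdist_lower] keeps the point away from its
    finitely many poles. *)
Lemma potential_bounded N : exists M : R, 0 <= M /\ forall x, punctured x ->
  0 < potential N x -> forall j, `|potential1 N j x| <= M /\ `|potential2 N j x| <= M.
Proof.
pose S k : R := \sum_(i < 16 ^ k.+1) 4 ^+ i.
have S0 k : 0 <= S k by apply: sumr_ge0 => i _; rewrite exprn_ge0.
have inv N' k x : punctured x -> 0 < potential N' x -> (k < N')%N ->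
    (sqdist k x)^-1 <= S k.
  move=> [Bx x0] p0 kN.
  apply: (le_trans (inv_sqdist_le (sqdist_lower Bx (sqdist_offaxis k x0) kN p0)
    (sqdist_B1 k Bx))).
  by apply: ler_sum => i _; rewrite ler_piMr ?exprn_ge0.
exists (\sum_(k < N) 6 * S k); split.
  by apply: sumr_ge0 => k _; rewrite mulr_ge0.
move=> x Px p0 j; have [Bx x0] := Px.
have w1 k : weight k <= 1 by rewrite exprn_ile1// invf_le1; lra.
split; apply: (le_trans (ler_norm_sum _ _ _)); apply: ler_sum => k _;
  have q0 := sqdist_offaxis k x0; have iS := inv N k x Px p0 (ltn_ord k);
  have i0 : 0 < (sqdist k x)^-1 by rewrite invr_gt0.
- rewrite normrM gtr0_norm ?weight_gt0//.
  apply: (@le_trans _ _ `|2 * offset k j x / sqdist k x|).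
    by rewrite ler_piMl.
  rewrite normrM (gtr0_norm i0) (le_trans _ (ler_wpM2l _ iS))// ler_wpM2r ?(ltW i0)//.
  rewrite normrM gtr0_norm//.
  have : `|offset k j x| ^+ 2 <= 2 ^+ 2.
    rewrite real_normK ?num_real// (le_trans (offset_sqr_le k j x))//.
    by rewrite (le_trans (sqdist_B1 k Bx))//; lra.
  by rewrite ler_sqr ?nnegrE// => h; lra.
- rewrite normrM gtr0_norm ?weight_gt0//.
  apply: (@le_trans _ _ `|2 / sqdist k x - 4 * offset k j x ^+ 2 / sqdist k x ^+ 2|).
    by rewrite ler_piMl.
  rewrite (le_trans _ (ler_wpM2l _ iS))//.
  have o1 := offset_sqr_le k j x; have o0 := sqr_ge0 (offset k j x).
  have -> : 2 / sqdist k x - 4 * offset k j x ^+ 2 / sqdist k x ^+ 2 =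
    (2 - 4 * (offset k j x ^+ 2 / sqdist k x)) * (sqdist k x)^-1.
    by field; rewrite gt_eqF.
  rewrite normrM (gtr0_norm i0) ler_wpM2r ?(ltW i0)//.
  have r0 : 0 <= offset k j x ^+ 2 / sqdist k x by rewrite divr_ge0// ltW.
  have r1 : offset k j x ^+ 2 / sqdist k x <= 1 by rewrite ler_pdivrMr// mul1r.
  by rewrite ler_norml; apply/andP; split; lra.
Qed.

(** The cutoff removes the poles. Its parameter is tied to [N] so that a single
    limit gives the positive part of the limit potential. *)
Definition truncation (N : nat) (x : R * R) : R := cutoff N.+1%:R^-1 (potential N x).

Definition truncation1 (N : nat) (j : 'I_2) (x : R * R) : R :=
  cutoff' N.+1%:R^-1 (potential N x) * potential1 N j x.

Lemma C1line_trunc N j c : regular_line j c ->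
  C1line j c (truncation N) (truncation1 N j).
Proof.
move=> reg; apply: (C1line_comp (phi := cutoff N.+1%:R^-1) (phi' := cutoff' N.+1%:R^-1)).
  by move=> t; split; [exact: is_derive_cutoff|exact: continuous_cutoff'].
exact: C1line_potential.
Qed.

Lemma continuous_trunc N (x : R * R) : offaxis x -> {for x, continuous (truncation N)}.
Proof.
move=> x0; apply: (@continuous_comp _ _ _ (potential N) (cutoff N.+1%:R^-1)).
  exact: continuous_potential.
have N0 : 0 < N.+1%:R^-1 :> R by rewrite invr_gt0.
exact: (is_derive_continuous (is_derive_cutoff _ N0)).
Qed.

Lemma continuous_trunc1 N j (x : R * R) : offaxis x ->
  {for x, continuous (truncation1 N j)}.
Proof.
move=> x0; apply: cvgM; last exact: continuous_potential1.
apply: (@continuous_comp _ _ _ (potential N) (cutoff' N.+1%:R^-1)).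
  exact: continuous_potential.
by apply: continuous_cutoff'; rewrite invr_gt0.
Qed.

Lemma truncation_itv N x : B1 x -> 0 <= truncation N x <= 1.
Proof.
move=> Bx; rewrite cutoff_ge0 ?invr_gt0//= (le_trans (cutoff_le _ _)) ?invr_gt0//.
by rewrite ge_max potential_le1// ler01.
Qed.

Lemma trunc_le0 N x : potential N x <= 0 -> truncation N x = 0 /\ forall j, truncation1 N j x = 0.
Proof.
move=> p0; split; first by rewrite /truncation cutoff_le0 ?invr_gt0.
by move=> j; rewrite /truncation1 cutoff'_le0 ?mul0r.
Qed.

Lemma trunc1_le N j x : `|truncation1 N j x| <= `|potential1 N j x|.
Proof.
by rewrite /truncation1 normrM ger0_norm ?cutoff'_ge0// ler_piMl// cutoff'_le1.
Qed.

Lemma continuous_field (K : R * R -> R -> R) (u : R * R -> R) (x : R * R) :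
  continuous (fun z : R * R * R => K z.1 z.2) -> {for x, continuous u} ->
  {for x, continuous (fun x => K x (u x))}.
Proof.
move=> cK cu; apply: (@continuous_comp _ _ _ (fun x => (x, u x))
  (fun z : R * R * R => K z.1 z.2)); last exact: cK.
by apply: continuous_pair; [exact: cvg_id|exact: cu].
Qed.

Definition field_bounded (H Ht : R * R -> R -> R) (Hx : 'I_2 -> R * R -> R -> R) (K : R) :=
  forall x t, B1 x -> 0 <= t <= 1 ->
    [/\ `|H x t| <= K, `|Ht x t| <= K & forall j, `|Hx j x t| <= K].

(** The integrand is the [j]-th partial derivative of [H x (truncation N x)], which
    vanishes outside of the disc. *)
Lemma integral_trunc_partial N j H Hx Ht K : C1field H Hx Ht -> field_bounded H Ht Hx K ->
  (\int[@leb2 R]_(x in punctured)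
     (Hx j x (truncation N x) + Ht x (truncation N x) * truncation1 N j x)%:E = 0)%E.
Proof.
move=> CH HK; have [M [M0 MP]] := potential_bounded N.
apply: (@integral_punctured0 j (fun x => H x (truncation N x)) _ (K + K * M)).
- move=> x x0.
  have cT := continuous_trunc (N := N) x0.
  have c1 := continuous_field (C1field_cx CH (j := j)) cT.
  have c2 := continuous_field (C1field_ct CH) cT.
  exact: (cvgD c1 (cvgM c2 (continuous_trunc1 (N := N) (j := j) x0))).
- move=> x Px; have [Bx x0] := Px.
  have [_ h2 /(_ j) h3] := HK x _ Bx (truncation_itv N Bx).
  have K0 : 0 <= K by exact: le_trans (normr_ge0 _) h2.
  have t1 : `|truncation1 N j x| <= M.
    have [p0|p0] := ltP 0 (potential N x); last by rewrite (trunc_le0 p0).2 normr0.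
    exact: le_trans (trunc1_le _ _ _) (MP x Px p0 j).1.
  by rewrite (le_trans (ler_normD _ _))// lerD// normrM ler_pM.
- apply: (@filterS _ _ (ae_filter_ringOfSetsType mu) _ _ _ (regular_line_ae R j)).
  move=> c reg; exact: (C1field_line CH (C1line_trunc N reg)).
- move=> x Bx; have [-> -> ->] := C1field_out CH (truncation N x) Bx.
  by rewrite mul0r addr0.
Qed.

(** Stationarity of the truncations: integration by parts produces the Laplacian
    of [potential N], which is zero away from the poles, near which the factor
    [H x (truncation N x)] vanishes. *)
Lemma integral_trunc_harmonic N H Hx Ht K : C1field H Hx Ht -> field_bounded H Ht Hx K ->
  (forall x, H x 0 = 0) -> (forall j x, Hx j x 0 = 0) ->
  (\int[@leb2 R]_(x in punctured)
     (\sum_(j < 2) potential1 N j x *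
        (Hx j x (truncation N x) + Ht x (truncation N x) * truncation1 N j x))%:E = 0)%E.
Proof.
move=> CH HK H0 Hx0; have [M [M0 MP]] := potential_bounded N.
have mP := @measurable_punctured R.
pose g j x := potential1 N j x * H x (truncation N x).
pose g' j x := potential2 N j x * H x (truncation N x) +
  potential1 N j x * (Hx j x (truncation N x) + Ht x (truncation N x) * truncation1 N j x).
have cg' j x : offaxis x -> {for x, continuous (g' j)}.
  move=> x0; have cT := continuous_trunc (N := N) x0.
  have c0 := continuous_field (C1field_c CH) cT.
  have c1 := continuous_field (C1field_cx CH (j := j)) cT.
  have c2 := continuous_field (C1field_ct CH) cT.
  have c3 := continuous_potential1 (N := N) (j := j) x0.
  have c4 := continuous_potential2 (N := N) (j := j) x0.
  have c5 := continuous_trunc1 (N := N) (j := j) x0.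
  exact: (cvgD (cvgM c4 c0) (cvgM c3 (cvgD c1 (cvgM c2 c5)))).
have bg' j x : punctured x -> `|g' j x| <= M * K + M * (K + K * M).
  move=> Px; have [Bx x0] := Px.
  have [h1 h2 /(_ j) h3] := HK x _ Bx (truncation_itv N Bx).
  have K0 : 0 <= K by exact: le_trans (normr_ge0 _) h2.
  have [p0|p0] := ltP 0 (potential N x); last first.
    rewrite /g' (trunc_le0 p0).1 (trunc_le0 p0).2 H0 Hx0 !(mulr0, addr0) normr0.
    by rewrite addr_ge0// mulr_ge0// addr_ge0// mulr_ge0.
  have [m1 m2] := MP x Px p0 j; have m3 := le_trans (trunc1_le N j x) m1.
  rewrite (le_trans (ler_normD _ _))// lerD// normrM ler_pM//.
  by rewrite (le_trans (ler_normD _ _))// lerD// normrM ler_pM.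
have ig' j : (@leb2 R).-integrable punctured (EFin \o g' j).
  apply: bounded_integrable_punctured (bg' j).
  apply: continuous_measurable2; first exact: open_punctured.
  by move=> x [_ x0]; exact: cg'.
have i0 j : (\int[@leb2 R]_(x in punctured) (g' j x)%:E = 0)%E.
  apply: (@integral_punctured0 j (g j) _ (M * K + M * (K + K * M))).
  - by move=> x; exact: cg'.
  - exact: bg'.
  - apply: (@filterS _ _ (ae_filter_ringOfSetsType mu) _ _ _ (regular_line_ae R j)).
    move=> c reg; exact: (C1lineM (C1line_potential1 N reg) (C1field_line CH (C1line_trunc N reg))).
  - move=> x Bx; have [h1 h2 h3] := C1field_out CH (truncation N x) Bx.
    by rewrite /g /g' h1 h2 h3 mul0r addr0 !mulr0 addr0.
transitivity (\int[@leb2 R]_(x in punctured) ((g' 0 x)%:E + (g' 1 x)%:E))%E.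
  apply: eq_integral => x; rewrite inE => -[Bx x0].
  rewrite -EFinD; congr (_%:E); rewrite !big_ord_recl big_ord0 addr0 /g'.
  have -> : lift ord0 ord0 = 1 :> 'I_2 by apply/val_inj.
  rewrite addrACA -mulrDl laplace_potential// mul0r add0r.
  by congr (_ + _).
rewrite integralD//; [|exact: ig'|exact: ig'].
by rewrite [X in (X + _)%E]i0 [X in (_ + X)%E]i0 adde0.
Qed.

Lemma integrable_energy (C : R) :
  (@leb2 R).-integrable punctured (fun x => C%:E * (1 + energy_bound x))%E.
Proof.
have mP := @measurable_punctured R.
have i1 : (@leb2 R).-integrable punctured (EFin \o (fun=> 1)).
  by apply: (@bounded_integrable_punctured _ 1) => [|x _]; [exact: measurable_cst|rewrite normr1].
have iE0 : (@leb2 R).-integrable punctured (@energy_bound R).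
  by apply: (integrableS _ _ _ (integrable_energy_bound R)) => //; exact: measurableT.
exact: (integrableZl mP C (integrableD mP i1 iE0)).
Qed.

Lemma integrable_energy_dominated (g : R * R -> R) (C : R) :
  measurable_fun (punctured : set plane) g ->
  (forall x, punctured x -> (`|g x|%:E <= C%:E * (1 + energy_bound x))%E) ->
  (@leb2 R).-integrable punctured (EFin \o g).
Proof.
move=> mg bd; apply: (le_integrable (@measurable_punctured R) _ _ (integrable_energy C)).
  exact/measurable_EFinP.
move=> x Px /=; rewrite (le_trans (bd x Px))//; exact: lee_abs.
Qed.

(** Dominated convergence, with the bound that serves for all truncations. *)
Lemma integral_limit0 (g_ : nat -> R * R -> R) (g : R * R -> R) (C : R) :
  (forall N x, offaxis x -> {for x, continuous (g_ N)}) ->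
  (forall N, (\int[@leb2 R]_(x in punctured) (g_ N x)%:E = 0)%E) ->
  (forall N x, punctured x -> (`|g_ N x|%:E <= C%:E * (1 + energy_bound x))%E) ->
  {ae (@leb2 R), forall x, punctured x -> g_ N x @[N --> \oo] --> g x} ->
  measurable_fun (punctured : set plane) g ->
  (@leb2 R).-integrable punctured (EFin \o g) /\
  (\int[@leb2 R]_(x in punctured) (g x)%:E = 0)%E.
Proof.
move=> cg i0 bd cv mg; have mP := @measurable_punctured R.
have iE := integrable_energy C.
have mg_ N : measurable_fun (punctured : set plane) (EFin \o g_ N).
  apply/measurable_EFinP; apply: continuous_measurable2; first exact: open_punctured.
  by move=> x [_ x0]; exact: cg.
have mg' : measurable_fun (punctured : set plane) (EFin \o g) by exact/measurable_EFinP.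
have cv' : {ae (@leb2 R), forall x, punctured x -> (EFin \o g_ N) x @[N --> \oo] --> (EFin \o g) x}.
  apply: (@filterS _ _ (ae_filter_ringOfSetsType (@leb2 R)) _ _ _ cv) => x h Px.
  by apply: cvg_EFin; [exact: nearW|exact: h].
have bd' : {ae (@leb2 R), forall x N, punctured x ->
    (`|(EFin \o g_ N) x| <= C%:E * (1 + energy_bound x))%E}.
  by apply: aeW => x N Px; rewrite /= bd.
have [ig _ cvi] := dominated_convergence mP mg_ mg' cv' iE bd'.
split => //; apply/esym; move: cvi; rewrite (_ : [sequence _]_n = fun=> 0%E).
  by move=> h; rewrite -[RHS](cvg_lim (@ereal_hausdorff R) h) lim_cst.
by apply/funext => N /=; exact: i0.
Qed.

End identities.

(** * The limit function *)

Section limit_functions.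
Variable R : realType.
Notation plane := (measurableTypeR R * measurableTypeR R)%type.
Notation offaxis := (@offaxis R).
Notation punctured := (@punctured R).
Notation B1 := (eball (0 : R * R) 1).
Notation limit_potential := (@limit_potential R).

(** The two sheets of the stationary map are [height] and its opposite. The value
    on the axis, a null set, is a convention. *)
Definition height (x : R * R) : R :=
  if x.2 == 0 then 0 else Num.max (limit_potential x) 0.

(** The gradient of [height], where [limit_potential] is not 0. *)
Definition slope (j : 'I_2) (x : R * R) : R :=
  if (x.2 != 0) && (0 < limit_potential x) then limit_potential1 j x else 0.

Lemma height_offaxis x : offaxis x -> height x = Num.max (limit_potential x) 0.
Proof. by rewrite /height => /negbTE ->. Qed.

Lemma slope_offaxis j x : offaxis x ->
  slope j x = (0 < limit_potential x)%R%:R * limit_potential1 j x.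
Proof.
by rewrite /slope => -> /=; case: ifP => _; rewrite ?mul1r ?mul0r.
Qed.

Lemma height_ge0 x : 0 <= height x.
Proof. by rewrite /height; case: ifP => // _; rewrite le_max lexx orbT. Qed.

Lemma height_le1 x : B1 x -> height x <= 1.
Proof.
move=> Bx; rewrite /height; case: ifPn => [_|x0]; first exact: ler01.
by rewrite ge_max limit_potential_le1// ler01.
Qed.

(** The potentials decrease to their limit, so all of them are positive where it
    is, and the bound for [potential1 N] passes to the limit. *)
Lemma slope_sqr_le j x : punctured x -> ((slope j x ^+ 2)%:E <= energy_bound x)%E.
Proof.
move=> [Bx x0]; rewrite slope_offaxis//; case: (ltP 0 (limit_potential x)) => p0; last first.
  by rewrite mul0r expr0n; exact: energy_bound_ge0.
rewrite mul1r; have le N : ((potential1 N j x ^+ 2)%:E <= energy_bound x)%E.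
  apply: le_trans (energy_bound_ge N x); rewrite lee_fin potential1_sqr_le//.
  exact: lt_le_trans p0 (limit_potential_le N Bx x0).
move: le (energy_bound_ge0 x); case: (energy_bound x) => [r| |] //= le _.
have cv : potential1 N j x ^+ 2 @[N --> \oo] --> limit_potential1 j x ^+ 2.
  by under eq_fun do rewrite expr2; rewrite expr2; apply: cvgM; exact: cvg_potential1.
rewrite lee_fin -(cvg_lim _ cv)//; apply: limr_le; first by apply/cvg_ex; eexists; exact: cv.
by apply: nearW => N; rewrite -lee_fin.
by rewrite leey.
Qed.

Lemma le_energy1 (r : R) (E : \bar R) : (0 <= E)%E -> ((r ^+ 2)%:E <= E)%E -> (`|r|%:E <= 1 + E)%E.
Proof.
move=> E0 rE; apply: (@le_trans _ _ (1 + (r ^+ 2)%:E)%E); last by rewrite leeD2l.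
rewrite -EFinD lee_fin -(real_normK (num_real r)).
by have := sqr_ge0 (`|r| - 1); have := normr_ge0 r; nra.
Qed.

Lemma trunc1_sqr_le N j x : punctured x ->
  (`|potential1 N j x * truncation1 N j x|%:E <= energy_bound x)%E /\
  ((truncation1 N j x ^+ 2)%:E <= energy_bound x)%E.
Proof.
move=> [Bx x0]; have [p0|p0] := ltP 0 (potential N x); last first.
  rewrite (trunc_le0 p0).2 mulr0 normr0 expr0n.
  by split; exact: energy_bound_ge0.
have le : ((potential1 N j x ^+ 2)%:E <= energy_bound x)%E.
  by apply: le_trans (energy_bound_ge N x); rewrite lee_fin potential1_sqr_le.
have t1 := trunc1_le N j x.
split; apply: (le_trans _ le); rewrite lee_fin.
  by rewrite normrM -(real_normK (num_real (potential1 N j x))) expr2 ler_wpM2l.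
rewrite -(real_normK (num_real (potential1 N j x))) -(real_normK (num_real (truncation1 N j x))).
by rewrite lerXn2r ?nnegrE.
Qed.

Lemma cvg_inv_succ : (N.+1%:R^-1 : R) @[N --> \oo] --> (0 : R).
Proof. exact: (@cvg_harmonic R). Qed.

Lemma cvg_trunc x : offaxis x -> truncation N x @[N --> \oo] --> height x.
Proof.
move=> x0; rewrite height_offaxis//; apply: cvg_cutoff => [n||].
- by rewrite invr_gt0.
- exact: cvg_inv_succ.
- exact: cvg_potential.
Qed.

Lemma cvg_trunc1 j x : offaxis x -> limit_potential x != 0 ->
  truncation1 N j x @[N --> \oo] --> slope j x.
Proof.
move=> x0 l0; rewrite slope_offaxis//; apply: cvgM; last exact: cvg_potential1.
by apply: cvg_cutoff' => //; [exact: cvg_inv_succ|exact: cvg_potential].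
Qed.

Lemma measurable_offaxis_extend (g : R * R -> R) (a : R) :
  measurable_fun (offaxis : set plane) g -> (forall x, x.2 = 0 -> g x = a) ->
  measurable_fun (setT : set plane) g.
Proof.
move=> mg ga; rewrite -(setUv offaxis); apply/measurable_funU.
- exact: measurable_offaxis.
- by apply: measurableC; exact: measurable_offaxis.
split => //; apply: (eq_measurable_fun (fun=> a)); last exact: measurable_cst.
by move=> x; rewrite inE => /negP; rewrite negbK => /eqP /ga ->.
Qed.

Lemma measurable_height : measurable_fun (setT : set plane) height.
Proof.
apply: (@measurable_offaxis_extend _ 0); last by move=> x x0; rewrite /height x0 eqxx.
apply: (eq_measurable_fun (fun x => Num.max (limit_potential x) 0)).
  by move=> x; rewrite inE => x0; rewrite height_offaxis.
by apply: measurable_maxr; [exact: measurable_limit_potential|exact: measurable_cst].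
Qed.

Lemma measurable_slope j : measurable_fun (setT : set plane) (slope j).
Proof.
apply: (@measurable_offaxis_extend _ 0); last by move=> x x0; rewrite /slope x0 eqxx.
apply: (eq_measurable_fun
  (fun x => if 0 < limit_potential x then limit_potential1 j x else 0)).
  by move=> x; rewrite inE => x0; rewrite /slope (x0 : x.2 != 0).
apply: measurable_fun_if.
- exact: measurable_offaxis.
- by apply: measurable_fun_ltr; [exact: measurable_cst|exact: measurable_limit_potential].
- apply: measurable_funS (@measurable_limit_potential1 R j); first exact: measurable_offaxis.
  exact: subIsetl.
- exact: measurable_cst.
Qed.

(** Two levels of the potential are discarded: 0, where the cutoffs may fail to
    converge, and another one, where a distance may fail to be differentiable. *)
Lemma ae_punctured (P : R * R -> Prop) (l : R) :
  (forall x, punctured x -> limit_potential x != 0 -> limit_potential x != l -> P x) ->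
  {ae (@leb2 R), forall x, punctured x -> P x}.
Proof.
move=> HP; have [m0 n0] := level_set_null (0 : R); have [ml nl] := level_set_null l.
exists ((offaxis `&` limit_potential @^-1` [set 0]) `|`
        (offaxis `&` limit_potential @^-1` [set l])); split.
- exact: measurableU.
- exact: (etrans (measureU0 m0 ml nl) n0).
- move=> x /= h; apply: contrapT => /not_orP[h0 hl]; apply: h => Px; apply: HP => //.
  + by apply/eqP => e; apply: h0; split => //; exact: Px.2.
  + by apply/eqP => e; apply: hl; split => //; exact: Px.2.
Qed.

Lemma cvg_field (K : R * R -> R -> R) (x : R * R) (u : nat -> R) (l : R) :
  continuous (fun z : R * R * R => K z.1 z.2) -> u @ \oo --> l ->
  K x (u N) @[N --> \oo] --> K x l.
Proof.
move=> cK cu.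
have c2 : (x, u N) @[N --> \oo] --> (x, l) by exact: (cvg_pair (cvg_cst x) cu).
exact: (cvg_comp _ _ c2 (cK (x, l))).
Qed.

Lemma measurable_field (K : R * R -> R -> R) (s : R) :
  continuous (fun z : R * R * R => K z.1 z.2) ->
  measurable_fun (punctured : set plane) (fun x => K x (s * height x)).
Proof.
move=> cK; apply: (@measurable_fun_cvg _ plane R punctured (fun N x => K x (s * truncation N x))).
- move=> N; apply: continuous_measurable2; first exact: open_punctured.
  move=> x [_ x0]; apply: (continuous_field cK); apply: cvgM; first exact: cvg_cst.
  exact: continuous_trunc.
- move=> x [_ x0]; apply: (cvg_field cK).
  by apply: cvgM; [exact: cvg_cst|exact: cvg_trunc].
Qed.

End limit_functions.

(** * Test functions and outer fields as regular integrands *)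

Section fields.
Variable R : realType.
Notation B1 := (eball (0 : R * R) 1).

(** The distance from the Q-point [[[t]] + [[- t]]] to a fixed Q-point has this
    form with [e = 0]; a positive [e] makes it smooth. *)
Definition profile (c d e t : R) : R :=
  Num.sqrt (2 * (t - c) ^+ 2 + 2 * d ^+ 2 + e ^+ 2).

Definition profile' (c d e t : R) : R := 2 * (t - c) / profile c d e t.

Lemma profile_arg_ge0 (c d e t : R) : 0 <= 2 * (t - c) ^+ 2 + 2 * d ^+ 2 + e ^+ 2.
Proof.
by have := sqr_ge0 (t - c); have := sqr_ge0 d; have := sqr_ge0 e; lra.
Qed.

Lemma profile_sqr (c d e t : R) :
  profile c d e t ^+ 2 = 2 * (t - c) ^+ 2 + 2 * d ^+ 2 + e ^+ 2.
Proof. by rewrite /profile sqr_sqrtr// profile_arg_ge0. Qed.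

Lemma profile_ge0 (c d e t : R) : 0 <= profile c d e t.
Proof. exact: sqrtr_ge0. Qed.

Lemma profile_arg_gt0 (c d e t : R) : 0 < e ->
  0 < 2 * (t - c) ^+ 2 + 2 * d ^+ 2 + e ^+ 2.
Proof.
move=> e0; have : 0 < e ^+ 2 by rewrite exprn_gt0.
by have := sqr_ge0 (t - c); have := sqr_ge0 d; lra.
Qed.

Lemma profile_gt0 (c d e t : R) : 0 < e -> 0 < profile c d e t.
Proof. by move=> e0; rewrite sqrtr_gt0 profile_arg_gt0. Qed.

Lemma profile'_le2 (c d e t : R) : `|profile' c d e t| <= 2.
Proof.
rewrite /profile' normrM normfV (ger0_norm (profile_ge0 _ _ _ _)).
have [->|p0] := eqVneq (profile c d e t) 0; first by rewrite invr0 mulr0.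
have pp : 0 < profile c d e t by rewrite lt_def p0 profile_ge0.
rewrite ler_pdivrMr// -ler_sqr ?nnegrE ?mulr_ge0 ?profile_ge0//.
rewrite real_normK ?num_real// !exprMn profile_sqr.
have := sqr_ge0 (t - c); have := sqr_ge0 d; have := sqr_ge0 e; nra.
Qed.

Lemma profile_le (c d e t : R) : 0 <= t <= 1 -> 0 <= e <= 1 ->
  profile c d e t <= 2 * (2 + `|c| + `|d|).
Proof.
move=> /andP[t0 t1] /andP[e0 e1].
rewrite -ler_sqr ?nnegrE ?mulr_ge0 ?profile_ge0 ?addr_ge0// profile_sqr.
have c0 := normr_ge0 c; have d0 := normr_ge0 d.
have tc : (t - c) ^+ 2 <= (1 + `|c|) ^+ 2.
  rewrite -(real_normK (num_real (t - c))) lerXn2r ?nnegrE ?addr_ge0//.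
  by rewrite (le_trans (ler_normB _ _))// lerD2r ger0_norm.
have e2 : e ^+ 2 <= 1 by rewrite expr_le1.
rewrite -(real_normK (num_real d)).
by rewrite !exprMn; nra.
Qed.

Lemma is_derive_profile (c d e t : R) : 0 < e ->
  is_derive t 1 (profile c d e) (profile' c d e t).
Proof.
move=> e0.
have dp : is_derive t 1 (fun t : R => 2 * (t - c) ^+ 2 + 2 * d ^+ 2 + e ^+ 2) (4 * (t - c)).
  apply: (@is_derive_quad _ _ _ _ 2) => h.
  rewrite ler_norml; have := sqr_ge0 h => h0.
  by apply/andP; split; nra.
have := @is_derive_sqrt_comp _ (fun t => 2 * (t - c) ^+ 2 + 2 * d ^+ 2 + e ^+ 2) t _
  (profile_arg_gt0 c d t e0) dp.
move=> h; apply: (is_derive_eq h).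
rewrite /profile' -/(profile c d e t); have := profile_gt0 c d t e0 => p0.
by field; rewrite gt_eqF.
Qed.

Lemma continuous_profile' (c d e : R) : 0 < e -> continuous (profile' c d e).
Proof.
move=> e0 t; apply: cvgM.
  apply: cvgM; first exact: cvg_cst.
  by apply: cvgB; [exact: cvg_id|exact: cvg_cst].
apply: cvgV; first by rewrite gt_eqF// profile_gt0.
exact: (is_derive_continuous (is_derive_profile c d t e0)).
Qed.

Lemma is_derive_along (V W : normedModType R) (F : V -> W) (g : R -> V) (v : V) (s : R) :
  (forall h, g (h + s) = h *: v + g s) -> derivable F (g s) v ->
  is_derive s 1 (fun r => F (g r)) ('D_v F (g s)).
Proof.
move=> gE dF.
have E : (fun h => h^-1 *: (F (g (h *: (1 : R) + s)) - F (g s))) =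
    (fun h => h^-1 *: (F (h *: v + g s) - F (g s))).
  by apply/funext => h; rewrite -gE /GRing.scale /= mulr1.
apply: DeriveDef; first by rewrite /derivable E.
by rewrite /derive E.
Qed.

Lemma line_shift j (c h s : R) : line j c (h + s) = h *: e2 R j + line j c s.
Proof.
rewrite /e2 /line; case: (j == 0); apply/pair_equal_spec; split => //=;
  by rewrite /GRing.scale /= ?mulr0 ?add0r ?mulr1.
Qed.

Lemma near_fst (T : topologicalType) (z : R * R * T) (A : set (R * R)) :
  nbhs z.1 A -> \near z, A z.1.
Proof. exact: (@cvg_fst _ _ (nbhs z.1) (nbhs z.2)). Qed.

(** The support is compact, which gives the bounds, and the function is 0 near
    any point outside of it. *)
Lemma test_function_C1 (phi : R * R -> R) : test_function B1 phi ->
  [/\ continuous phi, forall j, continuous (fun x => 'D_(e2 R j) phi x),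
     forall j (c s : R), is_derive s 1 (fun s => phi (line j c s)) ('D_(e2 R j) phi (line j c s)),
     forall x, ~ B1 x -> phi x = 0 /\ forall j, 'D_(e2 R j) phi x = 0 &
     exists M, forall x, `|phi x| <= M /\ forall j, `|'D_(e2 R j) phi x| <= M].
Proof.
move=> [sm cp sub]; have [c0 /= sm1] := sm 1%N.
have cphi : continuous phi by move=> x; exact: c0.
have cD j : continuous (fun x => 'D_(e2 R j) phi x).
  by move=> x; have [_ [h _]] := sm1 (e2 R j); exact: h.
have dr j x : derivable phi x (e2 R j) by have [h _] := sm1 (e2 R j); exact: h.
set S := closure [set x | phi x != 0] in cp sub.
have out x : ~ S x -> phi x = 0 /\ forall j, 'D_(e2 R j) phi x = 0.
  move=> Sx; have nS : \near x, phi x = 0.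
    have oS : open (~` S) by rewrite openC; exact: closed_closure.
    have : nbhs x (~` S) by exact: open_nbhs_nbhs.
    apply: filterS => y Sy; apply/eqP; apply: contrapT => /negP py; apply: Sy.
    exact: subset_closure.
  split; first exact: nbhs_singleton nS.
  move=> j; have nS' : \near x, cst 0 x = phi x by apply: filterS nS => y ->.
  have h := near_eq_is_derive nS' (is_derive_cst (0 : R) x (e2 R j)).
  exact: (@derive_val _ _ _ _ _ _ _ h).
have bd (f : R * R -> R) : continuous f -> (forall x, ~ S x -> f x = 0) ->
    exists M, forall x, `|f x| <= M.
  move=> cf f0.
  have cS : compact (f @` S) by apply: continuous_compact => //; exact: continuous_subspaceT.
  have [M [_ HM]] := compact_bounded cS.
  exists (Num.max 0 (M + 1)) => x; have [Sx|Sx] := pselect (S x); last first.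
    by rewrite f0// normr0 le_max lexx.
  rewrite le_max; apply/orP; right.
  by apply: (HM (M + 1)); [rewrite ltrDl|exists x].
split => //.
- move=> j c s.
  by apply: (is_derive_along (g := line j c)) => // h; exact: line_shift.
- by move=> x Bx; apply: out => Sx; apply: Bx; exact: sub.
- have [M0 H0] := bd _ cphi (fun x Sx => (out x Sx).1).
  have [M1 H1] := bd _ (cD 0) (fun x Sx => (out x Sx).2 0).
  have [M2 H2] := bd _ (cD 1) (fun x Sx => (out x Sx).2 1).
  exists (Num.max M0 (Num.max M1 M2)) => x; split.
    by rewrite le_max H0.
  move=> j; rewrite !le_max; have [->|->] : j = 0 \/ j = 1.
      by case: j => -[|[|//]] ?; [left|right]; apply/val_inj.
    by rewrite H1 orbT.
  by rewrite H2 !orbT.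
Qed.

Lemma C1field_test (c d e : R) (phi : R * R -> R) : 0 < e -> test_function B1 phi ->
  C1field (fun x t => profile c d e t * phi x)
    (fun j x t => profile c d e t * 'D_(e2 R j) phi x)
    (fun x t => profile' c d e t * phi x).
Proof.
move=> e0 tf; have [cphi cD dr out _] := test_function_C1 tf.
have cf2 (f : R -> R) (k : R * R -> R) : continuous f -> continuous k ->
    continuous (fun z : R * R * R => f z.2 * k z.1).
  move=> cf ck z; apply: cvgM.
    by apply: (@continuous_comp _ _ _ snd f); [exact: cvg_snd|exact: cf].
  by apply: (@continuous_comp _ _ _ fst k); [exact: cvg_fst|exact: ck].
have cp : continuous (profile c d e).
  by move=> t; exact: (is_derive_continuous (is_derive_profile c d t e0)).
split.
- move=> j k t s; have := is_deriveM (is_derive_cst (profile c d e t) s (1 : R)) (dr j k s).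
  move=> h; apply: (is_derive_eq h).
  by rewrite /GRing.scale /= mulr0 addr0.
- move=> x t; have := is_deriveM (is_derive_profile c d t e0) (is_derive_cst (phi x) t (1 : R)).
  move=> h; apply: (is_derive_eq h).
  by rewrite /GRing.scale /= mulr0 add0r mulrC.
- by move=> j; exact: (cf2 _ _ cp (cD j)).
- exact: (cf2 _ _ (@continuous_profile' c d e e0) cphi).
- exact: (cf2 _ _ cp cphi).
- move=> x t Bx; have [-> h] := out x Bx.
  by split; rewrite ?mulr0// => j; rewrite h mulr0.
Qed.

(** Only the values of an admissible field over the disc are prescribed, hence the
    extension by 0. *)
Definition outer (psi : R * R * 'cV[R]_1 -> 'cV[R]_1) (x : R * R) (t : R) : R :=
  if `[< B1 x >] then psi (x, const_mx t) 0 0 else 0.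

Definition outer_x (psi : R * R * 'cV[R]_1 -> 'cV[R]_1) (j : 'I_2) (x : R * R) (t : R) : R :=
  if `[< B1 x >] then Dx psi x (const_mx t) 0 j else 0.

Definition outer_t (psi : R * R * 'cV[R]_1 -> 'cV[R]_1) (x : R * R) (t : R) : R :=
  if `[< B1 x >] then Du psi x (const_mx t) 0 0 else 0.

Lemma continuous_const_mx : continuous (fun t : R => const_mx t : 'cV[R]_1).
Proof.
move=> t; rewrite (_ : (fun t : R => const_mx t : 'cV[R]_1) =
    (fun t => t *: (const_mx 1 : 'cV[R]_1))).
  by apply: cvgZr_tmp; exact: cvg_id.
by apply/funext => u; apply/matrixP => i j; rewrite !mxE mulr1.
Qed.

Lemma is_derive_entry (F : R * R * 'cV[R]_1 -> 'cV[R]_1) (g : R -> R * R * 'cV[R]_1)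
    (v : R * R * 'cV[R]_1) (s : R) :
  (forall h, g (h + s) = h *: v + g s) -> derivable F (g s) v ->
  is_derive s 1 (fun r => F (g r) 0 0) ('D_v F (g s) 0 0).
Proof.
move=> gE dF.
have cv : h^-1 *: (F (g (h *: (1 : R) + s)) 0 0 - F (g s) 0 0) @[h --> 0^'] -->
    'D_v F (g s) 0 0.
  rewrite (_ : (fun h => _) = (fun h => (h^-1 *: (F (h *: v + g s) - F (g s))) 0 0)).
    apply: (@cvg_comp _ _ _ (fun h : R => h^-1 *: (F (h *: v + g s) - F (g s)))
      (fun M : 'cV[R]_1 => M 0 0) _ (nbhs ('D_v F (g s)))); first exact: dF.
    exact: coord_continuous.
  by apply/funext => h; rewrite !mxE -gE /GRing.scale /= mulr1.
by apply: DeriveDef; [apply/cvg_ex; eexists; exact: cv|exact/cvg_lim].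
Qed.

(** The points where the definition changes have a neighbourhood outside of [S], on
    which both formulas give 0. *)
Lemma continuous_extend0 (F : R * R * 'cV[R]_1 -> 'cV[R]_1) (S : set (R * R)) :
  closed S -> S `<=` B1 ->
  (forall z, (B1 `*` setT) z -> {for z, continuous F}) ->
  (forall x u, B1 x -> ~ S x -> F (x, u) = 0) ->
  continuous (fun z : R * R * R => if `[< B1 z.1 >] then F (z.1, const_mx z.2) 0 0 else 0).
Proof.
move=> cS SB cF F0 z; have [Bz|Bz] := pselect (B1 z.1).
- have c1 : {for z, continuous (fun z : R * R * R => F (z.1, const_mx z.2) 0 0)}.
    apply: (@continuous_comp _ _ _ (fun z : R * R * R => F (z.1, const_mx z.2))
      (fun M : 'cV[R]_1 => M 0 0)); last exact: coord_continuous.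
    apply: (@continuous_comp _ _ _
      (fun z : R * R * R => (z.1, const_mx z.2 : 'cV[R]_1)) F); last exact: cF.
    apply: continuous_pair; first exact: cvg_fst.
    apply: (@continuous_comp _ _ _ snd (fun t : R => const_mx t : 'cV[R]_1)).
      exact: cvg_snd.
    exact: continuous_const_mx.
  rewrite /prop_for /continuous_at ifT; last exact/asboolP.
  apply: cvg_trans c1; apply: near_eq_cvg.
  have nB : nbhs z.1 B1 by apply: open_nbhs_nbhs; split => //; exact: open_eball.
  by apply: filterS (near_fst nB) => y By; rewrite ifT//; exact/asboolP.
- rewrite /continuous_at ifF; last exact/asboolPn.
  apply: cvg_near_cst.
  have nS : nbhs z.1 (~` S).
    by apply: open_nbhs_nbhs; split; [rewrite openC|move=> /SB].
  by apply: filterS (near_fst nS) => y Sy; case: ifPn => // /asboolP By; rewrite F0// mxE.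
Qed.

Lemma entry_le_enorm p q (A : 'M[R]_(p, q)) i j : `|A i j| <= enorm A.
Proof.
rewrite /enorm -sqrtr_sqr ler_sqrt /mxdot; last first.
  by apply: sumr_ge0 => k _; apply: sumr_ge0 => l _; rewrite -expr2 sqr_ge0.
rewrite (bigD1 i)//= (bigD1 j)//= expr2 -addrA lerDl addr_ge0//.
  by apply: sumr_ge0 => l _; rewrite -expr2 sqr_ge0.
by apply: sumr_ge0 => k _; apply: sumr_ge0 => l _; rewrite -expr2 sqr_ge0.
Qed.

Lemma enorm_const_mx (t : R) : enorm (const_mx t : 'cV[R]_1) = `|t|.
Proof. by rewrite /enorm /mxdot !big_ord1 !mxE -expr2 sqrtr_sqr. Qed.

Lemma C1field_outer psi : admissible B1 psi ->
  C1field (outer psi) (outer_x psi) (outer_t psi) /\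
  exists K, forall x t, B1 x -> `|t| <= 1 ->
    [/\ `|outer psi x t| <= K, `|outer_t psi x t| <= K
      & forall j, `|outer_x psi j x t| <= K].
Proof.
move=> [sm [Om [_ cOm sOm supp]] [C HC]].
have [c0 sm1] := sm 1%N.
set S := closure Om in cOm sOm.
have dpsi v z : (B1 `*` setT) z -> derivable psi z v by move=> Uz; have [h _] := sm1 v; exact: h.
have cD v z : (B1 `*` setT) z -> {for z, continuous (fun z => 'D_v psi z)}.
  by move=> Uz; have [_ [h _]] := sm1 v; exact: h.
have z0 x u : B1 x -> ~ S x -> psi (x, u) = 0.
  move=> Bx Sx; apply: contrapT => p0; apply: Sx; apply: subset_closure.
  have : (Om `*` setT) (x, u).
    apply: supp; split => //; apply: subset_closure; split => //=.
    exact/eqP.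
  by case.
have z1 v x u : B1 x -> ~ S x -> 'D_v psi (x, u) = 0.
  move=> Bx Sx.
  have nx : nbhs x (B1 `&` ~` S).
    apply: open_nbhs_nbhs; split => //; apply: openI; first exact: open_eball.
    by rewrite openC; exact: closed_closure.
  have nz : \forall z \near (x, u), cst 0 z = psi z.
    by apply: filterS (@near_fst _ (x, u) _ nx) => -[y w] /= [By Sy]; rewrite z0.
  have h := near_eq_is_derive nz (is_derive_cst (0 : 'cV[R]_1) (x, u) v).
  exact: (@derive_val _ _ _ _ _ _ _ h).
have clS : closed S by exact: closed_closure.
have E x t : B1 x -> [/\ outer psi x t = psi (x, const_mx t) 0 0,
    outer_t psi x t = 'D_(0, delta_mx 0 0) psi (x, const_mx t) 0 0 &
    forall j, outer_x psi j x t = 'D_(e2 R j, 0) psi (x, const_mx t) 0 0].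
  by move=> Bx; rewrite /outer /outer_x /outer_t; split=> [||j]; rewrite ifT ?mxE//; exact/asboolP.
have Z x t : ~ B1 x -> [/\ outer psi x t = 0, outer_t psi x t = 0 &
    forall j, outer_x psi j x t = 0].
  by move=> Bx; rewrite /outer /outer_x /outer_t; split=> [||j]; rewrite ifF//; exact/asboolPn.
split; last first.
  exists (2 * `|C|) => x t Bx t1.
  have [h1 h2] := HC x (const_mx t) Bx; rewrite enorm_const_mx in h2.
  have eg p q (A : 'M[R]_(p, q)) : 0 <= enorm A by exact: sqrtr_ge0.
  have CC := ler_norm C; have C0 := normr_ge0 C; have t0 := normr_ge0 t.
  have h3 : C * (1 + `|t|) <= 2 * `|C|.
    apply: (@le_trans _ _ (`|C| * (1 + `|t|))); first by rewrite ler_wpM2r// addr_ge0.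
    by nra.
  rewrite /outer /outer_x /outer_t; rewrite !(introT (asboolP _) Bx).
  have e1 := eg _ _ (psi (x, const_mx t)); have e2' := eg _ _ (Dx psi x (const_mx t)).
  split.
  - by apply: (le_trans (entry_le_enorm _ _ _)); lra.
  - by apply: (le_trans (entry_le_enorm _ _ _)); lra.
  - by move=> j; apply: (le_trans (entry_le_enorm _ _ _)); lra.
split.
- move=> j c t s; have [Bs|Bs] := pselect (B1 (line j c s)).
  + have [_ _ ->] := E _ t Bs.
    have gE h : (line j c (h + s), const_mx t) = h *: (e2 R j, 0) + (line j c s, const_mx t)
        :> R * R * 'cV[R]_1.
      apply/pair_equal_spec; split; last by rewrite /= scaler0 add0r.
      exact: line_shift.
    have dp : derivable psi (line j c s, const_mx t) (e2 R j, 0) by apply: dpsi.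
    have d := @is_derive_entry psi (fun s => (line j c s, const_mx t)) _ s gE dp.
    apply: near_eq_is_derive d.
    have nB : nbhs (line j c s) B1 by apply: open_nbhs_nbhs; split => //; exact: open_eball.
    have nr : \forall r \near s, B1 (line j c r) by exact: (@continuous_line R j c s _ nB).
    by apply: filterS nr => r Br; have [-> _ _] := E _ t Br.
  + have [_ _ ->] := Z _ t Bs.
    apply: near_eq_is_derive (is_derive_cst (0 : R) s (1 : R)).
    have nS : nbhs (line j c s) (~` S).
      by apply: open_nbhs_nbhs; split; [rewrite openC|move=> /sOm].
    have nr : \forall r \near s, (~` S) (line j c r) by exact: (@continuous_line R j c s _ nS).
    apply: filterS nr => r Sr; have [Br|Br] := pselect (B1 (line j c r)).
      by have [-> _ _] := E _ t Br; rewrite z0// mxE.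
    by have [-> _ _] := Z _ t Br.
- move=> x t; have [Bx|Bx] := pselect (B1 x).
  + have [_ -> _] := E _ t Bx.
    rewrite (_ : outer psi x = fun t => psi (x, const_mx t) 0 0); last first.
      by apply/funext => r; have [-> _ _] := E _ r Bx.
    apply: (@is_derive_entry psi (fun t => (x, const_mx t))); last exact: dpsi.
    move=> h; apply/pair_equal_spec; split; first by rewrite /= scaler0 add0r.
    apply/matrixP => a b; rewrite !mxE !ord1 /= mulr1.
    by [].
  + rewrite (_ : outer psi x = cst 0); last first.
      by apply/funext => r; have [-> _ _] := Z _ r Bx.
    by have [_ -> _] := Z _ t Bx; exact: is_derive_cst.
- move=> j; rewrite (_ : (fun z : R * R * R => outer_x psi j z.1 z.2) =
    (fun z => if `[< B1 z.1 >] then 'D_(e2 R j, 0) psi (z.1, const_mx z.2) 0 0 else 0)).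
    apply: (@continuous_extend0 (fun w => 'D_(e2 R j, 0) psi w) _ clS sOm) => [z Uz|x u].
      exact: cD.
    exact: z1.
  by apply/funext => z; rewrite /outer_x mxE.
- rewrite (_ : (fun z : R * R * R => outer_t psi z.1 z.2) =
    (fun z => if `[< B1 z.1 >] then 'D_(0, delta_mx 0 0) psi (z.1, const_mx z.2) 0 0 else 0)).
    apply: (@continuous_extend0 (fun w => 'D_(0, delta_mx 0 0) psi w) _ clS sOm) => [z Uz|x u].
      exact: cD.
    exact: z1.
  by apply/funext => z; rewrite /outer_t mxE.
- by apply: (@continuous_extend0 psi _ clS sOm) => [z Uz|x u]; [exact: c0|exact: z0].
- by move=> x t Bx; have [h1 h2 h3] := Z x t Bx.
Qed.

(** The combination of the values of [H] on the two sheets that enters the outer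
    variation. *)
Lemma C1field_odd (H : R * R -> R -> R) Hx Ht : C1field H Hx Ht ->
  C1field (fun x t => H x t - H x (- t)) (fun j x t => Hx j x t - Hx j x (- t))
    (fun x t => Ht x t + Ht x (- t)).
Proof.
move=> CH; have neg (K : R * R -> R -> R) : continuous (fun z : R * R * R => K z.1 z.2) ->
    continuous (fun z : R * R * R => K z.1 (- z.2)).
  move=> cK z; apply: (@continuous_comp _ _ _ (fun z : R * R * R => (z.1, - z.2))
    (fun z : R * R * R => K z.1 z.2)); last exact: cK.
  by apply: continuous_pair; [exact: cvg_fst|apply: cvgN; exact: cvg_snd].
split.
- move=> j c t s; exact: (is_deriveB (C1field_x CH j c t s) (C1field_x CH j c (- t) s)).
- move=> x t.
  have dN : is_derive t 1 (fun t : R => - t) (- 1) by exact: is_deriveN.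
  have := is_deriveB (C1field_t CH x t)
    (@is_derive1_comp _ (H x) (fun t => - t) t _ _ (C1field_t CH x (- t)) dN).
  by move=> h; apply: (is_derive_eq h); rewrite mulrN1 opprK.
- move=> j z; have c1 : continuous (fun z : R * R * R => Hx j z.1 z.2) := C1field_cx CH (j := j).
  exact: (cvgB (c1 z) (neg _ c1 z)).
- move=> z; have c1 : continuous (fun z : R * R * R => Ht z.1 z.2) := C1field_ct CH.
  exact: (cvgD (c1 z) (neg _ c1 z)).
- move=> z; have c1 : continuous (fun z : R * R * R => H z.1 z.2) := C1field_c CH.
  exact: (cvgB (c1 z) (neg _ c1 z)).
- move=> x t Bx; have [h1 h2 h3] := C1field_out CH t Bx.
  have [h4 h5 h6] := C1field_out CH (- t) Bx.
  by rewrite h1 h2 h4 h5 subrr addr0; split => // j; rewrite h3 h6 subrr.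
Qed.

End fields.

(** * Passing to the limit in the truncations *)

Section limit_identities.
Variable R : realType.
Notation plane := (measurableTypeR R * measurableTypeR R)%type.
Notation offaxis := (@offaxis R).
Notation punctured := (@punctured R).
Notation B1 := (eball (0 : R * R) 1).
Notation limit_potential := (@limit_potential R).

Lemma cvg_profile (c d t : R) (e u : nat -> R) : e @ \oo --> 0 -> u @ \oo --> t ->
  profile c d (e n) (u n) @[n --> \oo] --> profile c d 0 t.
Proof.
move=> ce cu; apply: (@cvg_comp _ _ _
  (fun n => 2 * (u n - c) ^+ 2 + 2 * d ^+ 2 + e n ^+ 2) Num.sqrt _
  (nbhs (2 * (t - c) ^+ 2 + 2 * d ^+ 2 + 0 ^+ 2))); last exact: sqrt_continuous.
have sq (v : nat -> R) (l : R) : v @ \oo --> l -> v n ^+ 2 @[n --> \oo] --> l ^+ 2.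
  by move=> cv; under eq_fun do rewrite expr2; rewrite expr2; exact: cvgM.
apply: cvgD; last exact: sq.
apply: cvgD; last exact: cvg_cst.
apply: cvgM; first exact: cvg_cst.
by apply: sq; apply: cvgB => //; exact: cvg_cst.
Qed.

Lemma cvg_profile' (c d t : R) (e u : nat -> R) : profile c d 0 t != 0 ->
  e @ \oo --> 0 -> u @ \oo --> t ->
  profile' c d (e n) (u n) @[n --> \oo] --> profile' c d 0 t.
Proof.
move=> p0 ce cu; apply: cvgM; last by apply: cvgV => //; exact: cvg_profile.
by apply: cvgM; [exact: cvg_cst|apply: cvgB => //; exact: cvg_cst].
Qed.

Lemma near_potential_lt0 x : offaxis x -> limit_potential x < 0 ->
  \forall N \near \oo, potential N x <= 0.
Proof.
move=> x0 l0; apply: filterS (cvgr_lt _ (cvg_potential x0) _ l0) => N.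
exact: ltW.
Qed.

Lemma continuous_field_truncation N j (H Ht : R * R -> R -> R) Hx x :
  C1field H Hx Ht -> offaxis x ->
  {for x, continuous (fun x =>
    Hx j x (truncation N x) + Ht x (truncation N x) * truncation1 N j x)}.
Proof.
move=> CH x0; have cT := continuous_trunc (N := N) x0.
have c1 := continuous_field (C1field_cx CH (j := j)) cT.
have c2 := continuous_field (C1field_ct CH) cT.
exact: (cvgD c1 (cvgM c2 (continuous_trunc1 (N := N) (j := j) x0))).
Qed.

Lemma measurable_invr : measurable_fun setT (fun t : R => t^-1).
Proof.
rewrite -(setUv [set 0 : R]); apply/measurable_funU => //; first exact: measurableC.
split; first exact: measurable_fun_set1.
apply: open_continuous_measurable_fun.
  rewrite (_ : ~` [set 0] = [set t | t != 0]); first exact: open_neq.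
  by apply/seteqP; split => t /= /eqP.
by move=> t; rewrite inE /= => /eqP t0; apply: cvgV => //; exact: cvg_id.
Qed.

Lemma measurable_profile (c d : R) :
  measurable_fun (setT : set plane) (fun x => profile c d 0 (height x)).
Proof.
apply: measurableT_comp (@measurable_height R); apply: continuous_measurable_fun => t.
apply: (@continuous_comp _ _ _ (fun t : R => 2 * (t - c) ^+ 2 + 2 * d ^+ 2 + 0 ^+ 2)
  Num.sqrt); last exact: sqrt_continuous.
apply: (@is_derive_continuous _ _ _ (4 * (t - c))); apply: (@is_derive_quad _ _ _ _ 2) => h.
by rewrite ler_norml; have := sqr_ge0 h => ?; apply/andP; split; nra.
Qed.

Lemma measurable_profile' (c d : R) :
  measurable_fun (setT : set plane) (fun x => profile' c d 0 (height x)).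
Proof.
apply: measurable_funM.
  apply: measurable_funM; first exact: measurable_cst.
  by apply: measurable_funB; [exact: measurable_height|exact: measurable_cst].
by apply: (measurableT_comp _ (measurable_profile c d)); exact: measurable_invr.
Qed.

(** The limit of [integral_trunc_partial]; the parameter that smoothes the profile
    tends to 0 together with the one of the cutoff. *)
Lemma weak_identity (c d : R) (j : 'I_2) (phi : R * R -> R) : test_function B1 phi ->
  (\int[@leb2 R]_(x in punctured)
    (profile c d 0 (height x) * 'D_(e2 R j) phi x
     + profile' c d 0 (height x) * slope j x * phi x)%:E = 0)%E.
Proof.
move=> tf; have [cphi cD dr out [M HM]] := test_function_C1 tf.
pose e N : R := N.+1%:R^-1.
have e0 N : 0 < e N by rewrite invr_gt0.
have e1 N : 0 <= e N <= 1 by rewrite (ltW (e0 N)) invf_le1// ler1n.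
have M0 : 0 <= M by exact: le_trans (normr_ge0 _) (HM 0).1.
pose P : R := 2 * (2 + `|c| + `|d|).
have P0 : 0 <= P by rewrite mulr_ge0// !addr_ge0.
have CH N := C1field_test c d (e0 N) tf.
have bP N t : 0 <= t <= 1 -> `|profile c d (e N) t| <= P.
  by move=> t01; rewrite ger0_norm ?profile_ge0// profile_le.
have bH N : field_bounded (fun x t => profile c d (e N) t * phi x)
    (fun x t => profile' c d (e N) t * phi x)
    (fun j x t => profile c d (e N) t * 'D_(e2 R j) phi x) (P * M + 2 * M).
  move=> x t Bx t01; have [m1 m2] := HM x; have pt := bP N t t01.
  have pt' := profile'_le2 c d (e N) t.
  have a1 : `|profile c d (e N) t * phi x| <= P * M by rewrite normrM ler_pM.
  have a2 : `|profile' c d (e N) t * phi x| <= 2 * M by rewrite normrM ler_pM.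
  have a0 : 0 <= P * M by rewrite mulr_ge0.
  have a0' : 0 <= 2 * M by rewrite mulr_ge0.
  split; [lra|lra|move=> i].
  have a3 : `|profile c d (e N) t * 'D_(e2 R i) phi x| <= P * M by rewrite normrM ler_pM.
  lra.
refine (proj2 (@integral_limit0 R
   (fun N x => profile c d (e N) (truncation N x) * 'D_(e2 R j) phi x
     + profile' c d (e N) (truncation N x) * phi x * truncation1 N j x)
   (fun x => profile c d 0 (height x) * 'D_(e2 R j) phi x
     + profile' c d 0 (height x) * slope j x * phi x) (P * M + 2 * M) _ _ _ _ _)).
- by move=> N x x0; exact: (continuous_field_truncation (CH N)).
- by move=> N; exact: (integral_trunc_partial N j (CH N) (bH N)).
- move=> N x Px; have [Bx x0] := Px.
  have [m1 m2] := HM x; have pt := bP N _ (truncation_itv N Bx).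
  have pt' := profile'_le2 c d (e N) (truncation N x).
  have tE := le_energy1 (energy_bound_ge0 x) (trunc1_sqr_le N j Px).2.
  have E1 : (1 <= 1 + energy_bound x)%E by rewrite leeDl// energy_bound_ge0.
  apply: (@le_trans _ _ ((P * M)%:E + (2 * M)%:E * `|truncation1 N j x|%:E)%E).
    rewrite -EFinM -EFinD lee_fin (le_trans (ler_normD _ _))// lerD//.
      by rewrite normrM ler_pM.
    by rewrite normrM ler_wpM2r// normrM ler_pM.
  rewrite EFinD ge0_muleDl ?lee_fin ?mulr_ge0//; apply: leeD.
    by rewrite -[leLHS]mule1 lee_pmul ?lee_fin ?mulr_ge0.
  by rewrite lee_pmul ?lee_fin ?mulr_ge0.
- apply: (@ae_punctured _ _ c) => x Px l0 lc; have [Bx x0] := Px.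
  apply: cvgD.
    apply: cvgM; last exact: cvg_cst.
    by apply: cvg_profile; [exact: cvg_inv_succ|exact: cvg_trunc].
  case: (ltgtP (limit_potential x) 0) l0 => // [ln|lp] _.
    have -> : slope j x = 0 by rewrite /slope ltNge (ltW ln) andbF.
    rewrite mulr0 mul0r; apply: cvg_near_cst.
    apply: filterS (near_potential_lt0 x0 ln) => N pN.
    by rewrite (trunc_le0 pN).2 mulr0.
  rewrite [X in _ --> X]mulrAC; apply: cvgM; last first.
    by apply: cvg_trunc1 => //; rewrite gt_eqF.
  apply: cvgM; last exact: cvg_cst.
  apply: cvg_profile'; [|exact: cvg_inv_succ|exact: cvg_trunc].
  (* The profile is smooth unless it vanishes, which needs [height x = c]. *)
  rewrite height_offaxis// max_l ?(ltW lp)// -sqrf_eq0 profile_sqr.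
  rewrite gt_eqF//; have : 0 < (limit_potential x - c) ^+ 2.
    by rewrite exprn_even_gt0//= subr_eq0.
  by have := sqr_ge0 d; rewrite expr0n /= addr0; lra.
- have mP := @measurable_punctured R.
  have ms : measurable_fun (punctured : set plane) (slope j).
    by apply: measurable_funTS; exact: measurable_slope.
  have mcont (f : R * R -> R) : continuous f -> measurable_fun (punctured : set plane) f.
    by move=> cf; apply: continuous_measurable2 => [|x _]; [exact: open_punctured|exact: cf].
  have mp : measurable_fun (punctured : set plane) (fun x => profile c d 0 (height x)).
    by apply: measurable_funTS; exact: measurable_profile.
  have mp' : measurable_fun (punctured : set plane) (fun x => profile' c d 0 (height x)).
    by apply: measurable_funTS; exact: measurable_profile'.
  apply: measurable_funD; apply: measurable_funM; rewrite //; do ?exact: mcont.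
  exact: measurable_funM.
Qed.

Lemma sum_ord2 (V : nmodType) (F : 'I_2 -> V) : \sum_(j < 2) F j = F 0 + F 1.
Proof.
by rewrite !big_ord_recl big_ord0 addr0; congr (_ + F _); apply/val_inj.
Qed.

Lemma sum2_energy_le (a b : 'I_2 -> R) (C : R) (Y : \bar R) : (0 <= Y)%E ->
  (forall j, (`|a j|%:E <= Y)%E) -> (forall j, `|b j| <= C) ->
  (`|\sum_(j < 2) a j * b j|%:E <= (2 * C)%:E * Y)%E.
Proof.
move=> Y0 aY bC; have C0 : 0 <= C by exact: le_trans (normr_ge0 _) (bC 0).
have h j : (`|a j * b j|%:E <= C%:E * Y)%E.
  by rewrite normrM EFinM muleC lee_pmul ?lee_fin.
rewrite sum_ord2; apply: (@le_trans _ _ (`|a 0 * b 0|%:E + `|a 1 * b 1|%:E)%E).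
  by rewrite -EFinD lee_fin ler_normD.
by rewrite mulr_natl mulr2n EFinD ge0_muleDl ?lee_fin// leeD.
Qed.

(** The limit of [integral_trunc_harmonic], where the integrand splits into the two
    parts of the outer variation, each of which is dominated separately. *)
Lemma stationary_identity (psi : R * R * 'cV[R]_1 -> 'cV[R]_1) : admissible B1 psi ->
  (\int[@leb2 R]_(x in punctured)
     (\sum_(j < 2) slope j x *
        (outer_x psi j x (height x) - outer_x psi j x (- height x)))%:E +
   \int[@leb2 R]_(x in punctured)
     (\sum_(j < 2) slope j x ^+ 2 *
        (outer_t psi x (height x) + outer_t psi x (- height x)))%:E = 0)%E.
Proof.
move=> ad; have [CO [K HK]] := C1field_outer ad; have CH := C1field_odd CO.
have mP := @measurable_punctured R.
have K0 : 0 <= K.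
  have B0 : B1 0 by apply/B1_sqr; rewrite /= !expr0n /= addr0 ltr01.
  have [|h _ _] := HK 0 0 B0; first by rewrite normr0 ler01.
  exact: le_trans (normr_ge0 _) h.
pose Hx j x t := outer_x psi j x t - outer_x psi j x (- t).
pose Ht x t := outer_t psi x t + outer_t psi x (- t).
have bH : field_bounded (fun x t => outer psi x t - outer psi x (- t)) Ht Hx (2 * K).
  move=> x t Bx /andP[t0 t1]; have n1 : `|t| <= 1 by rewrite ger0_norm.
  have n2 : `|- t| <= 1 by rewrite normrN.
  have [h1 h2 h3] := HK x t Bx n1; have [h4 h5 h6] := HK x (- t) Bx n2.
  rewrite mulr_natl mulr2n; split=> [||j].
  - by rewrite (le_trans (ler_normB _ _))// lerD.
  - by rewrite (le_trans (ler_normD _ _))// lerD.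
  - by rewrite (le_trans (ler_normB _ _))// lerD.
have Hx0 j x : Hx j x 0 = 0 by rewrite /Hx oppr0 subrr.
have hb x : punctured x -> 0 <= height x <= 1.
  by move=> [Bx _]; rewrite height_ge0 height_le1.
have E0 (x : R * R) : (0 <= 1 + energy_bound x)%E by rewrite adde_ge0// energy_bound_ge0.
have EE (x : R * R) : (energy_bound x <= 1 + energy_bound x)%E by rewrite leeDr// lee_fin.
pose A x := \sum_(j < 2) slope j x * Hx j x (height x).
pose B x := \sum_(j < 2) slope j x ^+ 2 * Ht x (height x).
have bA x : punctured x -> (`|A x|%:E <= (2 * (2 * K))%:E * (1 + energy_bound x))%E.
  move=> Px; apply: sum2_energy_le => // j.
    exact: le_energy1 (energy_bound_ge0 x) (slope_sqr_le j Px).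
  by have [_ _ h] := bH x _ Px.1 (hb x Px); exact: h.
have bB x : punctured x -> (`|B x|%:E <= (2 * (2 * K))%:E * (1 + energy_bound x))%E.
  move=> Px; apply: sum2_energy_le => // j.
    have -> : `|slope j x ^+ 2| = slope j x ^+ 2 by rewrite ger0_norm// sqr_ge0.
    by apply: le_trans (EE x); exact: slope_sqr_le.
  by have [_ h _] := bH x _ Px.1 (hb x Px); exact: h.
have ms j : measurable_fun (punctured : set plane) (slope j).
  by apply: measurable_funTS; exact: measurable_slope.
have mf (k : R * R -> R -> R) : continuous (fun z : R * R * R => k z.1 z.2) ->
    measurable_fun (punctured : set plane) (fun x => k x (height x)) /\
    measurable_fun (punctured : set plane) (fun x => k x (- height x)).
  move=> ck; split.
    apply: (@eq_measurable_fun _ _ plane R punctured (fun x => k x (1 * height x))).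
      by move=> x _; rewrite mul1r.
    exact: measurable_field.
  apply: (@eq_measurable_fun _ _ plane R punctured (fun x => k x ((- 1) * height x))).
    by move=> x _; rewrite mulN1r.
  exact: measurable_field.
have mA : measurable_fun (punctured : set plane) A.
  apply: measurable_sum => j; apply: measurable_funM => //.
  have [m1 m2] := mf (outer_x psi j) (C1field_cx CO (j := j)); exact: (measurable_funB m1 m2).
have mB : measurable_fun (punctured : set plane) B.
  apply: measurable_sum => j; apply: measurable_funM; first exact: measurable_funX.
  have [m1 m2] := mf (outer_t psi) (C1field_ct CO); exact: (measurable_funD m1 m2).
have iA := integrable_energy_dominated mA bA.
have iB := integrable_energy_dominated mB bB.
rewrite -/(A _) -/(B _).
suff : (\int[@leb2 R]_(x in punctured) (A x + B x)%:E = 0)%E.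
  by under eq_integral do rewrite EFinD; rewrite integralD.
refine (proj2 (@integral_limit0 R
   (fun N x => \sum_(j < 2) potential1 N j x *
     (Hx j x (truncation N x) + Ht x (truncation N x) * truncation1 N j x))
   (fun x => A x + B x) (2 * (2 * K) + 2 * (2 * K)) _ _ _ _ _)).
- move=> N x x0.
  have ct j : {for x, continuous (fun x => potential1 N j x *
      (Hx j x (truncation N x) + Ht x (truncation N x) * truncation1 N j x))}.
    exact: (cvgM (continuous_potential1 (N := N) (j := j) x0)
      (continuous_field_truncation (N := N) (j := j) CH x0)).
  rewrite (_ : (fun x => _) = (fun x => potential1 N 0 x *
      (Hx 0 x (truncation N x) + Ht x (truncation N x) * truncation1 N 0 x) +
    potential1 N 1 x *
      (Hx 1 x (truncation N x) + Ht x (truncation N x) * truncation1 N 1 x))).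
    exact: (cvgD (ct 0) (ct 1)).
  by apply/funext => y; rewrite sum_ord2.
- by move=> N; apply: (integral_trunc_harmonic N CH bH) => // x; rewrite oppr0 subrr.
- move=> N x Px; have [Bx x0] := Px.
  have [p0|p0] := ltP 0 (potential N x); last first.
    rewrite big1 ?normr0 => [|j _].
      by rewrite mule_ge0// lee_fin; lra.
    by rewrite (trunc_le0 p0).1 (trunc_le0 p0).2 Hx0 mulr0 addr0 mulr0.
  have [_ h2 h3] := bH x _ Bx (truncation_itv N Bx).
  have le1 j : ((potential1 N j x ^+ 2)%:E <= energy_bound x)%E.
    by apply: le_trans (energy_bound_ge N x); rewrite lee_fin potential1_sqr_le.
  have b1 := sum2_energy_le (E0 x)
    (fun j => le_energy1 (energy_bound_ge0 x) (le1 j)) h3.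
  have b2 := sum2_energy_le (E0 x)
    (fun j => le_trans (trunc1_sqr_le N j Px).1 (EE x)) (fun=> h2).
  rewrite (_ : \sum_(j < 2) _ = \sum_(j < 2) potential1 N j x * Hx j x (truncation N x)
      + \sum_(j < 2) potential1 N j x * truncation1 N j x * Ht x (truncation N x)); last first.
    by rewrite -big_split; apply: eq_bigr => j _; rewrite mulrDr mulrAC mulrA.
  rewrite EFinD ge0_muleDl ?lee_fin ?mulr_ge0//.
  by apply: le_trans (leeD b1 b2); rewrite -EFinD lee_fin ler_normD.
- apply: (ae_punctured (l := 0)) => x Px l0 _; have [Bx x0] := Px.
  rewrite (_ : (fun N => _) = (fun N => potential1 N 0 x * (Hx 0 x (truncation N x)
      + Ht x (truncation N x) * truncation1 N 0 x) + potential1 N 1 x * (Hx 1 x (truncation N x)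
      + Ht x (truncation N x) * truncation1 N 1 x))); last by apply/funext => N; rewrite sum_ord2.
  rewrite (_ : A x + B x = slope 0 x * (Hx 0 x (height x) + Ht x (height x) * slope 0 x)
      + slope 1 x * (Hx 1 x (height x) + Ht x (height x) * slope 1 x)); last first.
    by rewrite /A /B !sum_ord2; ring.
  suff cj j : potential1 N j x * (Hx j x (truncation N x)
      + Ht x (truncation N x) * truncation1 N j x) @[N --> \oo] -->
      slope j x * (Hx j x (height x) + Ht x (height x) * slope j x).
    exact: (cvgD (cj 0) (cj 1)).
  case: (ltgtP (limit_potential x) 0) l0 => // [ln|lp] _.
    have -> : slope j x = 0 by rewrite /slope ltNge (ltW ln) andbF.
    rewrite mul0r; apply: cvg_near_cst.
    apply: filterS (near_potential_lt0 x0 ln) => N pN.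
    by rewrite (trunc_le0 pN).1 (trunc_le0 pN).2 Hx0 !mulr0 addr0 mulr0.
  have cT := cvg_trunc x0.
  have l0 : limit_potential x != 0 by rewrite gt_eqF.
  apply: cvgM.
    by rewrite slope_offaxis// lp mul1r; exact: cvg_potential1.
  have c1 : Hx j x (truncation N x) @[N --> \oo] --> Hx j x (height x) :=
    cvg_field (x := x) (C1field_cx CH (j := j)) cT.
  have c2 : Ht x (truncation N x) @[N --> \oo] --> Ht x (height x) :=
    cvg_field (x := x) (C1field_ct CH) cT.
  have c3 : truncation1 N j x @[N --> \oo] --> slope j x by exact: cvg_trunc1.
  exact: (cvgD c1 (cvgM c2 c3)).
- exact: (@measurable_funD _ plane R punctured A B mA mB).
Qed.

End limit_identities.

(** * Pairs of points *)

Section two_points.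
Variables (R : realType) (n : nat).
Notation V := 'cV[R]_n.

Lemma dirac_sum2E (p : 'I_2 -> V) (x : V) :
  (dirac_sum p) x = ((x == p 0%R) + (x == p 1%R))%N.
Proof.
rewrite /dirac_sum !big_ord_recl big_ord0 msetD0 msetE2 !msetnE.
have -> : lift ord0 ord0 = 1%R :> 'I_2 by apply/val_inj.
by case: (x == _); case: (x == _).
Qed.

(** Counting occurrences determines the enumeration up to the transposition. *)
Lemma dirac_sum2_inj (p s : 'I_2 -> V) : dirac_sum p = dirac_sum s ->
  (p 0%R = s 0%R /\ p 1%R = s 1%R) \/ (p 0%R = s 1%R /\ p 1%R = s 0%R).
Proof.
move=> e; have E x : ((x == p 0%R) + (x == p 1%R) = (x == s 0%R) + (x == s 1%R))%N.
  by rewrite -!dirac_sum2E e.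
have [e0|n0] := eqVneq (p 0%R) (s 0%R).
  left; split => //; have := E (p 1%R); rewrite e0 eqxx => /eqP.
  by rewrite eqn_add2l; case: (p 1%R =P s 1%R).
right; have e1 : p 0%R = s 1%R.
  have := E (p 0%R); rewrite eqxx (negbTE n0) add0n.
  by case: (p 0%R =P s 1%R) => //; case: (_ == _).
split => //; have := E (p 1%R); rewrite e1 eqxx addnC => /eqP.
by rewrite eqn_add2r; case: (p 1%R =P s 0%R).
Qed.

Lemma ord2_cases (i : 'I_2) : i = 0%R \/ i = 1%R.
Proof. by case: i => -[|[|//]] ?; [left|right]; apply/val_inj. Qed.

(** The only permutations are the identity and the transposition. *)
Lemma big_min_S2 (d : 'S_2 -> R) :
  \big[Num.min/d 1%g]_(sigma : 'S_2) d sigma = Num.min (d 1%g) (d (tperm 0%R 1%R)).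
Proof.
have S2 (s : 'S_2) : s = 1%g \/ s = tperm 0%R 1%R.
  have [e|e] := ord2_cases (s 0%R); [left|right]; apply/permP => i.
  - rewrite perm1; case: (ord2_cases i) => ->; first exact: e.
    have [e1|//] := ord2_cases (s 1%R).
    by have : s 1%R = s 0%R by [rewrite e e1]; move/perm_inj.
  - case: (ord2_cases i) => ->; first by rewrite tpermL.
    rewrite tpermR; have [//|e1] := ord2_cases (s 1%R).
    by have : s 1%R = s 0%R by [rewrite e e1]; move/perm_inj.
apply/eqP; rewrite eq_le le_min -andbA; apply/and3P; split.
- by apply: bigmin_le_id.
- exact: bigmin_le.
- by apply/bigmin_geP; split=> [|s _]; [|case: (S2 s) => ->]; rewrite ge_min lexx ?orbT.
Qed.

Lemma match_dist1 (p s : 'I_2 -> V) : match_dist p s 1%g =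
  Num.sqrt (enorm (p 0%R - s 0%R) ^+ 2 + enorm (p 1%R - s 1%R) ^+ 2).
Proof. by rewrite /match_dist sum_ord2 !perm1. Qed.

Lemma match_dist_tperm (p s : 'I_2 -> V) : match_dist p s (tperm 0%R 1%R) =
  Num.sqrt (enorm (p 0%R - s 1%R) ^+ 2 + enorm (p 1%R - s 0%R) ^+ 2).
Proof. by rewrite /match_dist sum_ord2 tpermL tpermR. Qed.

Lemma atoms_qpoint (p : 'I_2 -> V) :
  (atoms (qpoint p) 0%R = p 0%R /\ atoms (qpoint p) 1%R = p 1%R) \/
  (atoms (qpoint p) 0%R = p 1%R /\ atoms (qpoint p) 1%R = p 0%R).
Proof. by apply: dirac_sum2_inj; rewrite /atoms; case: cid. Qed.

(** Transposing the chosen enumerations at most exchanges the two matchings. *)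
Lemma Gdist2 (p s : 'I_2 -> V) : Gdist (qpoint p) (qpoint s) =
  Num.min (Num.sqrt (enorm (p 0%R - s 0%R) ^+ 2 + enorm (p 1%R - s 1%R) ^+ 2))
          (Num.sqrt (enorm (p 0%R - s 1%R) ^+ 2 + enorm (p 1%R - s 0%R) ^+ 2)).
Proof.
rewrite /Gdist big_min_S2 match_dist1 match_dist_tperm.
have [[-> ->]|[-> ->]] := atoms_qpoint p; have [[-> ->]|[-> ->]] := atoms_qpoint s => //.
- by rewrite minC.
- by rewrite minC; congr Num.min; rewrite addrC.
- by congr Num.min; rewrite addrC.
Qed.

Lemma AQ2_qpoint (T : AQ R 2 n) : exists p, T = qpoint p.
Proof.
case: T => T e; have [p h] := e; exists p; rewrite /qpoint.
by subst T; congr exist; exact: Prop_irrelevance.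
Qed.

End two_points.

Section sheets.
Variable R : realType.

Definition pair_of (a b : R) (i : 'I_2) : 'cV[R]_1 := const_mx (if i == 0 then a else b).

Definition sheets (t : R) : AQ R 2 1 := qpoint (pair_of t (- t)).

Lemma pair_of_entries (p : 'I_2 -> 'cV[R]_1) : p = pair_of (p 0 0 0) (p 1 0 0).
Proof.
apply/funext => i; apply/matrixP => k l; rewrite mxE !ord1.
by case: (ord2_cases i) => ->.
Qed.

Lemma enorm_sub_const (a b : R) : enorm (const_mx a - const_mx b : 'cV[R]_1) ^+ 2 = (a - b) ^+ 2.
Proof.
rewrite (_ : _ - _ = const_mx (a - b)); last by apply/matrixP => i j; rewrite !mxE.
by rewrite enorm_const_mx real_normK ?num_real.
Qed.

Lemma Gdist_pair (a b c d : R) : Gdist (qpoint (pair_of a b)) (qpoint (pair_of c d)) =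
  Num.min (Num.sqrt ((a - c) ^+ 2 + (b - d) ^+ 2)) (Num.sqrt ((a - d) ^+ 2 + (b - c) ^+ 2)).
Proof. by rewrite Gdist2 /pair_of /= !enorm_sub_const. Qed.

(** As [t] is non-negative, the better matching is the one that preserves the order
    of the two values, whence the absolute value. *)
Lemma Gdist_sheets (t a b : R) : 0 <= t ->
  Gdist (sheets t) (qpoint (pair_of a b)) = profile (`|a - b| / 2) ((a + b) / 2) 0 t.
Proof.
move=> t0; rewrite Gdist_pair /profile.
have s0 (u v : R) : 0 <= u ^+ 2 + v ^+ 2 by rewrite addr_ge0 ?sqr_ge0.
have [ab|ab] := leP b a.
  rewrite ger0_norm ?subr_ge0// min_l ?ler_sqrt//; last by nra.
  by congr Num.sqrt; field.
rewrite ltr0_norm ?subr_lt0// min_r ?ler_sqrt//; last by nra.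
by congr Num.sqrt; field.
Qed.

Lemma AQ2_pair (T : AQ R 2 1) : exists a b, T = qpoint (pair_of a b).
Proof.
by have [p ->] := AQ2_qpoint T; exists (p 0 0 0), (p 1 0 0); rewrite -pair_of_entries.
Qed.

Lemma Gdist_sheets_le (t s : R) : Gdist (sheets t) (sheets s) <= 2 * `|t - s|.
Proof.
rewrite /sheets Gdist_pair ge_min; apply/orP; left.
rewrite -ler_sqr ?nnegrE ?sqrtr_ge0 ?mulr_ge0// sqr_sqrtr ?addr_ge0 ?sqr_ge0//.
rewrite exprMn real_normK ?num_real//; have := sqr_ge0 (t - s); nra.
Qed.

Lemma open_sheets (U : set (AQ R 2 1)) : Gopen U -> open [set t | U (sheets t)].
Proof.
move=> oU; rewrite openE => t /= Ut; have [r r0 rU] := oU _ Ut.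
apply/nbhs_ballP; exists (r / 2) => /=; first by rewrite divr_gt0.
move=> s; rewrite /ball /= => ts; apply: rU.
by apply: (le_lt_trans (Gdist_sheets_le t s)); rewrite -ltr_pdivlMl// mulrC.
Qed.

End sheets.

(** * The map is in the Sobolev space *)

Section sobolev_sheets.
Variable R : realType.
Notation plane := (measurableTypeR R * measurableTypeR R)%type.
Notation offaxis := (@offaxis R).
Notation punctured := (@punctured R).
Notation B1 := (eball (0 : R * R) 1).

Definition sheets_map (x : R * R) : AQ R 2 1 := sheets (height x).

Lemma B1_setD_axis : B1 `\` ~` offaxis = punctured.
Proof. by rewrite setDE setCK. Qed.

Lemma integrable_B1 (g : R * R -> R) : measurable_fun (setT : set plane) g ->
  (@leb2 R).-integrable punctured (EFin \o g) -> (@leb2 R).-integrable B1 (EFin \o g).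
Proof.
move=> mg ig; have [mN n0] := axis_null R.
apply/(negligible_integrable mN (@measurable_B1 R)) => //.
  by apply/measurable_EFinP; exact: measurable_funTS.
by rewrite B1_setD_axis.
Qed.

Lemma integral_B1 (g : R * R -> \bar R) :
  (\int[@leb2 R]_(x in B1) g x = \int[@leb2 R]_(x in punctured) g x)%E.
Proof.
have [mN n0] := axis_null R.
rewrite -B1_setD_axis.
exact: (@integral_setD_null R _ plane (@lebesgue_measure R \x @lebesgue_measure R)%E B1 _ g mN n0).
Qed.

Lemma L2_dominated (g : R * R -> R) (C : R) : measurable_fun (setT : set plane) g ->
  (forall x, punctured x -> ((g x ^+ 2)%:E <= C%:E * (1 + energy_bound x))%E) -> L2 B1 g.
Proof.
move=> mg gC; split; first exact: measurable_funTS.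
have mg2 : measurable_fun (setT : set plane) (fun x => g x ^+ 2) by exact: measurable_funX.
apply: (integrable_B1 mg2); apply: (@integrable_energy_dominated R _ C).
  by apply: measurable_funTS; exact: mg2.
by move=> x Px; rewrite ger0_norm ?sqr_ge0//; exact: gC.
Qed.

(** The two terms of [weak_identity] are integrable, so their integrals are
    opposite. *)
Lemma weak_partial_profile (c d : R) (j : 'I_2) :
  weak_partial B1 j (fun x => profile c d 0 (height x))
    (fun x => profile' c d 0 (height x) * slope j x).
Proof.
move=> phi tf; have [cphi cD _ _ [M HM]] := test_function_C1 tf.
have M0 : 0 <= M by exact: le_trans (normr_ge0 _) (HM 0).1.
pose a x : R := profile c d 0 (height x) * 'D_(e2 R j) phi x.
pose b x : R := profile' c d 0 (height x) * slope j x * phi x.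
have mcont (f : R * R -> R) : continuous f -> measurable_fun (punctured : set plane) f.
  by move=> cf; apply: continuous_measurable2 => [|x _]; [exact: open_punctured|exact: cf].
have ma : measurable_fun (punctured : set plane) a.
  apply: measurable_funM; last exact: mcont.
  by apply: measurable_funTS; exact: measurable_profile.
have mb : measurable_fun (punctured : set plane) b.
  apply: measurable_funM; last exact: mcont.
  apply: measurable_funTS; apply: measurable_funM; first exact: measurable_profile'.
  exact: measurable_slope.
have ia : (@leb2 R).-integrable punctured (EFin \o a).
  apply: (@bounded_integrable_punctured R a (2 * (2 + `|c| + `|d|) * M) ma) => x [Bx _].
  rewrite normrM ler_pM//; last exact: (HM x).2.
  rewrite ger0_norm ?profile_ge0//; apply: profile_le; last by rewrite lexx ler01.
  by rewrite height_ge0 height_le1.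
have ib : (@leb2 R).-integrable punctured (EFin \o b).
  apply: (@integrable_energy_dominated R b (2 * M) mb) => x Px.
  have sE := le_energy1 (energy_bound_ge0 x) (slope_sqr_le j Px).
  apply: (@le_trans _ _ ((2 * M)%:E * `|slope j x|%:E)%E); last first.
    by rewrite lee_pmul ?lee_fin ?mulr_ge0.
  rewrite -EFinM lee_fin /b 2!normrM -mulrA (mulrC `|slope j x|) mulrA ler_wpM2r//.
  by rewrite ler_pM// ?profile'_le2//; exact: (HM x).1.
have := weak_identity c d j tf; under eq_integral do rewrite EFinD.
rewrite (integralD (@measurable_punctured R) ia ib) => /eqP.
rewrite /Rintegral !integral_B1.
have fa := integrable_fin_num (@measurable_punctured R) ia.
have fb := integrable_fin_num (@measurable_punctured R) ib.
rewrite -(fineK fa) -(fineK fb) -EFinD eqe addr_eq0 => /eqP h.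
exact: h.
Qed.

Lemma qmeasurable_sheets : qmeasurable B1 sheets_map.
Proof.
move=> U oU; have mU : measurable (@height R @^-1` [set t | U (sheets t)] : set plane).
  rewrite -[X in measurable X]setTI; apply: (@measurable_height R) => //.
  by apply: open_measurable; exact: open_sheets.
exact: (measurableI _ _ (@measurable_B1 R) mU).
Qed.

Lemma qW12_sheets : qW12 B1 sheets_map.
Proof.
split; first exact: qmeasurable_sheets.
have ms j := @measurable_slope R j.
have L2s (u : R * R -> R) j : measurable_fun (setT : set plane) u ->
    (forall x, `|u x| <= 2 * `|slope j x|) -> L2 B1 u.
  move=> mu us; apply: (@L2_dominated _ 4) => // x Px.
  apply: (@le_trans _ _ (4%:E * (slope j x ^+ 2)%:E)%E).
    rewrite -EFinM lee_fin -(real_normK (num_real (u x))) -(real_normK (num_real (slope j x))).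
    by have := us x; have := normr_ge0 (u x); have := normr_ge0 (slope j x); nra.
  rewrite lee_pmul ?lee_fin ?sqr_ge0//.
  by apply: le_trans (slope_sqr_le j Px) _; rewrite leeDr// lee_fin.
(* [profile'] is at most 2 in modulus, whatever the Q-point. *)
exists (fun j x => 2 * `|slope j x|); split.
  move=> j; apply: (@L2s _ j).
    by apply: measurable_funM; [exact: measurable_cst|exact: measurableT_comp].
  by move=> x; rewrite ger0_norm// mulr_ge0.
move=> T; have [a [b ->]] := AQ2_pair T.
exists (fun j x => profile' (`|a - b| / 2) ((a + b) / 2) 0 (height x) * slope j x).
set c := `|a - b| / 2; set d := (a + b) / 2.
have bnd j x : `|profile' c d 0 (height x) * slope j x| <= 2 * `|slope j x|.
  by rewrite normrM ler_wpM2r// profile'_le2.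
have mh j : measurable_fun (setT : set plane)
    (fun x => profile' c d 0 (height x) * slope j x).
  by apply: measurable_funM; [exact: measurable_profile'|exact: measurable_slope].
have -> : (fun x => Gdist (sheets_map x) (qpoint (pair_of a b))) =
    (fun x => profile c d 0 (height x)).
  by apply/funext => x; rewrite Gdist_sheets// height_ge0.
split; last by move=> j; exact: aeW.
split.
  apply: (@L2_dominated _ ((2 * (2 + `|c| + `|d|)) ^+ 2)); first exact: measurable_profile.
  move=> x [Bx _]; rewrite -[leLHS]mule1 lee_pmul ?lee_fin ?sqr_ge0//; last first.
    by rewrite leeDl// energy_bound_ge0.
  rewrite lerXn2r ?nnegrE ?profile_ge0 ?mulr_ge0 ?addr_ge0//.
  by rewrite profile_le ?lexx ?ler01// height_ge0 height_le1.
by move=> j; split; [apply: (@L2s _ j)|exact: weak_partial_profile].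
Qed.

End sobolev_sheets.

(** * Sets of density one *)

Section density.
Variable R : realType.
Notation plane := (measurableTypeR R * measurableTypeR R)%type.
Notation len k := (enorm (vec2 k)).
Implicit Types (x y k : R * R) (E : set (R * R)).

Lemma len_sqr k : len k ^+ 2 = k.1 ^+ 2 + k.2 ^+ 2.
Proof. by rewrite enorm_vec2 sqr_sqrtr// addr_ge0 ?sqr_ge0. Qed.

Lemma len_ge0 k : 0 <= len k.
Proof. exact: sqrtr_ge0. Qed.

Lemma fst_le_len k : `|k.1| <= len k.
Proof.
rewrite -ler_sqr ?nnegrE ?len_ge0// real_normK ?num_real// len_sqr.
by rewrite lerDl sqr_ge0.
Qed.

Lemma snd_le_len k : `|k.2| <= len k.
Proof.
rewrite -ler_sqr ?nnegrE ?len_ge0// real_normK ?num_real// len_sqr.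
by rewrite lerDr sqr_ge0.
Qed.

Lemma len_le k : len k <= `|k.1| + `|k.2|.
Proof.
rewrite -ler_sqr ?nnegrE ?len_ge0 ?addr_ge0// len_sqr.
rewrite -(real_normK (num_real k.1)) -(real_normK (num_real k.2)).
by have := normr_ge0 k.1; have := normr_ge0 k.2; nra.
Qed.

Lemma nbhs_eball x (r : R) : 0 < r -> nbhs x (eball x r).
Proof.
move=> r0; apply: open_nbhs_nbhs; split; first exact: open_eball.
by apply/eball_sqr => //; rewrite !subrr expr0n /= addr0 exprn_gt0.
Qed.

Lemma near_within_eball E x (P : R * R -> Prop) :
  (\forall y \near within E x^', P y) ->
  exists2 r : R, 0 < r & forall y, E y -> y != x -> len (y - x) < r -> P y.
Proof.
move=> /nbhs_ballP[r /= r0 H]; exists r => // y Ey yx yr.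
apply: H => //; split; rewrite /ball /= distrC; apply: le_lt_trans yr.
- exact: (fst_le_len (y - x)).
- exact: (snd_le_len (y - x)).
Qed.

Lemma leb2_eball_le x (r : R) : 0 < r -> (leb2 (eball x r) <= (4 * r ^+ 2)%:E)%E.
Proof.
move=> r0; have rr : - r <= r by lra.
have : eball x r `<=` `[x.1 - r, x.1 + r] `*` `[x.2 - r, x.2 + r].
  move=> y yr; rewrite /= !in_itv /=.
  have := le_lt_trans (fst_le_len (y - x)) yr; have := le_lt_trans (snd_le_len (y - x)) yr.
  by rewrite /= !ltr_norml => /andP[? ?] /andP[? ?]; split; apply/andP; split; lra.
have mI (a b c d : R) : measurable (`[a, b] `*` `[c, d] : set plane).
  by apply: (@measurableX _ _ (measurableTypeR R) (measurableTypeR R)).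
move=> /(le_measure (@lebesgue_measure R \x @lebesgue_measure R)%E) h.
apply: (@le_trans _ _ (leb2 (`[x.1 - r, x.1 + r] `*` `[x.2 - r, x.2 + r]))).
  by apply: h; rewrite inE; [exact: (open_measurable2 (@open_eball R x r))|exact: mI].
by rewrite leb2_rect ?lee_fin; [nra|lra|lra].
Qed.

(** Otherwise [E] would miss a fixed fraction of arbitrarily small discs. *)
Lemma density_one_meets E x (c1 d1 c2 d2 : R) : measurable E -> density_one E x ->
  c1 < d1 -> c2 < d2 ->
  (forall u v : R, c1 <= u <= d1 -> c2 <= v <= d2 -> u ^+ 2 + v ^+ 2 < 1) ->
  exists2 rho : R, 0 < rho & forall r, 0 < r -> r < rho ->
    exists2 y, E y & (r * c1 <= (y - x).1 <= r * d1) && (r * c2 <= (y - x).2 <= r * d2).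
Proof.
move=> mE dE cd1 cd2 inB.
pose A := (d1 - c1) * (d2 - c2); have A0 : 0 < A by rewrite mulr_gt0 ?subr_gt0.
have A4 : 1 - A / 4 < 1 by rewrite ltrBlDr ltrDl divr_gt0.
have : nbhs (0 : R) (fun r => 0 < r ->
    1 - A / 4 < fine (leb2 (E `&` eball x r)) / fine (leb2 (eball x r))).
  exact: (cvgr_gt _ dE _ A4).
move=> /nbhs_ballP[rho /= rho0 H].
exists rho => // r r0 rr.
have {H} H : 1 - A / 4 < fine (leb2 (E `&` eball x r)) / fine (leb2 (eball x r)).
  by apply: H; rewrite // /ball /= sub0r normrN gtr0_norm.
apply: contrapT => nE.
pose S : set (R * R) := `[x.1 + r * c1, x.1 + r * d1] `*` `[x.2 + r * c2, x.2 + r * d2].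
have SB : S `<=` eball x r.
  move=> y; rewrite /S /= !in_itv /= => -[/andP[h1 h2] /andP[h3 h4]].
  apply/eball_sqr => //.
  have r1 : 0 < r^-1 by rewrite invr_gt0.
  have e z : z = r * (z / r) by field; rewrite gt_eqF.
  have := inB ((y.1 - x.1) / r) ((y.2 - x.2) / r).
  rewrite !ler_pdivlMr// !ler_pdivrMr//.
  rewrite !expr_div_n -mulrDl ltr_pdivrMr ?exprn_gt0// mul1r; apply; apply/andP; split; lra.
have mB : measurable (eball x r : set plane) by exact: (open_measurable2 (@open_eball R x r)).
have mS : measurable (S : set plane).
  by apply: (@measurableX _ _ (measurableTypeR R) (measurableTypeR R)).
have mEB : measurable (E `&` eball x r : set plane) by exact: measurableI.
have sS : leb2 S = (r ^+ 2 * A)%:E.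
  rewrite leb2_rect; last 2 first.
  - by rewrite lerD2l ler_wpM2l// ltW.
  - by rewrite lerD2l ler_wpM2l// ltW.
  by congr EFin; rewrite /A; ring.
have dis : (E `&` eball x r) `&` S = set0.
  apply/seteqP; split => // y [[Ey _]]; rewrite /S /= !in_itv /= => -[/andP[h1 h2] /andP[h3 h4]].
  by apply: nE; exists y => //=; rewrite -!andbA; apply/and4P; split; lra.
have sumle : (leb2 (E `&` eball x r) + (r ^+ 2 * A)%:E <= leb2 (eball x r))%E.
  rewrite -sS; have := measureU (@lebesgue_measure R \x @lebesgue_measure R)%E mEB mS dis.
  move=> <-; apply: (le_measure (@lebesgue_measure R \x @lebesgue_measure R)%E); rewrite ?inE//.
    exact: measurableU.
  by move=> y [[]|/SB].
have e0 : (0 <= leb2 (E `&` eball x r))%E by exact: measure_ge0.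
move: H sumle (leb2_eball_le x r0) e0.
case: (leb2 (eball x r)) => [b| |] //; case: (leb2 (E `&` eball x r)) => [e| |] //=.
rewrite -EFinD !lee_fin => H h1 h2 h3.
have rA : 0 < r ^+ 2 * A by rewrite mulr_gt0// exprn_gt0.
have b0 : 0 < b by lra.
by move: H; rewrite ltr_pdivlMr//; nra.
Qed.

(** The set contains, at all small scales, points in thin rectangles along each of
    the axes, where one of the two terms dominates. *)
Lemma linear_form_eq0 E x (a b : R) : measurable E -> density_one E x ->
  (forall eta, 0 < eta -> exists2 rho : R, 0 < rho & forall y, E y -> y != x ->
     len (y - x) < rho -> `|a * (y - x).1 + b * (y - x).2| <= eta * len (y - x)) ->
  a = 0 /\ b = 0.
Proof.
move=> mE dE H.
(* The points found at a small scale [r], scaled back to the unit disc. *)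
have pt (c1 d1 c2 d2 eta : R) : 0 <= c1 -> c1 < d1 -> d1 <= 2^-1 -> 0 <= c2 -> c2 < d2 ->
    d2 <= 2^-1 -> 0 < c1 + c2 -> 0 < eta ->
    exists u v : R, [/\ c1 <= u <= d1, c2 <= v <= d2 & `|a * u + b * v| <= eta].
  move=> c10 cd1 d12 c20 cd2 d22 cc eta0.
  have inB (u v : R) : c1 <= u <= d1 -> c2 <= v <= d2 -> u ^+ 2 + v ^+ 2 < 1.
    by move=> /andP[? ?] /andP[? ?]; nra.
  have [rho rho0 {}H] := H eta eta0.
  have [rho' rho'0 M] := density_one_meets mE dE cd1 cd2 inB.
  have m0 : 0 < Num.min rho rho' by rewrite lt_min rho0.
  pose r := Num.min rho rho' / 2.
  have r0 : 0 < r by rewrite divr_gt0.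
  have : r < Num.min rho rho' by rewrite /r; lra.
  rewrite lt_min => /andP[r1 r2].
  have [y Ey /andP[h12 h34]] := M r r0 r2.
  exists ((y - x).1 / r), ((y - x).2 / r); split.
  - by rewrite ler_pdivlMr// ler_pdivrMr// !(mulrC _ r).
  - by rewrite ler_pdivlMr// ler_pdivrMr// !(mulrC _ r).
  have r1' : 0 < r^-1 by rewrite invr_gt0.
  move: h12 h34 => /andP[h1 h2] /andP[h3 h4].
  have k1 : 0 <= (y - x).1 by apply: le_trans h1; rewrite mulr_ge0// ltW.
  have k2 : 0 <= (y - x).2 by apply: le_trans h3; rewrite mulr_ge0// ltW.
  have l1 : len (y - x) <= r.
    apply: (le_trans (len_le _)); rewrite (ger0_norm k1) (ger0_norm k2).
    have : r * d1 <= r * 2^-1 by rewrite ler_pM2l.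
    have : r * d2 <= r * 2^-1 by rewrite ler_pM2l.
    lra.
  have yx : y != x.
    apply: contraTneq cc => e; rewrite -leNgt; move: h1 h3; rewrite e subrr /=.
    by rewrite !pmulr_rle0//; lra.
  have := H y Ey yx (le_lt_trans l1 r1) => g.
  rewrite !mulrA -mulrDl normrM (gtr0_norm r1') ler_pdivrMr//.
  by apply: (le_trans g); rewrite ler_wpM2l// ltW.
have zero (p q : R) : (forall th eta : R, 0 < th -> th <= 2^-1 -> 0 < eta ->
    exists u v : R, [/\ 4^-1 <= u <= 2^-1, 0 <= v <= th & `|p * u + q * v| <= eta]) -> p = 0.
  move=> hpq; apply/eqP; apply: contrapT => /negP n0.
  have p0 : 0 < `|p| by rewrite normr_gt0.
  have D0 : 0 < 16 * (`|p| + `|q| + 1) by have := normr_ge0 q; lra.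
  (* Thin enough for [`|q| * th] to stay below a quarter of [`|p| / 4], the least
     value of [`|p * u|]. *)
  pose th := `|p| / (16 * (`|p| + `|q| + 1)).
  have th0 : 0 < th by rewrite divr_gt0.
  have th2 : th <= 2^-1 by rewrite ler_pdivrMr//; have := normr_ge0 q; lra.
  have qth : `|q| * th <= `|p| / 16.
    by rewrite mulrA ler_pdivrMr//; have := normr_ge0 q; nra.
  have eta0 : 0 < `|p| / 16 by rewrite divr_gt0.
  have [u [v [/andP[u1 u2] /andP[v1 v2] le]]] := hpq th (`|p| / 16) th0 th2 eta0.
  have u0 : 0 <= u by lra.
  have := lerB_dist (p * u) (- (q * v)); rewrite opprK normrN !normrM (ger0_norm u0) (ger0_norm v1).
  have : `|q| * v <= `|q| * th by rewrite ler_wpM2l.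
  have : `|p| * 4^-1 <= `|p| * u by rewrite ler_wpM2l// ltW.
  lra.
split.
- apply: (@zero a b) => th eta th0 th2 eta0.
  by apply: pt; lra.
- apply: (@zero b a) => th eta th0 th2 eta0.
  have [u [v [? ? le]]] : exists u v : R,
      [/\ 0 <= u <= th, 4^-1 <= v <= 2^-1 & `|a * u + b * v| <= eta] by apply: pt; lra.
  by exists v, u; split => //; rewrite addrC.
Qed.

Lemma leb2_eball_gt0 x (r : R) : 0 < r -> (0 < leb2 (eball x r))%E.
Proof.
move=> r0; apply: (@lt_le_trans _ _ (leb2 (`[x.1, x.1 + r / 2] `*` `[x.2, x.2 + r / 2]))).
  by rewrite leb2_rect ?lerDl ?divr_ge0 ?(ltW r0)// lte_fin; nra.
apply: (le_measure (@lebesgue_measure R \x @lebesgue_measure R)%E); rewrite ?inE.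
- by apply: (@measurableX _ _ (measurableTypeR R) (measurableTypeR R)).
- exact: (open_measurable2 (@open_eball R x r)).
- move=> y; rewrite /= !in_itv /= => -[/andP[h1 h2] /andP[h3 h4]].
  by apply/eball_sqr => //; nra.
Qed.

Lemma density_one_interior x (U : set (R * R)) : nbhs x U -> density_one U x.
Proof.
move=> /nbhs_ballP[rho /= rho0 H]; apply: cvg_near_cst.
apply: filterS2 (nbhs_right_gt 0) (nbhs_right_lt rho0) => r r0 rr.
have -> : U `&` eball x r = eball x r.
  apply/setIidPr => y yr; apply: H; split; rewrite /ball /= distrC; apply: le_lt_trans rr;
    apply: le_trans (ltW yr).
  - exact: (fst_le_len (y - x)).
  - exact: (snd_le_len (y - x)).
have := leb2_eball_gt0 x r0; have := leb2_eball_le x r0.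
by case: (leb2 (eball x r)) => [b| |] //= _; rewrite lte_fin => b0; rewrite divff// gt_eqF.
Qed.

End density.

(** * The differential, and stationarity *)

Section differential_of_sheets.
Variable R : realType.
Notation plane := (measurableTypeR R * measurableTypeR R)%type.
Notation offaxis := (@offaxis R).
Notation punctured := (@punctured R).
Notation B1 := (eball (0 : R * R) 1).
Notation limit_potential := (@limit_potential R).
Notation len k := (enorm (vec2 k)).
Implicit Types (x y k : R * R).

(** The sign of [limit_potential], hence the formula for [height], does not change
    near [x]. *)
Lemma height_linear x : offaxis x -> limit_potential x != 0 ->
  exists C delta : R, [/\ 0 <= C, 0 < delta & forall k, len k < delta ->
    `|height (x + k) - height x - (slope 0 x * k.1 + slope 1 x * k.2)| <= C * len k ^+ 2].
Proof.
move=> x0 l0; have x2 : 0 < `|x.2| by rewrite normr_gt0.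
pose p := limit_potential1 0 x; pose q := limit_potential1 1 x.
pose C : R := 19 / x.2 ^+ 2.
have C0 : 0 <= C by rewrite divr_ge0 ?sqr_ge0.
have L0 : 0 < `|limit_potential x| by rewrite normr_gt0.
pose S := `|p| + `|q| + C + 1.
have S0 : 0 < S by rewrite ltr_pwDr// !addr_ge0.
pose delta := Num.min 1 (Num.min (`|x.2| / 8) (`|limit_potential x| / S)).
exists C, delta; split => //; first by rewrite !lt_min ltr01 !divr_gt0.
move=> k; rewrite !lt_min => /and3P[k1 k2 k3].
have lk := len_ge0 k.
have kx : k.1 ^+ 2 + k.2 ^+ 2 <= x.2 ^+ 2 / 64.
  rewrite -len_sqr -(real_normK (num_real x.2)).
  rewrite (_ : _ / 64 = (`|x.2| / 8) ^+ 2); last by field.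
  by rewrite lerXn2r ?nnegrE ?divr_ge0// ltW.
have off : offaxis (x + k).
  apply/eqP => e; have e2 : `|x.2| = `|k.2|.
    by have /eqP := e; rewrite /= addr_eq0 => /eqP ->; rewrite normrN.
  by have := le_lt_trans (snd_le_len k) k2; rewrite -e2; lra.
have := limit_potential_quadratic x0 kx; rewrite -len_sqr -/p -/q -/C => est.
have lin : `|p * k.1 + q * k.2| <= (`|p| + `|q|) * len k.
  rewrite (le_trans (ler_normD _ _))// !normrM mulrDl lerD// ler_wpM2l//.
    exact: fst_le_len.
  exact: snd_le_len.
have near : `|limit_potential (x + k) - limit_potential x| < `|limit_potential x|.
  have l2 : len k ^+ 2 <= len k by rewrite expr2 ler_piMl// ltW.
  have : C * len k ^+ 2 <= C * len k by rewrite ler_wpM2l.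
  move: k3; rewrite ltr_pdivlMr// /S => k3.
  have := ler_normD (limit_potential (x + k) - limit_potential x - (p * k.1 + q * k.2))
    (p * k.1 + q * k.2).
  by rewrite subrK; lra.
rewrite !height_offaxis// !slope_offaxis//.
have [lp|lp] := ltP 0 (limit_potential x).
  have lpk : 0 < limit_potential (x + k).
    by move: near; rewrite (gtr0_norm lp) ltr_norml; lra.
  by rewrite !max_l ?(ltW lpk) ?(ltW lp)// !mul1r.
have ln : limit_potential x < 0 by rewrite lt_neqAle l0.
have lnk : limit_potential (x + k) < 0.
  by move: near; rewrite (ltr0_norm ln) ltr_norml; lra.
rewrite (max_r (ltW lnk)) !mul0r addr0 !subr0 normr0.
by rewrite mulr_ge0// sqr_ge0.
Qed.

Definition slope_row (s : R) x : 'M[R]_(1, 2) := \matrix_(i, j) (s * slope j x).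

Definition sheet_slopes x (i : 'I_2) : 'M[R]_(1, 2) := slope_row (if i == 0 then 1 else -1) x.

Lemma mul_row_vec2 (A : 'M[R]_(1, 2)) k : A *m vec2 k = const_mx (A 0 0 * k.1 + A 0 1 * k.2).
Proof. by apply/matrixP => a b; rewrite !mxE sum_ord2 !mxE !ord1. Qed.

Lemma sheets_expansion x y :
  qpoint (fun i => pair_of (height x) (- height x) i + sheet_slopes x i *m vec2 (y - x)) =
  sheets (height x + (slope 0 x * (y - x).1 + slope 1 x * (y - x).2)).
Proof.
rewrite /sheets; congr qpoint; apply/funext => i; apply/matrixP => a b.
rewrite mul_row_vec2 !mxE; case: (ord2_cases i) => -> /=; first by rewrite !mul1r.
by rewrite !mulN1r; ring.
Qed.

Lemma slope_height0 x j : height x = 0 -> punctured x -> slope j x = 0.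
Proof.
move=> h0 [_ x0]; rewrite slope_offaxis//; case: ltP => [lp|]; last by rewrite mul0r.
by move: h0; rewrite height_offaxis// max_l ?(ltW lp)// => h0; rewrite h0 ltxx in lp.
Qed.

Lemma approx_diff_sheets x : punctured x -> limit_potential x != 0 ->
  approx_diff B1 (@sheets_map R) x (pair_of (height x) (- height x), sheet_slopes x).
Proof.
move=> Px l0; have [Bx x0] := Px; split.
- by [].
- move=> i j; have [h0|h0] := eqVneq (height x) 0.
    move=> _; apply/matrixP => a b; rewrite !mxE !slope_height0//.
    by rewrite !mulr0.
  have hh : height x != - height x by rewrite -subr_eq0 opprK -mulr2n mulrn_eq0.
  by case: (ord2_cases i) => ->; case: (ord2_cases j) => -> //= /matrixP /(_ 0 0);
    rewrite !mxE /= => /eqP; rewrite ?(negbTE hh)// eq_sym (negbTE hh).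
have nB : nbhs x B1 by apply: open_nbhs_nbhs; split => //; exact: open_eball.
exists B1; split => //.
- exact: (@measurable_B1 R).
- exact: density_one_interior.
have [C [delta [C0 d0 est]]] := height_linear x0 l0.
suff h : (fun y => Gdist (sheets_map y) (qpoint (fun i =>
    pair_of (height x) (- height x) i + sheet_slopes x i *m vec2 (y - x)))
    / len (y - x)) @ x --> (0 : R).
  exact: (cvg_within_filter _ (cvg_within_filter _ h)).
apply/cvgrPdist_le => e e0.
pose r := Num.min delta (e / (2 * C + 1)).
have C1 : 0 < 2 * C + 1 by lra.
have r0 : 0 < r by rewrite lt_min d0 divr_gt0.
apply: filterS (nbhs_eball x r0) => y; rewrite /eball /= lt_min => /andP[y1 y2].
rewrite sheets_expansion sub0r normrN.
have G0 := Gdist_sheets_le (height y) (height x + (slope 0 x * (y - x).1 + slope 1 x * (y - x).2)).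
have := est (y - x) y1; rewrite (addrC x) subrK => ey.
have [k0|k0] := eqVneq (len (y - x)) 0; first by rewrite k0 invr0 mulr0 normr0 ltW.
have kp : 0 < len (y - x) by rewrite lt_def k0 len_ge0.
rewrite normrM normfV (gtr0_norm kp) ler_pdivrMr//.
have Gge : 0 <= Gdist (sheets_map y)
    (sheets (height x + (slope 0 x * (y - x).1 + slope 1 x * (y - x).2))).
  rewrite /sheets_map /sheets Gdist_pair le_min !sqrtr_ge0//.
rewrite ger0_norm//; apply: (le_trans G0).
rewrite opprD addrA; apply: (@le_trans _ _ (2 * (C * len (y - x) ^+ 2))).
  by rewrite ler_wpM2l.
move: y2; rewrite ltr_pdivlMr// => y2; rewrite expr2 !mulrA ler_wpM2r ?len_ge0//.
by have := len_ge0 (y - x); lra.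
Qed.

(** The hypothesis excludes the crossed matching, or makes the two matchings equal. *)
Lemma Gdist_branch (u w0 w1 : R) (g := Gdist (sheets u) (qpoint (pair_of w0 w1))) :
  g < u - w1 \/ w0 = w1 -> `|u - w0| <= g /\ `|u + w1| <= g.
Proof.
have le1 (a b : R) : `|a| <= Num.sqrt (a ^+ 2 + b ^+ 2).
  by rewrite -sqrtr_sqr ler_sqrt ?lerDl ?addr_ge0 ?sqr_ge0.
have le2 (a b : R) : `|b| <= Num.sqrt (a ^+ 2 + b ^+ 2) by rewrite addrC le1.
have e : `|u + w1| = `|- u - w1| by rewrite -opprD normrN.
have key : g < u - w1 \/ w0 = w1 ->
    Num.sqrt ((u - w0) ^+ 2 + (- u - w1) ^+ 2) <= g.
  rewrite /g /sheets Gdist_pair le_min lexx /= => -[lt|->]; last by [].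
  rewrite leNgt; apply/negP => lt2.
  have m : Num.min (Num.sqrt ((u - w0) ^+ 2 + (- u - w1) ^+ 2))
    (Num.sqrt ((u - w1) ^+ 2 + (- u - w0) ^+ 2)) = Num.sqrt ((u - w1) ^+ 2 + (- u - w0) ^+ 2).
    by rewrite min_r// ltW.
  rewrite m in lt; have := le1 (u - w1) (- u - w0); have := ler_norm (u - w1).
  lra.
move=> /key h; rewrite e; split; apply: le_trans h.
  exact: le1.
exact: le2.
Qed.

(** Along a set of density one both components stay close to the sheet of the same
    sign: the crossed matching costs about [2 * height x] if this is positive, and
    if it is 0 both components are equal. Each linear part thus differs from the
    one of the sheet by a form that is small along that set, hence zero. *)
Lemma approx_diff_unique x (D : 'I_2 -> 'M[R]_(1, 2)) : punctured x ->
  limit_potential x != 0 ->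
  approx_diff B1 (@sheets_map R) x (pair_of (height x) (- height x), D) ->
  D 0 = slope_row 1 x /\ D 1 = slope_row (-1) x.
Proof.
move=> Px l0 [_ De [E [mE EB Ex dE cE]]]; have [Bx x0] := Px.
have [C [delta [C0 d0 est]]] := height_linear x0 l0.
set h := height x in est De cE; have h0 : 0 <= h by exact: height_ge0.
pose M := `|slope 0 x| + `|slope 1 x| + (`|D 1 0 0| + `|D 1 0 1|).
have M0 : 0 <= M by rewrite !addr_ge0.
have lin (a b : R) k : `|a * k.1 + b * k.2| <= (`|a| + `|b|) * len k.
  rewrite (le_trans (ler_normD _ _))// !normrM mulrDl lerD// ler_wpM2l//.
    exact: fst_le_len.
  exact: snd_le_len.
have main (eta : R) : 0 < eta -> exists2 rho : R, 0 < rho & forall y, E y -> y != x ->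
    len (y - x) < rho ->
    `|(slope 0 x - D 0 0 0) * (y - x).1 + (slope 1 x - D 0 0 1) * (y - x).2| <= eta * len (y - x) /\
    `|(slope 0 x + D 1 0 0) * (y - x).1 + (slope 1 x + D 1 0 1) * (y - x).2| <= eta * len (y - x).
  move=> eta0; have eta2 : 0 < eta / 2 by rewrite divr_gt0.
  have [rho1 r10 H1] := near_within_eball (cvgr_lt _ cE _ eta2).
  (* Closer than [s] to [x], the crossed matching is too expensive. *)
  pose s := if h == 0 then 1 else 2 * h / (eta + M + 1).
  have D1 : 0 < eta + M + 1 by lra.
  have s0 : 0 < s.
    rewrite /s; case: (eqVneq h 0) => // hn; rewrite divr_gt0// mulr_gt0//.
    by rewrite lt_def hn.
  have D2 : 0 < 2 * (C + 1) by lra.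
  exists (Num.min (Num.min rho1 delta) (Num.min (eta / (2 * (C + 1))) s)).
    by rewrite !lt_min r10 d0 s0 divr_gt0.
  move=> y Ey yx; rewrite !lt_min => /andP[/andP[y1 y2] /andP[y3 y4]].
  have := H1 y Ey yx y1; have := est (y - x) y2; rewrite (addrC x) subrK.
  set k := y - x in y1 y2 y3 y4 *; have lk := len_ge0 k.
  have kp : 0 < len k.
    rewrite lt_def lk andbT; apply/eqP => e; move/eqP: yx; apply.
    have := fst_le_len k; have := snd_le_len k; rewrite e !normr_le0 => /eqP k2 /eqP k1.
    by apply/eqP; rewrite -subr_eq0 -/k; apply/eqP/pair_equal_spec.
  rewrite ltr_pdivrMr// => e1.
  rewrite (_ : qpoint _ = qpoint (pair_of (h + (D 0 0 0 * k.1 + D 0 0 1 * k.2))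
      (- h + (D 1 0 0 * k.1 + D 1 0 1 * k.2)))); last first.
    congr qpoint; apply/funext => i; apply/matrixP => a b.
    by rewrite mul_row_vec2 !mxE; case: (ord2_cases i) => ->.
  set w0 := D 0 0 0 * _ + _; set w1 := D 1 0 0 * _ + _; set g := Gdist _ _ => gk.
  set l := slope 0 x * k.1 + slope 1 x * k.2 in e1.
  have Ck : C * len k ^+ 2 <= eta / 2 * len k.
    rewrite expr2 mulrA ler_wpM2r//; move: y3; rewrite ltr_pdivlMr// => y3.
    lra.
  have ll : `|l - w1| <= M * len k.
    rewrite (le_trans (ler_normB _ _))// /M mulrDl; apply: lerD; exact: lin.
  have [b0 b1] : `|height y - (h + w0)| <= g /\ `|height y + (- h + w1)| <= g.
    apply: Gdist_branch; have [hz|hz] := eqVneq h 0.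
      right; have D01 : D 0 = D 1 by apply: De; rewrite /pair_of /= hz oppr0.
      by rewrite /w0 /w1 D01 hz oppr0.
    left; rewrite -/g; move: y4; rewrite /s (negbTE hz) ltr_pdivlMr// => y4.
    move: e1 ll; rewrite !ler_norml => /andP[e1 e1'] /andP[ll ll'].
    move: gk; rewrite -/k; nra.
  have -> : (slope 0 x - D 0 0 0) * k.1 + (slope 1 x - D 0 0 1) * k.2 = l - w0.
    by rewrite /l /w0; ring.
  have -> : (slope 0 x + D 1 0 0) * k.1 + (slope 1 x + D 1 0 1) * k.2 = l + w1.
    by rewrite /l /w1; ring.
  move: e1 b0 b1; rewrite !ler_norml => /andP[? ?] /andP[? ?] /andP[? ?].
  split; apply/andP; split; lra.
have z0 := linear_form_eq0 mE dE (a := slope 0 x - D 0 0 0) (b := slope 1 x - D 0 0 1).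
have z1 := linear_form_eq0 mE dE (a := slope 0 x + D 1 0 0) (b := slope 1 x + D 1 0 1).
have [a0 a1] : slope 0 x - D 0 0 0 = 0 /\ slope 1 x - D 0 0 1 = 0.
  by apply: z0 => eta /main[rho r0 H]; exists rho => // y Ey yx yr; have [] := H y Ey yx yr.
have [b0 b1] : slope 0 x + D 1 0 0 = 0 /\ slope 1 x + D 1 0 1 = 0.
  by apply: z1 => eta /main[rho r0 H]; exists rho => // y Ey yx yr; have [] := H y Ey yx yr.
by split; apply/matrixP => i j; rewrite !mxE !ord1; case: (ord2_cases j) => ->; lra.
Qed.

Definition swap2 (i : 'I_2) : 'I_2 := if i == 0 then 1 else 0.

Lemma qpoint_swap n (p : 'I_2 -> 'cV[R]_n) : qpoint (fun i => p (swap2 i)) = qpoint p.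
Proof.
apply: eq_exist; apply/msetP => v; rewrite !dirac_sum2E /swap2 /=.
exact: addnC.
Qed.

Lemma approx_diff_swap (f : R * R -> AQ R 2 1) x p D : approx_diff B1 f x (p, D) ->
  approx_diff B1 f x (fun i => p (swap2 i), fun i => D (swap2 i)).
Proof.
move=> [fx pD [E [mE EB Ex dE cE]]]; split.
- by rewrite qpoint_swap.
- by move=> i j; exact: pD.
- have e y : qpoint (fun i => p (swap2 i) + D (swap2 i) *m vec2 (y - x)) =
      qpoint (fun i => p i + D i *m vec2 (y - x)).
    exact: (qpoint_swap (fun i => p i + D i *m vec2 (y - x))).
  exists E; split; [exact: mE|exact: EB|exact: Ex|exact: dE|].
  by under eq_fun do rewrite e; exact: cE.
Qed.

(** Sums over the two sheets of the differential, which is determined up to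
    the order of its components. *)
Lemma sum_differential x (F : 'cV[R]_1 -> 'M[R]_(1, 2) -> R) : punctured x ->
  limit_potential x != 0 ->
  (let: (p, D) := differential B1 (@sheets_map R) x in \sum_(i < 2) F (p i) (D i)) =
  F (const_mx (height x)) (slope_row 1 x) + F (const_mx (- height x)) (slope_row (-1) x).
Proof.
move=> Px l0.
have : approx_diff B1 (@sheets_map R) x (differential B1 (@sheets_map R) x).
  exact: (xgetI _ (approx_diff_sheets Px l0 :
    [set pD | approx_diff B1 (@sheets_map R) x pD] _)).
case: (differential B1 (@sheets_map R) x) => p D ad; rewrite sum_ord2.
have [e _ _] := ad.
have [[p0 p1]|[p0 p1]] := dirac_sum2_inj (congr1 (@proj1_sig _ _) e).
- have pE : p = pair_of (height x) (- height x).
    by apply/funext => i; case: (ord2_cases i) => ->; rewrite -?p0 -?p1.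
  rewrite pE in ad; have [-> ->] := approx_diff_unique Px l0 ad.
  by rewrite pE.
- have pE : (fun i => p (swap2 i)) = pair_of (height x) (- height x).
    by apply/funext => i; case: (ord2_cases i) => ->; rewrite /swap2 /= -?p0 -?p1.
  have ad' := approx_diff_swap ad; rewrite pE in ad'.
  have [d0 d1] := approx_diff_unique Px l0 ad'.
  by rewrite -p0 -p1 -d0 -d1 /swap2 /= addrC.
Qed.

(** The differential is known only off the axis and the zero set of the potential,
    which are null. *)
Lemma weakly_stationary_sheets : weakly_stationary B1 (@sheets_map R).
Proof.
move=> psi ad; rewrite /outer_variation -[RHS](stationary_identity ad) !integral_B1.
have [m0 n0] := level_set_null (0 : R).
have full (F G : R * R -> \bar R) :
    (forall x, punctured x -> limit_potential x != 0 -> F x = G x) ->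
    (\int[@leb2 R]_(x in punctured) F x = \int[@leb2 R]_(x in punctured) G x)%E.
  move=> FG.
  have cut (H : R * R -> \bar R) := @integral_setD_null R _ plane
    (@lebesgue_measure R \x @lebesgue_measure R)%E punctured _ H m0 n0.
  rewrite /leb2 (cut F) (cut G); apply: eq_integral => x; rewrite inE => -[Px nx].
  apply: FG => //; apply/eqP => lx; apply: nx; split => //; exact: Px.2.
congr (_ + _)%E; apply: full => x Px l0; have [Bx x0] := Px.
- apply: (etrans (congr1 EFin
    (sum_differential (fun u A => mxdot A (Dx psi x u)) Px l0))).
  rewrite /mxdot !big_ord1 -big_split /=; congr EFin; apply: eq_bigr => j _.
  by rewrite !mxE /outer_x !(introT (asboolP _) Bx) !mxE; ring.
- apply: (etrans (congr1 EFin
    (sum_differential (fun u A => mxdot A (Du psi x u *m A)) Px l0))).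
  rewrite /mxdot !big_ord1 -big_split /=; congr EFin; apply: eq_bigr => j _.
  by rewrite !mxE !big_ord1 /outer_t !(introT (asboolP _) Bx) !mxE; ring.
Qed.

End differential_of_sheets.

(** * Discontinuity at the origin *)

Section discontinuity.
Variable R : realType.
Notation B1 := (eball (0 : R * R) 1).

(** A non-empty open set has positive measure. *)
Lemma open_meets_ae (U : set (R * R)) (P : R * R -> Prop) : open U -> U !=set0 ->
  {ae @leb2 R, forall x, P x} -> exists2 x, U x & P x.
Proof.
move=> oU [y Uy] [N [mN N0 PN]]; apply: contrapT => nU.
have UN : U `<=` N.
  by move=> x Ux; apply: PN => Px; apply: nU; exists x.
have /nbhs_ballP[r /= r0 H] : nbhs y U by exact: open_nbhs_nbhs.
have sub : eball y r `<=` N.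
  move=> z zr; apply: UN; apply: H; split; rewrite /ball /= distrC; apply: le_lt_trans zr.
  - exact: (fst_le_len (z - y)).
  - exact: (snd_le_len (z - y)).
have := leb2_eball_gt0 y r0.
have : (leb2 (eball y r) <= leb2 N)%E.
  apply: (le_measure (@lebesgue_measure R \x @lebesgue_measure R)%E); rewrite ?inE//.
  exact: (open_measurable2 (@open_eball R y r)).
by rewrite N0 => /le_lt_trans h /h; rewrite ltxx.
Qed.

(** [height] is at least [1 / 2] on the left half disc and vanishes on a disc around
    each pole, and both kinds of open sets come arbitrarily close to the origin.
    Two heights that far apart cannot both be matched with the Q-point [g 0]. *)
Lemma not_continuous_sheets (g : R * R -> AQ R 2 1) :
  {ae @leb2 R, forall x, B1 x -> g x = sheets_map x} -> ~ qcontinuous_at g 0.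
Proof.
have gap (t t' : R) : 2^-1 <= t -> `|t - t'| < 8^-1 -> `|0 - t'| < 8^-1 -> False.
  by move=> ?; rewrite !ltr_norml => /andP[? ?] /andP[? ?]; lra.
move=> ge cg.
have [a [b g0]] := AQ2_pair (g 0).
have aeo : {ae @leb2 R, forall x, @offaxis R x}.
  by have [mN n0] := axis_null R; exists (~` @offaxis R); split; [exact: mN|exact: n0|].
have ae2 : {ae @leb2 R, forall x, @offaxis R x /\ (B1 x -> g x = sheets_map x)}.
  by apply: (filterS2 (ae_filter_ringOfSetsType (@leb2 R)) _ aeo ge) => x.
have e0 : (0 : R) < 8^-1 by [].
have [r r0 near] : exists2 r : R, 0 < r & forall y, eball 0 r y -> Gdist (g y) (g 0) < 8^-1.
  have : nbhs (0 : R * R) (fun y => Gdist (g y) (g 0) < 8^-1).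
    exact: (cvgr_lt _ cg _ e0).
  move=> /nbhs_ballP[r /= r0 H].
  exists r => // y yr; apply: H; split; rewrite /ball /= distrC; apply: le_lt_trans yr.
  - exact: (fst_le_len (y - 0)).
  - exact: (snd_le_len (y - 0)).
pose s := Num.min r 1.
have s0 : 0 < s by rewrite lt_min r0 ltr01.
have [s1 sr] : s <= 1 /\ s <= r by split; rewrite ge_min lexx ?orbT.
have sB x : eball 0 s x -> B1 x /\ eball 0 r x.
  by rewrite /eball /= => xs; split; apply: lt_le_trans xs _.
set c : R := `|a - b| / 2; set d : R := (a + b) / 2.
have val x : eball 0 s x -> (B1 x -> g x = sheets_map x) -> profile c d 0 (height x) < 8^-1.
  move=> /sB[Bx xr] /(_ Bx) gx; have := near x xr.
  by rewrite gx g0 Gdist_sheets// height_ge0.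
have [x [xs x1] [x0 gx]] : exists2 x, (eball 0 s x /\ x.1 < 0) &
    @offaxis R x /\ (B1 x -> g x = sheets_map x).
  apply: open_meets_ae ae2.
    apply: openI; first exact: open_eball.
    exact: (open_comp (fun x _ => cvg_fst) (@open_lt R 0)).
  exists (- (s / 2), 0); split => /=; last by rewrite oppr_lt0 divr_gt0.
  by apply/eball_sqr => //=; rewrite subr0 subrr expr0n /= addr0; nra.
have [k ks] : exists k, @pole R k < s / 2.
  have s2 : 0 < s / 2 by rewrite divr_gt0.
  have c2 : (2^-1 : R) ^+ n @[n --> \oo] --> (0 : R).
    by apply: cvg_expr; rewrite ger0_norm//; lra.
  by have [N _ HN] := cvgr_lt _ c2 _ s2; exists N; apply: HN => /=; exact: leqnSn.
pose w := 4 * expR (- (weight R k)^-1).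
have w0 : 0 < w by rewrite mulr_gt0// expR_gt0.
have [y [ys y1] [y0 gy]] : exists2 y, (eball 0 s y /\ sqdist k y < w) &
    @offaxis R y /\ (B1 y -> g y = sheets_map y).
  apply: open_meets_ae ae2.
    apply: openI; first exact: open_eball.
    apply: (@open_comp _ _ (sqdist k) [set t | t < w]); last exact: open_lt.
    move=> z _; rewrite /sqdist; under eq_fun do rewrite !expr2.
    have c1 : fst z' - pole R k @[z' --> z] --> z.1 - pole R k.
      by apply: cvgB; [exact: cvg_fst|exact: cvg_cst].
    have c2 : snd z' @[z' --> z] --> z.2 by exact: cvg_snd.
    exact: (cvgD (cvgM c1 c1) (cvgM c2 c2)).
  exists (pole R k, 0); split => /=.
    by apply/eball_sqr => //=; rewrite subr0 subrr expr0n /= addr0; have := pole_gt0 R k; nra.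
  by rewrite /sqdist /= subrr expr0n /= addr0.
have hx : 2^-1 <= height x.
  rewrite height_offaxis// le_max limit_potential_left ?(ltW x1)//; exact: (sB x xs).1.
have hy : height y = 0.
  rewrite height_offaxis//; apply/max_idPr.
  by apply: (limit_potential_near_pole (k := k)) => //; [exact: (sB y ys).1|exact: ltW].
have p8 (t : R) : profile c d 0 t < 8^-1 -> `|t - c| < 8^-1.
  move=> pt; apply: le_lt_trans pt; rewrite -sqrtr_sqr ler_sqrt ?profile_arg_ge0//.
  by have := sqr_ge0 (t - c); have := sqr_ge0 d; rewrite expr0n /= addr0; lra.
apply: (gap (height x) c hx); first exact: (p8 _ (val x xs gx)).
by rewrite -hy; exact: (p8 _ (val y ys gy)).
Qed.

End discontinuity.

Theorem proposition1p6 (R : realType) :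
  let B1 := eball (0 : R * R) 1 in
  exists f : R * R -> AQ R 2 1,
    [/\ qW12 B1 f,
        weakly_stationary B1 f &
        forall g : R * R -> AQ R 2 1,
          {ae @leb2 R, forall x, B1 x -> g x = f x} ->
          ~ qcontinuous_at g 0].
Proof.
exists (@sheets_map R); split.
- exact: qW12_sheets.
- exact: weakly_stationary_sheets.
- exact: not_continuous_sheets.
Qed.
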